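(* Let $m>2$. The quantum superalgebra $U_q[osp(m|n)]$ has an infinite family of Casimir invariants (elements of its centre) of the form $$C_r=(\mathrm{str}\otimes\mathrm{id})\bigl((\pi(q^{2h_\rho})\otimes I)A^r\bigr),\qquad r\in\mathbb Z^+,$$ where $$A=\frac{R^TR-I\otimes I}{q-q^{-1}}\in(\mathrm{End}\,V)\otimes U_q[osp(m|n)].$$ The eigenvalues of these invariants acting on an arbitrary irreducible finite-dimensional module with highest weight $\Lambda$ are $$\chi_\Lambda(C_r)=\sum_{a\in\mathcal I}(-1)^{[a]}q^{C(\Lambda_0)-(\varepsilon_a,\varepsilon_a)}f(a)\left[\frac{q^{(\varepsilon_a,\varepsilon_a+2\rho+2\Lambda)-C(\Lambda_0)}-1}{q-q^{-1}}\right]^r\prod_{b\in\mathcal I,\,b\ne a}\frac{q^{(\varepsilon_a,2\rho+2\Lambda+\varepsilon_a)}-q^{(\varepsilon_b,2\rho+2\Lambda-\varepsilon_b)}}{q^{(\varepsilon_a,2\rho+2\Lambda+\varepsilon_a)}-q^{(\varepsilon_b,2\rho+2\Lambda+\varepsilon_b)}},$$ where $$f(a)=\begin{cases}1-(q-q^{-1})\dfrac{q}{q^{2(\varepsilon_a,\varepsilon_a+2\rho+2\Lambda)}-1},&m=2l,\\[2mm]1+(q-q^{-1})\dfrac{q^{(\varepsilon_a,\varepsilon_a+2\rho+2\Lambda)}}{q^{2(\varepsilon_a,\varepsilon_a+2\rho+2\Lambda)}-1},&\varepsilon_a\ne0,\ m=2l+1,\\[2mm]1,&\varepsilon_a=0,\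 m=2l+1.\end{cases}$$
   Context: Throughout $m>2$ and $n=2k\ge2$ are integers, $l=\lfloor m/2\rfloor$, and $q$ is a nonzero complex number that is not a root of unity (with fixed choices of the powers $q^x$ used). Indices. $\mathcal I$ is the disjoint union of even indices $i\in\{1,\dots,m\}$ (grading $[i]=0$, Latin letters) and odd indices $\mu\in\{1,\dots,n\}$ (grading $[\mu]=1$, Greek letters). Writing $i=1$ or $\mu=k$ as a subscript specifies the even index $1$ or the odd index $k$. Put $\overline{i}=m+1-i$, $\overline{\mu}=n+1-\mu$, and $\xi_i=1$, $\xi_\mu=(-1)^\mu$. Weights. To $a\in\mathcal I$ is attached a weight $\varepsilon_a$ (also written $\delta_\mu$ if $a=\mu$ is odd) with $\varepsilon_{\overline a}=-\varepsilon_a$ (so $\varepsilon_{l+1}=0$ if $m=2l+1$); $\varepsilon_1,\dots,\varepsilon_l,\delta_1,\dots,\delta_k$ are linearly independent, with bilinear form $(\varepsilon_i,\varepsilon_j)=\delta^i_j$, $(\delta_\mu,\delta_\nu)=-\delta^\mu_\nu$, $(\varepsilon_i,\delta_\mu)=0$ for $1\le i,j\le l$, $1\le\mu,\nu\le k$. The graded half-sum of positive roots is $\rho=\frac12\sum_{i=1}^l(m-2i)\varepsilon_i+\frac12\sum_{\mu=1}^k(n-m+2-2\mu)\delta_\mu$, and $C(\Lambda_0)=(\delta_1,\delta_1+2\rho)=m-n-1$. Simple roots: $\alpha_i=\varepsilon_i-\varepsilon_{i+1}$ ($1\le i<l$); $\alpha_l=\varepsilon_l+\varepsilon_{l-1}$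 if $m=2l$, $\alpha_l=\varepsilon_l$ if $m=2l+1$; $\alpha_\mu=\delta_\mu-\delta_{\mu+1}$ ($1\le\mu<k$); $\alpha_s=\delta_k-\varepsilon_1$ (the only odd simple root). $U_q[osp(m|n)]$ is the $\mathbb Z_2$-graded unital associative algebra generated by raising generators $e_c$, lowering generators $f_c$ (one pair for each simple root $\alpha_c$; $e_s,f_s$ odd, the rest even) and the Cartan subalgebra $H$, spanned by elements $h_\lambda$ linear in the weight $\lambda$, together with all $q^{h}$, $h\in H$; $h_c:=h_{\alpha_c}$. With graded commutator $[A,B]=AB-(-1)^{[A][B]}BA$, the relations are: $[h_\lambda,h_{\lambda'}]=0$, $[h_\lambda,e_c]=(\lambda,\alpha_c)e_c$, $[h_\lambda,f_c]=-(\lambda,\alpha_c)f_c$, $[e_c,f_d]=\delta^c_d\frac{q^{h_c}-q^{-h_c}}{q-q^{-1}}$, $[e_c,e_c]=[f_c,f_c]=0$ if $(\alpha_c,\alpha_c)=0$, and the standard and extra (higher order) $q$-Serre relations. In terms of $E_c=e_cq^{\frac12h_c}$ and $[E_c,x]_q=\mathrm{ad}E_c\circ x=E_cx-(-1)^{[E_c][x]}q^{(\alpha_c,\mathrm{wt}\,x)}xE_c$, the standard ones are $(\mathrm{ad}E_b\,\circ)^{1-a_{bc}}E_c=0$ for $b\ne c$ (where $a_{bc}=2(\alpha_b,\alpha_c)/(\alpha_b,\alpha_b)$ if $(\alpha_b,\alpha_b)\neq0$; and for $(\alpha_b,\alpha_b)=0$ the relation $\mathrm{ad}E_b\circ E_c=0$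 when $(\alpha_b,\alpha_c)=0$), and similarly for $F_c=f_cq^{\frac12h_c}$; the extra ones are those of the standard presentation of the quantum superalgebra for this Dynkin diagram (Yamane, Publ. RIMS 35 (1999)), e.g. for $k\ge2$: $[E_s,[E_{\mu=k-1},[E_s,E_{i=1}]_q]_q]_q=0=[E_s,[E_{i=1},[E_s,E_{\mu=k-1}]_q]_q]_q$. Tensor products are graded: $(a\otimes b)(c\otimes d)=(-1)^{[b][c]}ac\otimes bd$. The coproduct is the algebra homomorphism with $\Delta(e_c)=q^{\frac12h_c}\otimes e_c+e_c\otimes q^{-\frac12h_c}$, $\Delta(f_c)=q^{\frac12h_c}\otimes f_c+f_c\otimes q^{-\frac12h_c}$, $\Delta(q^{h})=q^{h}\otimes q^{h}$. The graded twist is $T(a\otimes b)=(-1)^{[a][b]}b\otimes a$ and $\Delta^T=T\Delta$. $U_q[osp(m|n)]^+$ (resp. $U_q[osp(m|n)]^-$) is the Hopf subsuperalgebra generated by the raising (resp. lowering) generators and Cartan elements. A universal $R$-matrix is an even invertible element $\mathcal R$ of (a suitable completion of) $U_q[osp(m|n)]^{\otimes2}$ with $\mathcal R\Delta(a)=\Delta^T(a)\mathcal R$ for all $a$, $(\mathrm{id}\otimes\Delta)\mathcal R=\mathcal R_{13}\mathcal R_{12}$, $(\Delta\otimes\mathrm{id})\mathcal R=\mathcal R_{13}\mathcal R_{23}$. Let $\mathcal R$ be the unique one in $U_q[osp(m|n)]^-\otimes U_q[osp(m|n)]^+$ (completed), arising from Drinfeld's double construction, and $\mathcal R^T=T\mathcal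 R$ its opposite. The Lax operator and its opposite are $R=(\pi\otimes\mathrm{id})\mathcal R$ and $R^T=(\pi\otimes\mathrm{id})\mathcal R^T$, with $\pi$ the vector representation below. Vector representation. $V$ is the $(m+n)$-dimensional graded space with homogeneous basis $|a\rangle$, $a\in\mathcal I$; $E^a_b|c\rangle=\delta^c_b|a\rangle$, and $E^a_b$ has grading $[a]+[b]$. Put $\Sigma^a_b=E^a_b-(-1)^{[a]([a]+[b])}\xi_a\xi_bE^{\overline b}_{\overline a}$. Then $\pi:U_q[osp(m|n)]\to\mathrm{End}\,V$ is given by $\pi(h_{\varepsilon_a})=(-1)^{[a]}\Sigma^a_a$; $\pi(e_i)=\Sigma^i_{i+1}$, $\pi(f_i)=\Sigma^{i+1}_i$ ($1\le i<l$); $\pi(e_l)=\Sigma^{l-1}_{\overline l}$, $\pi(f_l)=\Sigma^{\overline l}_{l-1}$ if $m=2l$; $\pi(e_l)=\Sigma^l_{l+1}$, $\pi(f_l)=\Sigma^{l+1}_l$ if $m=2l+1$; $\pi(e_\mu)=\Sigma^\mu_{\mu+1}$, $\pi(f_\mu)=-\Sigma^{\mu+1}_\mu$ ($1\le\mu<k$); $\pi(e_s)=\Sigma^{\mu=k}_{i=1}$, $\pi(f_s)=-\Sigma^{i=1}_{\mu=k}$. $h_\rho\in H$ is the element with $\lambda(h_\rho)=(\rho,\lambda)$ for all $\lambda\in H^*$, so $\pi(q^{2h_\rho})=\sum_aq^{2(\rho,\varepsilon_a)}E^a_a$. The supertrace is $\mathrm{str}(E^a_b)=(-1)^{[a]}\delta^a_b$.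 A module has highest weight $\Lambda$ if it is generated by a vector killed by all $e_c$ on which $h_\lambda$ acts as $(\lambda,\Lambda)$; $\chi_\Lambda(C_r)$ is the scalar by which $C_r$ acts. If some of the numbers $q^{(\varepsilon_a,\varepsilon_a+2\rho+2\Lambda)}$, $a\in\mathcal I$, coincide, so that denominators vanish, the right-hand side of the eigenvalue formula is understood as the value obtained by continuation in $\Lambda$ of the total expression (in which the singularities cancel). *)

(* Defs.v *)
From HB Require Import structures.
From mathcomp Require Import all_boot all_order all_algebra.
From mathcomp Require Import complex.
From mathcomp Require Import all_classical all_reals all_analysis.

Set Implicit Arguments.
Unset Strict Implicit.
Unset Printing Implicit Defensive.

Import Order.TTheory GRing.Theory Num.Theory numFieldNormedType.Exports.
Local Open Scope classical_set_scope.
Local Open Scope ring_scope.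

(*  A unital associative Z_2-graded K-algebra is a ring with a central ring
    morphism [cst] from K and the parity automorphism [par], equal to +1 on
    even and to -1 on odd elements.  [algType] is not used because it requires
    [1 != 0], which is not part of the data of an algebra presented by
    generators and relations. *)

HB.mixin Record PzRing_isSuperalg (K : fieldType) A of GRing.PzRing A := {
  cst : K -> A;
  cstD : forall c d, cst (c + d) = cst c + cst d;
  cstM : forall c d, cst (c * d) = cst c * cst d;
  cst1 : cst 1 = 1;
  cstC : forall c x, cst c * x = x * cst c;
  par : A -> A;
  parD : forall x y, par (x + y) = par x + par y;
  parM : forall x y, par (x * y) = par x * par y;
  par_cst : forall c, par (cst c) = cst c;
  parK : forall x, par (par x) = x
}.

#[short(type="superAlgType")]
HB.structure Definition Superalg (K : fieldType) :=
  {A of GRing.PzRing A & PzRing_isSuperalg K A}.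

Section SuperalgTheory.
Variables (K : fieldType) (A : superAlgType K).
Implicit Types x y : A.

Lemma cst0 : cst 0 = 0 :> A.
Proof. by apply: (@addrI _ (cst 0)); rewrite addr0 -cstD addr0. Qed.

Lemma cstN c : cst (- c) = - cst c :> A.
Proof. by apply: (@addrI _ (cst c)); rewrite -cstD !subrr cst0. Qed.

Lemma par0 : par 0 = 0 :> A.
Proof. by rewrite -cst0 par_cst. Qed.

Lemma par1 : par 1 = 1 :> A.
Proof. by rewrite -cst1 par_cst. Qed.

Definition parn (b : bool) x : A := if b then par x else x.

Definition homog (p : bool) x : Prop := par x = cst ((-1) ^+ p) * x.

Lemma parnD b x y : parn b (x + y) = parn b x + parn b y.
Proof. by case: b => //=; rewrite parD. Qed.

Lemma parn0 b : parn b 0 = 0.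
Proof. by case: b => //=; rewrite par0. Qed.

Lemma parnM b x y : parn b (x * y) = parn b x * parn b y.
Proof. by case: b => //=; rewrite parM. Qed.

Lemma parn_cst b c : parn b (cst c) = cst c.
Proof. by case: b => //=; rewrite par_cst. Qed.

Lemma parn_parn b c x : parn b (parn c x) = parn (b (+) c) x.
Proof. by case: b c => [] [] //=; rewrite parK. Qed.

Lemma parn_sum b (I : Type) (s : seq I) (P : pred I) (F : I -> A) :
  parn b (\sum_(i <- s | P i) F i) = \sum_(i <- s | P i) parn b (F i).
Proof. by apply: (big_morph (parn b)); [exact: parnD|exact: parn0]. Qed.

Lemma parn_homog b p x : homog p x -> parn b x = cst ((-1) ^+ (b && p)) * x.
Proof. by case: b => //= _; rewrite expr0 cst1 mul1r. Qed.
End SuperalgTheory.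

Record shom (K : fieldType) (A B : superAlgType K) := SHom {
  sfun :> A -> B;
  shomD : forall x y, sfun (x + y) = sfun x + sfun y;
  shomM : forall x y, sfun (x * y) = sfun x * sfun y;
  shom_cst : forall c, sfun (cst c) = cst c;
  shom_par : forall x, sfun (par x) = par (sfun x)
}.

Section Shom.
Variables (K : fieldType).
Implicit Types A B D : superAlgType K.

Lemma shom_homog A B (f : shom A B) p x : homog p x -> homog p (f x).
Proof. by rewrite /homog -shom_par => ->; rewrite shomM shom_cst. Qed.

Lemma shom1 A B (f : shom A B) : f 1 = 1.
Proof. by rewrite -(@cst1 _ A) shom_cst cst1. Qed.

Definition sid A : shom A A := @SHom K A A id (fun _ _ => erefl)
  (fun _ _ => erefl) (fun _ => erefl) (fun _ => erefl).

Program Definition scomp A B D (g : shom B D) (f : shom A B) : shom A D :=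
  @SHom K A D (g \o f) _ _ _ _.
Next Obligation. by move=> A B D g f x y /=; rewrite !shomD. Qed.
Next Obligation. by move=> A B D g f x y /=; rewrite !shomM. Qed.
Next Obligation. by move=> A B D g f x /=; rewrite !shom_cst. Qed.
Next Obligation. by move=> A B D g f x /=; rewrite !shom_par. Qed.
End Shom.

(*  [stm] is the set of superalgebra expressions in the generators [G], [scong]
    the least congruence containing the superalgebra axioms and the relations
    [rel], and [pres rel] the quotient, i.e. the superalgebra defined by [G] and
    [rel].  The degree of a generator is prescribed by a relation on [SPar]. *)

Inductive stm (K G : Type) :=
| SGen of G
| SCst of K
| SAdd of stm K G & stm K G
| SMul of stm K G & stm K G
| SPar of stm K G.
Arguments SGen {K G}.
Arguments SCst {K G}.

Declare Scope stm_scope.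
Delimit Scope stm_scope with stm.
Bind Scope stm_scope with stm.
Notation "x + y" := (SAdd x y) : stm_scope.
Notation "x * y" := (SMul x y) : stm_scope.
Notation "c *: x" := (SMul (SCst c) x) : stm_scope.
Notation "x - y" := (SAdd x (SMul (SCst (- 1)%R) y)) : stm_scope.
Notation "0" := (SCst 0%R) : stm_scope.
Notation "1" := (SCst 1%R) : stm_scope.

Section Pres.
Variables (K : fieldType) (G : Type) (rel : stm K G -> stm K G -> Prop).
Local Notation T := (stm K G).

Inductive scong : T -> T -> Prop :=
| sc_rel x y : rel x y -> scong x y
| sc_refl x : scong x x
| sc_sym x y : scong x y -> scong y x
| sc_trans x y z : scong x y -> scong y z -> scong x z
| sc_add x x' y y' : scong x x' -> scong y y' -> scong (x + y)%stm (x' + y')%stm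
| sc_mul x x' y y' : scong x x' -> scong y y' -> scong (x * y)%stm (x' * y')%stm
| sc_par x x' : scong x x' -> scong (SPar x) (SPar x')
| sc_addA x y z : scong (x + (y + z))%stm (x + y + z)%stm
| sc_addC x y : scong (x + y)%stm (y + x)%stm
| sc_add0 x : scong (0 + x)%stm x
| sc_addN x : scong ((- 1)%R *: x + x)%stm 0%stm
| sc_mulA x y z : scong (x * (y * z))%stm (x * y * z)%stm
| sc_mul1l x : scong (1 * x)%stm x
| sc_mul1r x : scong (x * 1)%stm x
| sc_mulDl x y z : scong ((x + y) * z)%stm (x * z + y * z)%stm
| sc_mulDr x y z : scong (x * (y + z))%stm (x * y + x * z)%stm
| sc_cstD c d : scong (SCst (c + d)) (SCst c + SCst d)%stm
| sc_cstM c d : scong (SCst (c * d)) (SCst c * SCst d)%stm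
| sc_cstC c x : scong (SCst c * x)%stm (x * SCst c)%stm
| sc_parD x y : scong (SPar (x + y)%stm) (SPar x + SPar y)%stm
| sc_parM x y : scong (SPar (x * y)%stm) (SPar x * SPar y)%stm
| sc_par_cst c : scong (SPar (SCst c)) (SCst c)
| sc_parK x : scong (SPar (SPar x)) x.

Definition scongb (x y : {classic T}) : bool := `[< scong x y >].

Lemma scongb_equiv : equiv_class_of scongb.
Proof.
split=> [x|x y|y x z].
- exact/asboolP/sc_refl.
- by apply/asboolP/asboolP; exact: sc_sym.
- by move=> /asboolP xy /asboolP yz; apply/asboolP; exact: sc_trans yz.
Qed.

Canonical scong_equiv := EquivRelPack scongb_equiv.

Definition pres := {eq_quot scong_equiv}%qT.
HB.instance Definition _ := Choice.on pres.
HB.instance Definition _ := EqQuotient.on pres.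

Definition pcls (x : T) : pres := (\pi_pres (x : {classic T}))%qT.

Lemma pclsP x y : reflect (scong x y) (pcls x == pcls y).
Proof. by rewrite /pcls eqmodE; exact: asboolP. Qed.

Lemma pcls_eq x y : scong x y -> pcls x = pcls y.
Proof. by move/pclsP/eqP. Qed.

Lemma pcls_repr (x : pres) : pcls (repr x : {classic T}) = x.
Proof. exact: reprK. Qed.

Lemma pcls_ind (P : pres -> Prop) : (forall t, P (pcls t)) -> forall x, P x.
Proof. by move=> H x; rewrite -(pcls_repr x). Qed.

Lemma repr_pcls t : scong (repr (pcls t) : {classic T}) t.
Proof. by apply/pclsP; rewrite pcls_repr. Qed.

Definition padd (x y : pres) : pres :=
  pcls (SAdd (repr x : {classic T}) (repr y : {classic T})).
Definition pmul (x y : pres) : pres :=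
  pcls (SMul (repr x : {classic T}) (repr y : {classic T})).
Definition ppar (x : pres) : pres := pcls (SPar (repr x : {classic T})).
Definition pcst (c : K) : pres := pcls (SCst c).
Definition popp (x : pres) : pres := pmul (pcst (- 1)) x.

Lemma paddE x y : padd (pcls x) (pcls y) = pcls (x + y)%stm.
Proof. by apply: pcls_eq; apply: sc_add; exact: repr_pcls. Qed.
Lemma pmulE x y : pmul (pcls x) (pcls y) = pcls (x * y)%stm.
Proof. by apply: pcls_eq; apply: sc_mul; exact: repr_pcls. Qed.
Lemma pparE x : ppar (pcls x) = pcls (SPar x).
Proof. by apply: pcls_eq; apply: sc_par; exact: repr_pcls. Qed.

Let paddA : associative padd.
Proof.
elim/pcls_ind=> x; elim/pcls_ind=> y; elim/pcls_ind=> z.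
by rewrite !paddE; apply: pcls_eq; exact: sc_addA.
Qed.
Let paddC : commutative padd.
Proof.
elim/pcls_ind=> x; elim/pcls_ind=> y.
by rewrite !paddE; apply: pcls_eq; exact: sc_addC.
Qed.
Let padd0 : left_id (pcst 0) padd.
Proof. by elim/pcls_ind=> x; rewrite paddE; apply: pcls_eq; exact: sc_add0. Qed.
Let paddN : left_inverse (pcst 0) popp padd.
Proof.
by elim/pcls_ind=> x; rewrite /popp pmulE paddE; apply: pcls_eq; exact: sc_addN.
Qed.
Let pmulA : associative pmul.
Proof.
elim/pcls_ind=> x; elim/pcls_ind=> y; elim/pcls_ind=> z.
by rewrite !pmulE; apply: pcls_eq; exact: sc_mulA.
Qed.
Let pmul1l : left_id (pcst 1) pmul.
Proof. by elim/pcls_ind=> x; rewrite pmulE; apply: pcls_eq; exact: sc_mul1l. Qed.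
Let pmul1r : right_id (pcst 1) pmul.
Proof. by elim/pcls_ind=> x; rewrite pmulE; apply: pcls_eq; exact: sc_mul1r. Qed.
Let pmulDl : left_distributive pmul padd.
Proof.
elim/pcls_ind=> x; elim/pcls_ind=> y; elim/pcls_ind=> z.
by rewrite !(pmulE, paddE); apply: pcls_eq; exact: sc_mulDl.
Qed.
Let pmulDr : right_distributive pmul padd.
Proof.
elim/pcls_ind=> x; elim/pcls_ind=> y; elim/pcls_ind=> z.
by rewrite !(pmulE, paddE); apply: pcls_eq; exact: sc_mulDr.
Qed.

HB.instance Definition _ :=
  GRing.isZmodule.Build pres paddA paddC padd0 paddN.
HB.instance Definition _ :=
  GRing.Zmodule_isPzRing.Build pres pmulA pmul1l pmul1r pmulDl pmulDr.

Let pcstD c d : pcst (c + d) = pcst c + pcst d.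
Proof. by rewrite [RHS]paddE; apply: pcls_eq; exact: sc_cstD. Qed.
Let pcstM c d : pcst (c * d) = pcst c * pcst d.
Proof. by rewrite [RHS]pmulE; apply: pcls_eq; exact: sc_cstM. Qed.
Let pcst1 : pcst 1 = 1. Proof. by []. Qed.
Let pcstC c (x : pres) : pcst c * x = x * pcst c.
Proof.
elim/pcls_ind: x => x; rewrite [LHS]pmulE [RHS]pmulE.
by apply: pcls_eq; exact: sc_cstC.
Qed.
Let pparD (x y : pres) : ppar (x + y) = ppar x + ppar y.
Proof.
elim/pcls_ind: x => x; elim/pcls_ind: y => y; rewrite /GRing.add /=.
by rewrite !(paddE, pparE); apply: pcls_eq; exact: sc_parD.
Qed.
Let pparM (x y : pres) : ppar (x * y) = ppar x * ppar y.
Proof.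
elim/pcls_ind: x => x; elim/pcls_ind: y => y; rewrite /GRing.mul /=.
by rewrite !(pmulE, pparE); apply: pcls_eq; exact: sc_parM.
Qed.
Let ppar_cst c : ppar (pcst c) = pcst c.
Proof. by rewrite pparE; apply: pcls_eq; exact: sc_par_cst. Qed.
Let pparK (x : pres) : ppar (ppar x) = x.
Proof. by elim/pcls_ind: x => x; rewrite !pparE; apply: pcls_eq; exact: sc_parK. Qed.

HB.instance Definition _ := PzRing_isSuperalg.Build K pres
  pcstD pcstM pcst1 pcstC pparD pparM ppar_cst pparK.

Definition pgen (g : G) : pres := pcls (SGen g).

Lemma pcls_add x y : pcls (x + y)%stm = pcls x + pcls y.
Proof. by rewrite -paddE. Qed.
Lemma pcls_mul x y : pcls (x * y)%stm = pcls x * pcls y.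
Proof. by rewrite -pmulE. Qed.
Lemma pcls_par x : pcls (SPar x) = par (pcls x).
Proof. by rewrite -pparE. Qed.
Lemma pcls_cst c : pcls (SCst c) = cst c.
Proof. by []. Qed.

Section Lift.
Variables (B : superAlgType K) (f : G -> B).

Fixpoint seval (t : T) : B :=
  match t with
  | SGen g => f g
  | SCst c => cst c
  | SAdd x y => seval x + seval y
  | SMul x y => seval x * seval y
  | SPar x => par (seval x)
  end.

Hypothesis frel : forall x y, rel x y -> seval x = seval y.

Lemma seval_cong x y : scong x y -> seval x = seval y.
Proof.
elim=> {x y} /=; do ?by [].
- by move=> x y z _ -> _ ->.
- by move=> x x' y y' _ -> _ ->.
- by move=> x x' y y' _ -> _ ->.
- by move=> x x' _ ->.
- by move=> x y z; rewrite addrA.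
- by move=> x y; rewrite addrC.
- by move=> x; rewrite cst0 add0r.
- by move=> x; rewrite cstN cst1 cst0 mulN1r addNr.
- by move=> x y z; rewrite mulrA.
- by move=> x; rewrite cst1 mul1r.
- by move=> x; rewrite cst1 mulr1.
- by move=> x y z; rewrite mulrDl.
- by move=> x y z; rewrite mulrDr.
- by move=> c d; rewrite cstD.
- by move=> c d; rewrite cstM.
- by move=> c x; rewrite cstC.
- by move=> x y; rewrite parD.
- by move=> x y; rewrite parM.
- by move=> c; rewrite par_cst.
- by move=> x; rewrite parK.
Qed.

Definition plift_fun (x : pres) : B := seval (repr x : {classic T}).

Lemma plift_cls t : plift_fun (pcls t) = seval t.
Proof. by apply: seval_cong; exact: repr_pcls. Qed.

Program Definition plift : shom pres B := @SHom K pres B plift_fun _ _ _ _.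
Next Obligation.
by elim/pcls_ind=> x; elim/pcls_ind=> y; rewrite -pcls_add !plift_cls.
Qed.
Next Obligation.
by elim/pcls_ind=> x; elim/pcls_ind=> y; rewrite -pcls_mul !plift_cls.
Qed.
Next Obligation. by move=> c; rewrite -pcls_cst plift_cls. Qed.
Next Obligation. by elim/pcls_ind=> x; rewrite -pcls_par !plift_cls. Qed.

Lemma plift_gen g : plift (pgen g) = f g.
Proof. exact: plift_cls. Qed.
End Lift.
End Pres.

Section Tensor.
Variables (K : fieldType).

Section Def.
Variables (A B : superAlgType K).

(* The graded tensor product is presented by the elements [inl a] = a (x) 1 and
   [inr b] = 1 (x) b: both embeddings are morphisms, and
   (1 (x) b)(a (x) 1) = (-1)^([a][b]) (a (x) 1)(1 (x) b), which is the rule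
   (a (x) b)(c (x) d) = (-1)^([b][c]) ac (x) bd. *)
Inductive tens_rel : stm K (A + B) -> stm K (A + B) -> Prop :=
| tr_lD a a' : tens_rel (SGen (inl (a + a')))
                        (SGen (inl a) + SGen (inl a'))%stm
| tr_lM a a' : tens_rel (SGen (inl (a * a')))
                        (SGen (inl a) * SGen (inl a'))%stm
| tr_lcst c : tens_rel (SGen (inl (cst c))) (SCst c)
| tr_lpar a : tens_rel (SGen (inl (par a))) (SPar (SGen (inl a)))
| tr_rD b b' : tens_rel (SGen (inr (b + b')))
                        (SGen (inr b) + SGen (inr b'))%stm
| tr_rM b b' : tens_rel (SGen (inr (b * b')))
                        (SGen (inr b) * SGen (inr b'))%stm
| tr_rcst c : tens_rel (SGen (inr (cst c))) (SCst c)
| tr_rpar b : tens_rel (SGen (inr (par b))) (SPar (SGen (inr b)))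
| tr_swap p p' a b : homog p a -> homog p' b ->
    tens_rel (SGen (inr b) * SGen (inl a))%stm
             ((-1) ^+ (p && p') *: (SGen (inl a) * SGen (inr b)))%stm.

Definition stens := pres tens_rel.
HB.instance Definition _ := Superalg.on stens.

Program Definition tinl : shom A stens :=
  @SHom K A stens (fun a => pgen tens_rel (inl a)) _ _ _ _.
Next Obligation.
move=> x y; rewrite -[RHS]pcls_add; apply: pcls_eq; apply: sc_rel; exact: tr_lD.
Qed.
Next Obligation.
move=> x y; rewrite -[RHS]pcls_mul; apply: pcls_eq; apply: sc_rel; exact: tr_lM.
Qed.
Next Obligation. by move=> c; apply: pcls_eq; apply: sc_rel; exact: tr_lcst. Qed.
Next Obligation.
move=> x; rewrite -[RHS]pcls_par; apply: pcls_eq; apply: sc_rel; exact: tr_lpar.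
Qed.

Program Definition tinr : shom B stens :=
  @SHom K B stens (fun b => pgen tens_rel (inr b)) _ _ _ _.
Next Obligation.
move=> x y; rewrite -[RHS]pcls_add; apply: pcls_eq; apply: sc_rel; exact: tr_rD.
Qed.
Next Obligation.
move=> x y; rewrite -[RHS]pcls_mul; apply: pcls_eq; apply: sc_rel; exact: tr_rM.
Qed.
Next Obligation. by move=> c; apply: pcls_eq; apply: sc_rel; exact: tr_rcst. Qed.
Next Obligation.
move=> x; rewrite -[RHS]pcls_par; apply: pcls_eq; apply: sc_rel; exact: tr_rpar.
Qed.

Definition tens (a : A) (b : B) : stens := tinl a * tinr b.

Lemma tens_swap p p' a b : homog p a -> homog p' b ->
  tinr b * tinl a = cst ((-1) ^+ (p && p')) * (tinl a * tinr b).
Proof.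
move=> ha hb; rewrite /= /pgen -[LHS]pcls_mul.
by rewrite (pcls_eq (sc_rel (tr_swap ha hb))) !pcls_mul pcls_cst.
Qed.
End Def.

Definition supercommute (A B D : superAlgType K) (f : A -> D) (g : B -> D) :=
  forall p p' a b, homog p a -> homog p' b ->
    g b * f a = cst ((-1) ^+ (p && p')) * (f a * g b).

Section Lift.
Variables (A B D : superAlgType K) (f : shom A D) (g : shom B D).
Hypothesis fg : supercommute f g.

Definition tens_gen (x : A + B) : D :=
  match x with inl a => f a | inr b => g b end.

Lemma tens_gen_rel x y : tens_rel x y -> seval tens_gen x = seval tens_gen y.
Proof.
case=> /=; do ?by [move=> *; rewrite ?(shomD, shomM, shom_cst, shom_par)].
exact: fg.
Qed.

Definition tlift : shom (stens A B) D := plift tens_gen_rel.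

Lemma tlift_inl a : tlift (tinl A B a) = f a.
Proof. exact: (plift_gen tens_gen_rel). Qed.
Lemma tlift_inr b : tlift (tinr A B b) = g b.
Proof. exact: (plift_gen tens_gen_rel). Qed.
End Lift.

Lemma tmap_comm (A B A' B' : superAlgType K) (f : shom A A') (g : shom B B') :
  supercommute (scomp (tinl A' B') f) (scomp (tinr A' B') g).
Proof. by move=> p p' a b ha hb /=; apply: tens_swap; exact: shom_homog. Qed.

(* [tmap f g] is f (x) g (for even maps f and g). *)
Definition tmap (A B A' B' : superAlgType K) (f : shom A A') (g : shom B B') :
  shom (stens A B) (stens A' B') := tlift (tmap_comm f g).

Lemma ttwist_comm (A B : superAlgType K) :
  supercommute (tinr B A) (tinl B A).
Proof.
move=> p p' a b ha hb; rewrite (tens_swap hb ha) andbC.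
set c := cst _; rewrite (mulrA c c) /c -cstM -exprD addnn -mul2n exprM sqrrN.
by rewrite expr1n expr1n cst1 mul1r.
Qed.

(* The graded twist a (x) b |-> (-1)^([a][b]) b (x) a. *)
Definition ttwist (A B : superAlgType K) : shom (stens A B) (stens B A) :=
  tlift (@ttwist_comm A B).
End Tensor.

Arguments tinl {K A B}.
Arguments tinr {K A B}.

HB.instance Definition _ (K : fieldType) :=
  @PzRing_isSuperalg.Build K K^o id (fun _ _ => erefl) (fun _ _ => erefl) erefl
    (fun c x => mulrC c x) id (fun _ _ => erefl) (fun _ _ => erefl)
    (fun _ => erefl) (fun _ => erefl).

(* End V (x) A for a graded space V with a finite homogeneous basis I, of
   grading gI.  X : smx gI A stands for
   \sum_(a, b) E^a_b (x) X (a, b), with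
   (E^a_b (x) x)(E^b_d (x) y) = (-1)^([x]([b]+[d])) E^a_d (x) xy. *)
Definition smx (K : fieldType) (I : finType) (gI : I -> bool)
  (A : superAlgType K) : Type := {ffun I * I -> A}.

Section Smx.
Variables (K : fieldType) (I : finType) (gI : I -> bool) (A : superAlgType K).
Local Notation T := (smx gI A).

HB.instance Definition _ := GRing.Zmodule.copy T {ffun I * I -> A}.

Implicit Types X Y Z : T.

Definition smx_mul X Y : T := [ffun ad =>
  \sum_b parn (gI b (+) gI ad.2) (X (ad.1, b)) * Y (b, ad.2)].
Definition smx_diag (x : A) : T := [ffun ad => if ad.1 == ad.2 then x else 0].
Definition smx_par X : T := [ffun ad =>
  cst ((-1) ^+ (gI ad.1 (+) gI ad.2)) * par (X ad)].

Lemma smx_addE X Y ad : (X + Y) ad = X ad + Y ad. Proof. exact: ffunE. Qed.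
Lemma smx_mul_diagl x Y ad :
  smx_mul (smx_diag x) Y ad = parn (gI ad.1 (+) gI ad.2) x * Y ad.
Proof.
rewrite ffunE (bigD1 ad.1) //= big1 => [|b bN].
  by rewrite ffunE eqxx addr0; case: ad.
by rewrite ffunE /= eq_sym (negPf bN) parn0 mul0r.
Qed.

Lemma smx_mul_diagr X y ad : smx_mul X (smx_diag y) ad = X ad * y.
Proof.
rewrite ffunE (bigD1 ad.2) //= big1 => [|b bN].
  by rewrite ffunE eqxx addr0 addbb; case: ad.
by rewrite ffunE /= (negPf bN) mulr0.
Qed.

Let smulA : associative smx_mul.
Proof.
move=> X Y Z; apply/ffunP => -[a e]; rewrite !ffunE /=.
under eq_bigr => b _ do rewrite ffunE /= mulr_sumr.
rewrite exchange_big; apply: eq_bigr => d _ /=.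
rewrite ffunE /= parn_sum mulr_suml; apply: eq_bigr => b _.
rewrite parnM parn_parn mulrA; congr (parn _ _ * _ * _).
by case: (gI d) (gI e) (gI b) => [] [] [].
Qed.
Let smul1l : left_id (smx_diag 1) smx_mul.
Proof.
move=> X; apply/ffunP => ad; rewrite smx_mul_diagl.
by rewrite -(@cst1 _ A) parn_cst cst1 mul1r.
Qed.
Let smul1r : right_id (smx_diag 1) smx_mul.
Proof. by move=> X; apply/ffunP => ad; rewrite smx_mul_diagr mulr1. Qed.
Let smulDl : left_distributive smx_mul +%R.
Proof.
move=> X Y Z; apply/ffunP => ad; rewrite smx_addE !ffunE -big_split.
by apply: eq_bigr => b _ /=; rewrite smx_addE parnD mulrDl.
Qed.
Let smulDr : right_distributive smx_mul +%R.
Proof.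
move=> X Y Z; apply/ffunP => ad; rewrite smx_addE !ffunE -big_split.
by apply: eq_bigr => b _ /=; rewrite smx_addE mulrDr.
Qed.
HB.instance Definition _ :=
  GRing.Zmodule_isPzRing.Build T smulA smul1l smul1r smulDl smulDr.

Let sdiagD x y : smx_diag (x + y) = smx_diag x + smx_diag y.
Proof. by apply/ffunP => ad; rewrite smx_addE !ffunE; case: eqP; rewrite ?addr0. Qed.
Let sdiagM x y : smx_diag (x * y) = smx_diag x * smx_diag y.
Proof.
apply/ffunP => ad; rewrite [RHS]smx_mul_diagr !ffunE.
by case: eqP; rewrite ?mul0r.
Qed.
Let scstC c X : smx_diag (cst c) * X = X * smx_diag (cst c).
Proof.
apply/ffunP => ad; rewrite [LHS]smx_mul_diagl [RHS]smx_mul_diagr.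
by rewrite parn_cst cstC.
Qed.
Let sparD X Y : smx_par (X + Y) = smx_par X + smx_par Y.
Proof. by apply/ffunP => ad; rewrite smx_addE !ffunE parD mulrDr. Qed.
Let sparM X Y : smx_par (X * Y) = smx_par X * smx_par Y.
Proof.
apply/ffunP => -[a d]; rewrite !ffunE /= (@big_morph _ _ par 0 +%R) //.
- rewrite mulr_sumr; apply: eq_bigr => b _; rewrite !ffunE /= parM.
  rewrite parnM parn_cst; set u := par (parn _ _).
  have -> : parn (gI b (+) gI d) (par (X (a, b))) = u.
    by rewrite /u /parn; case: ifP.
  have -> : gI a (+) gI d = (gI a (+) gI b) (+) (gI b (+) gI d).
    by case: (gI a) (gI b) (gI d) => [] [] [].
  rewrite signr_addb cstM -!mulrA; congr (_ * _).
  by rewrite !mulrA; congr (_ * _); rewrite cstC.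
- exact: parD.
- exact: par0.
Qed.
Let spar_cst c : smx_par (smx_diag (cst c)) = smx_diag (cst c).
Proof.
apply/ffunP => -[a d]; rewrite !ffunE /=; case: eqP => [->|_].
  by rewrite addbb expr0 cst1 mul1r par_cst.
by rewrite par0 mulr0.
Qed.
Let sparK X : smx_par (smx_par X) = X.
Proof.
apply/ffunP => -[a d]; rewrite !ffunE /= parM par_cst parK mulrA -cstM.
by rewrite -signr_addb addbb expr0 cst1 mul1r.
Qed.
HB.instance Definition _ := PzRing_isSuperalg.Build K T
  (fun c d => etrans (congr1 smx_diag (cstD c d)) (sdiagD _ _))
  (fun c d => etrans (congr1 smx_diag (cstM c d)) (sdiagM _ _))
  (congr1 smx_diag cst1) scstC sparD sparM spar_cst sparK.

(* x |-> I (x) x *)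
Program Definition smx_inr : shom A T := @SHom K A T smx_diag _ _ _ _.
Next Obligation. exact: sdiagD. Qed.
Next Obligation. exact: sdiagM. Qed.
Next Obligation. by []. Qed.
Next Obligation.
move=> x; apply/ffunP => -[a d]; rewrite !ffunE /=; case: eqP => [->|_].
  by rewrite addbb expr0 cst1 mul1r.
by rewrite par0 mulr0.
Qed.

End Smx.

Section Smx2.
Variables (K : fieldType) (I : finType) (gI : I -> bool) (A : superAlgType K).
Local Notation T := (smx gI A).

Definition smx_const (X : smx gI K^o) : T := [ffun ad => @cst K A (X ad)].

(* X |-> X (x) 1 *)
Program Definition smx_inl : shom (smx gI K^o) T :=
  @SHom K _ T smx_const _ _ _ _.
Next Obligation. by move=> X Y; apply/ffunP => ad; rewrite smx_addE !ffunE cstD. Qed.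
Next Obligation.
move=> X Y; apply/ffunP => ad; rewrite !ffunE (@big_morph _ _ (@cst K A) 0 +%R).
- by apply: eq_bigr => b _; rewrite !ffunE parn_cst; case: (_ (+) _); exact: cstM.
- exact: cstD.
- exact: cst0.
Qed.
Next Obligation.
by move=> c; apply/ffunP => ad; rewrite !ffunE; case: eqP; rewrite ?cst0.
Qed.
Next Obligation. by move=> X; apply/ffunP => ad; rewrite !ffunE cstM par_cst. Qed.

Lemma smx_comm : supercommute smx_inl (smx_inr gI A).
Proof.
move=> p p' X x hX hx; apply/ffunP => -[a d].
rewrite [LHS]smx_mul_diagl /= [RHS]smx_mul_diagl [in RHS]smx_mul_diagr !ffunE.
rewrite (parn_homog _ hx) parn_cst /=.
have /ffunP/(_ (a, d)) := hX; rewrite [RHS]smx_mul_diagl ffunE /=.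
have -> b : parn b ((-1) ^+ p : K^o) = (-1) ^+ p by case: b.
case: (eqVneq (X (a, d)) 0) => [-> _|X0 /(mulIf X0) e].
  by rewrite cst0 mulr0 mul0r mulr0.
suff -> : (-1 : K) ^+ ((gI a (+) gI d) && p') = (-1) ^+ (p && p').
  by rewrite -mulrA; congr (_ * _); rewrite [RHS]cstC.
by case: p' {hx}; rewrite ?andbT ?andbF.
Qed.
End Smx2.

Section Modules.
Variable K : fieldType.

Record is_action (A : superAlgType K) (W : lmodType K) (a : A -> W -> W) :
    Prop := IsAction {
  is_actDr : forall x v w, a x (v + w) = a x v + a x w;
  is_actDl : forall x y v, a (x + y) v = a x v + a y v;
  is_actM : forall x y v, a (x * y) v = a x (a y v);
  is_act_cst : forall c v, a (cst c) v = c *: v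
}.

Record amod (A : superAlgType K) := AMod {
  asp :> lmodType K;
  act : A -> asp -> asp;
  actP : is_action act
}.

Definition is_amod_hom (A : superAlgType K) (M N : amod A) (f : M -> N) : Prop :=
  linear f /\ forall x v, f (act x v) = act x (f v).

Program Definition pull (A B : superAlgType K) (f : shom A B) (M : amod B) :
  amod A := @AMod A (asp M) (fun x v => act (f x) v) _.
Next Obligation.
move=> A B f M; have [aDr aDl aM ac] := actP M.
by split=> *; rewrite ?(shomD, shomM, shom_cst).
Qed.

Definition sregular (A : superAlgType K) : Type := A.

Section Regular.
Variable A : superAlgType K.
HB.instance Definition _ := GRing.Zmodule.on (sregular A).

Definition sreg_scale (c : K) (x : sregular A) : sregular A := (cst c : A) * (x : A).
Let sreg_scaleA c d x : sreg_scale c (sreg_scale d x) = sreg_scale (c * d) x.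
Proof. by rewrite /sreg_scale cstM mulrA. Qed.
Let sreg_scale1 : left_id 1 sreg_scale.
Proof. by move=> x; rewrite /sreg_scale cst1 mul1r. Qed.
Let sreg_scaleDr : right_distributive sreg_scale +%R.
Proof. by move=> c x y; exact: (@mulrDr A). Qed.
Let sreg_scaleDl x : {morph sreg_scale^~ x : c d / c + d}.
Proof. by move=> c d; rewrite /sreg_scale cstD; exact: (@mulrDl A). Qed.
HB.instance Definition _ := GRing.Zmodule_isLmodule.Build K (sregular A)
  sreg_scaleA sreg_scale1 sreg_scaleDr sreg_scaleDl.

Program Definition regmod : amod A :=
  @AMod A (sregular A) (fun (x : A) (y : sregular A) => x * (y : A)) _.
Next Obligation.
split=> [x v w|x y v|x y v|c v] //.
- exact: (@mulrDr A).
- exact: (@mulrDl A).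
- exact/esym/(@mulrA A).
Qed.
End Regular.

Definition sparity (A : superAlgType K) : shom A A :=
  @SHom K A A par (@parD K A) (@parM K A) (@par_cst K A) (fun _ => erefl).

(* The completion of B with respect to a class P of B-modules: the algebra of
   endomorphisms of the forgetful functor from the modules in P to vector
   spaces.  An element of B gives the family of its actions.  The values of
   [cop] outside P are irrelevant. *)
Record completion (B : superAlgType K) (P : amod B -> Prop) := Completion {
  cop : forall M : amod B, M -> M;
  cop_linear : forall M, P M -> linear (@cop M);
  cop_nat : forall (M N : amod B) (f : M -> N), P M -> P N -> is_amod_hom f ->
    forall v, f (cop v) = cop (f v)
}.

(* The image of X under (the extension to the completion of) f : B -> D: by
   naturality X acts on D, viewed as a left B-module through f, as left
   multiplication by [cimg f X]. *)
Definition cimg (B D : superAlgType K) (P : amod B -> Prop)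
    (f : shom B D) (X : completion P) : D :=
  @cop _ _ X (pull f (regmod D)) (1 : D).
End Modules.

(* (x, y) is the weight \sum_i x_i eps_i + \sum_mu y_mu delta_mu. *)
Notation weight R m k := ('rV[R[i]]_(m./2) * 'rV[R[i]]_k)%type (only parsing).

Section RootData.
Variables (R : realType) (m k : nat).
Local Notation C := R[i].
Local Notation n := (2 * k)%N.
Local Notation l := (m./2).

Definition idx : Type := ('I_m + 'I_n)%type.
HB.instance Definition _ := Finite.on idx.

(* [inl i] is the even index i + 1, and [inr mu] the odd index mu + 1. *)
Definition gr (a : idx) : bool := if a is inr _ then true else false.

Definition bar (a : idx) : idx :=
  match a with inl i => inl (rev_ord i) | inr u => inr (rev_ord u) end.

Definition xi (a : idx) : C := if a is inr u then (-1) ^+ u.+1 else 1.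

Local Notation wt := (weight R m k).

Definition bil (x y : wt) : C :=
  \sum_i x.1 0 i * y.1 0 i - \sum_u x.2 0 u * y.2 0 u.

Definition epsn (j : nat) : wt := (\row_(i < l) (i == j :> nat)%:R, 0).
Definition deltan (j : nat) : wt := (0, \row_(u < k) (u == j :> nat)%:R).

(* [epsn j] vanishes for j >= l, hence eps_(bar a) = - eps_a, and the middle
   weight is 0 when m is odd. *)
Definition eps (a : idx) : wt :=
  match a with
  | inl i => epsn i - epsn (rev_ord i)
  | inr u => deltan u - deltan (rev_ord u)
  end.

Definition rho : wt :=
  (\row_(i < l) (2^-1 * (m%:R - 2 * (i.+1)%:R)),
   \row_(u < k) (2^-1 * (n%:R - m%:R + 2 - 2 * (u.+1)%:R))).

Definition C0 : C := bil (deltan 0) (deltan 0 + rho *+ 2).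

Inductive sroot :=
| REven of 'I_l      (* alpha_i *)
| ROdd of 'I_k.-1    (* alpha_mu, mu < k *)
| RS.                (* alpha_s *)

Definition sgr (c : sroot) : bool := if c is RS then true else false.

Definition alpha (c : sroot) : wt :=
  match c with
  | REven i => if (i.+1 < l)%N then epsn i - epsn i.+1
               else if odd m then epsn i else epsn i + epsn i.-1
  | ROdd u => deltan u - deltan u.+1
  | RS => deltan k.-1 - epsn 0
  end.
End RootData.

(* The norm topology of R[i], as for every numFieldType. *)
HB.instance Definition _ (R : realType) :=
  PseudoPointedMetric.copy R[i] (R[i])^o.
HB.instance Definition _ (R : realType) := NormedModule.copy R[i] (R[i])^o.

Definition cexp (R : realType) (z : R[i]) : R[i] :=
  Complex (expR (complex.Re z) * cos (complex.Im z))
          (expR (complex.Re z) * sin (complex.Im z)).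

Section Osp.
(* [hq] is the chosen logarithm of q. *)
Variables (R : realType) (m k : nat) (hq : R[i]).
Local Notation C := R[i].
Local Notation n := (2 * k)%N.
Local Notation l := (m./2).
Local Notation wt := (weight R m k).
Local Notation sroot := (sroot m k).
Local Notation alpha := (@alpha R m k).

Definition qpow (x : C) : C := cexp (hq * x).
Arguments qpow x%_ring_scope.
Local Notation q := (qpow 1).

(* The h_lambda and the q^(h_lambda) are independent generators: the relation
   "q^h = exp(hq h)" is not algebraic and is imposed on weight vectors instead
   ([wvec], [highest_weight]). *)
Inductive ogen :=
| GE of sroot
| GF of sroot
| GH of wt    (* h_lambda *)
| GQ of wt.   (* q^(h_lambda) *)
Arguments GH x%_ring_scope.
Arguments GQ x%_ring_scope.

Local Notation T := (stm C ogen).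

(* Expressions of known weight and degree, in order to form q-commutators. *)
Record wtm := WTm { wtm_tm : T; wtm_wt : wt; wtm_gr : bool }.

(* [x, y]_q = x y - (-1)^([x][y]) q^(wt x, wt y) y x *)
Definition qbr (x y : wtm) : wtm :=
  WTm (wtm_tm x * wtm_tm y
       - (((-1) ^+ (wtm_gr x && wtm_gr y) * qpow (bil (wtm_wt x) (wtm_wt y)))%R
          *: (wtm_tm y * wtm_tm x)))%stm
      (wtm_wt x + wtm_wt y)%R (wtm_gr x (+) wtm_gr y).

Definition qE (c : sroot) : wtm :=
  WTm (SGen (GE c) * SGen (GQ (2^-1 *: alpha c)))%stm (alpha c) (sgr c).
Definition qF (c : sroot) : wtm :=
  WTm (SGen (GF c) * SGen (GQ (2^-1 *: alpha c)))%stm (- alpha c) (sgr c).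

(* The standard and the extra q-Serre relations for X = qE or qF: each listed
   expression is set to 0. *)
Inductive serre (X : sroot -> wtm) : wtm -> Prop :=
| serre_std b c (N : nat) :
    b <> c -> bil (alpha b) (alpha b) != 0 ->
    N%:R = 1 - 2 * bil (alpha b) (alpha c) / bil (alpha b) (alpha b) ->
    serre X (iter N (qbr (X b)) (X c))
| serre_iso b c :
    b <> c -> bil (alpha b) (alpha b) = 0 -> bil (alpha b) (alpha c) = 0 ->
    serre X (qbr (X b) (X c))
(* alpha_(mu = k-1) --- alpha_s --- alpha_i; here i = 1, and also i = 2 if m = 4 *)
| serre_extra1 (u : 'I_k.-1) (i : 'I_l) :
    u.+2 = k -> bil (alpha (RS m k)) (alpha (REven k i)) != 0 ->
    serre X (qbr (X (RS m k)) (qbr (X (ROdd m u))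
                   (qbr (X (RS m k)) (X (REven k i)))))
| serre_extra2 (u : 'I_k.-1) (i : 'I_l) :
    u.+2 = k -> bil (alpha (RS m k)) (alpha (REven k i)) != 0 ->
    serre X (qbr (X (RS m k)) (qbr (X (REven k i))
                   (qbr (X (RS m k)) (X (ROdd m u))))).

Local Notation e c := (SGen (GE c)).
Local Notation f c := (SGen (GF c)).
Local Notation h x := (SGen (GH x)).
Local Notation qh x := (SGen (GQ x)).

(* or_he ... or_qf: the Cartan relations, those with q^h being the exponentiated
   form of those with h. *)
Inductive osp_rel : T -> T -> Prop :=
| or_par_e c : osp_rel (SPar (e c)) ((-1) ^+ sgr c *: e c)%stm
| or_par_f c : osp_rel (SPar (f c)) ((-1) ^+ sgr c *: f c)%stm
| or_par_h x : osp_rel (SPar (h x)) (h x)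
| or_par_q x : osp_rel (SPar (qh x)) (qh x)
| or_h_lin a x y : osp_rel (h (a *: x + y)) (a *: h x + h y)%stm
| or_q0 : osp_rel (qh 0) 1%stm
| or_qD x y : osp_rel (qh (x + y)) (qh x * qh y)%stm
| or_hh x y : osp_rel (h x * h y)%stm (h y * h x)%stm
| or_hq x y : osp_rel (h x * qh y)%stm (qh y * h x)%stm
| or_he x c : osp_rel (h x * e c - e c * h x)%stm (bil x (alpha c) *: e c)%stm
| or_hf x c :
    osp_rel (h x * f c - f c * h x)%stm ((- bil x (alpha c))%R *: f c)%stm
| or_qe x c :
    osp_rel (qh x * e c)%stm (qpow (bil x (alpha c)) *: (e c * qh x))%stm
| or_qf x c :
    osp_rel (qh x * f c)%stm (qpow (- bil x (alpha c)) *: (f c * qh x))%stm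
| or_ef c :
    osp_rel (e c * f c - ((-1) ^+ sgr c *: (f c * e c)))%stm
            ((q - q^-1)^-1%R *: (qh (alpha c) - qh (- alpha c)%R))%stm
| or_ef0 c d : c <> d ->
    osp_rel (e c * f d - ((-1) ^+ (sgr c && sgr d) *: (f d * e c)))%stm 0%stm
| or_ee c : bil (alpha c) (alpha c) = 0 ->
    osp_rel (e c * e c - ((-1) ^+ sgr c *: (e c * e c)))%stm 0%stm
| or_ff c : bil (alpha c) (alpha c) = 0 ->
    osp_rel (f c * f c - ((-1) ^+ sgr c *: (f c * f c)))%stm 0%stm
| or_serre_e x : serre qE x -> osp_rel (wtm_tm x) 0%stm
| or_serre_f x : serre qF x -> osp_rel (wtm_tm x) 0%stm.

Definition Uosp := pres osp_rel.
HB.instance Definition _ := Superalg.on Uosp.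
Local Notation U := Uosp.
Local Notation UU := (stens U U).

Definition ue (c : sroot) : U := pgen osp_rel (GE c).
Definition uf (c : sroot) : U := pgen osp_rel (GF c).
Definition uh (x : wt) : U := pgen osp_rel (GH x).
Definition uq (x : wt) : U := pgen osp_rel (GQ x).

(* Delta is primitive on h_lambda, as Delta(q^h) = q^h (x) q^h requires. *)
Definition is_coproduct (Delta : shom U UU) : Prop :=
  [/\ forall c, Delta (ue c) =
        tens (uq (2^-1 *: alpha c)) (ue c) + tens (ue c) (uq (- (2^-1 *: alpha c))),
      forall c, Delta (uf c) =
        tens (uq (2^-1 *: alpha c)) (uf c) + tens (uf c) (uq (- (2^-1 *: alpha c))),
      forall x, Delta (uh x) = tens (uh x) 1 + tens 1 (uh x)
    & forall x, Delta (uq x) = tens (uq x) (uq x)].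

Local Notation idx := (idx m k).
Local Notation EndV := (smx (@gr m k) C^o).
Local Notation EndVU := (smx (@gr m k) U).

Definition Emx (a b : idx) : EndV := [ffun xy => (xy == (a, b))%:R].

Definition Sig (a b : idx) : EndV :=
  Emx a b - cst ((-1) ^+ (gr a && (gr a (+) gr b)) * xi R a * xi R b)
            * Emx (bar b) (bar a).

Definition is_vector_rep (pi : shom U EndV) : Prop :=
  [/\ forall a, pi (uh (eps R a)) = cst ((-1) ^+ gr a) * Sig a a,
      forall x, pi (uq x) = \sum_a cst (qpow (bil x (eps R a))) * Emx a a,
      forall (i : 'I_l) (a b : 'I_m), (i.+1 < l)%N || odd m ->
        a = i :> nat -> b = i.+1 :> nat ->
        pi (ue (REven k i)) = Sig (inl a) (inl b) /\
        pi (uf (REven k i)) = Sig (inl b) (inl a),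
      forall (i : 'I_l) (a b : 'I_m), i.+1 = l -> ~~ odd m ->
        a.+1 = i :> nat -> b = i :> nat ->
        pi (ue (REven k i)) = Sig (inl a) (bar (inl b)) /\
        pi (uf (REven k i)) = Sig (bar (inl b)) (inl a)
    & (forall (u : 'I_k.-1) (a b : 'I_n), a = u :> nat -> b = u.+1 :> nat ->
        pi (ue (ROdd m u)) = Sig (inr a) (inr b) /\
        pi (uf (ROdd m u)) = - Sig (inr b) (inr a)) /\
      (forall (a : 'I_n) (b : 'I_m), a = k.-1 :> nat -> b = 0 :> nat ->
        pi (ue (RS m k)) = Sig (inr a) (inl b) /\
        pi (uf (RS m k)) = - Sig (inl b) (inr a))].

Definition wvec (B : superAlgType C) (g : shom U B) (M : amod B) (x : wt) (v : M) :
  Prop := forall y, act (g (uh y)) v = bil y x *: v /\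
                    act (g (uq y)) v = qpow (bil y x) *: v.

Definition weightmod (B : superAlgType C) (g : shom U B) (M : amod B) : Prop :=
  forall v : M, exists s : seq (wt * M),
    (forall i : 'I_(size s),
       wvec g (tnth (in_tuple s) i).1 (tnth (in_tuple s) i).2) /\
    v = \sum_(xw <- s) xw.2.

Definition locnil (B : superAlgType C) (g : shom U B) (x : sroot -> U)
    (M : amod B) : Prop :=
  forall v : M, exists N : nat, forall cs : seq sroot,
    (N <= size cs)%N -> act (g (\prod_(c <- cs) x c)) v = 0.

(* The class of U (x) U-modules used to complete U (x) U: a sum of terms
   f_(c_1) ... f_(c_N) (x) e_(d_1) ... e_(d_N) over all N, as well as
   q^(\sum h_i (x) h^i), act on modules on which one of the two factors acts by
   weights with a locally nilpotent action of the lowering (first factor) or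
   raising (second factor) generators.  Nothing is required of the other factor,
   which may thus be the regular representation. *)
Definition adm_l (M : amod UU) : Prop := weightmod tinl M /\ locnil tinl uf M.
Definition adm_r (M : amod UU) : Prop := weightmod tinr M /\ locnil tinr ue M.
Definition adm (M : amod UU) : Prop := adm_l M \/ adm_r M.

Definition universal_R (Delta : shom U UU) (X : completion adm) : Prop :=
  [/\
   (* X is even and invertible *)
   forall (M : amod UU) (v : M), adm M ->
     @cop _ _ _ X (pull (sparity UU) M) v = cop X v,
   exists Y : completion adm, forall M : amod UU, adm M ->
     cancel (@cop _ _ _ X M) (@cop _ _ _ Y M) /\
     cancel (@cop _ _ _ Y M) (@cop _ _ _ X M),
   (* X Delta(a) = Delta^T(a) X *)
   forall (a : U) (M : amod UU) (v : M), adm M ->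
     cop X (act (Delta a) v) = act (ttwist U U (Delta a)) (cop X v),
   (* (id (x) Delta) X = X_13 X_12, on U (x) (U (x) U)-modules *)
   forall (M : amod (stens U UU)) (v : M),
     let M_iD := pull (tmap (sid U) Delta) M in
     let M12 := pull (tmap (sid U) (tinl : shom U UU)) M in
     let M13 := pull (tmap (sid U) (tinr : shom U UU)) M in
     adm M_iD -> adm M12 -> adm M13 ->
     @cop _ _ _ X M_iD v = @cop _ _ _ X M13 (@cop _ _ _ X M12 v)
   (* (Delta (x) id) X = X_13 X_23, on (U (x) U) (x) U-modules *)
 & forall (M : amod (stens UU U)) (v : M),
     let M_Di := pull (tmap Delta (sid U)) M in
     let M13 := pull (tmap (tinl : shom U UU) (sid U)) M in
     let M23 := pull (tmap (tinr : shom U UU) (sid U)) M in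
     adm M_Di -> adm M13 -> adm M23 ->
     @cop _ _ _ X M_Di v = @cop _ _ _ X M13 (@cop _ _ _ X M23 v)].

(* The part of degree N of the subalgebra generated by the Cartan elements and
   the generators x, each x c having degree 1. *)
Inductive borel (x : sroot -> U) : nat -> U -> Prop :=
| borel_one : borel x 0 1
| borel_h y : borel x 0 (uh y)
| borel_q y : borel x 0 (uq y)
| borel_x c : borel x 1 (x c)
| borel_M i j a b : borel x i a -> borel x j b -> borel x (i + j) (a * b)
| borel_D i a b : borel x i a -> borel x i b -> borel x i (a + b)
| borel_Z i c a : borel x i a -> borel x i (cst c * a).

Inductive minus_plus (N : nat) : UU -> Prop :=
| mp_tens a b : borel uf N a -> borel ue N b -> minus_plus N (tens a b)
| mp_D s t : minus_plus N s -> minus_plus N t -> minus_plus N (s + t)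
| mp_Z c s : minus_plus N s -> minus_plus N (cst c * s).

(* The form of the canonical element of Drinfeld's double of U^+:
   X = (\sum_N Theta_N) q^(\sum_i h_i (x) h^i) in the completion of
   U^- (x) U^+, with Theta_0 = 1 and Theta_N of degree N in the lowering and in
   the raising generators.  On vectors of weight x for the first (second) factor
   the Cartan part acts as 1 (x) q^(h_x) (as q^(h_x) (x) 1). *)
Definition double_form (X : completion adm) : Prop :=
  exists Theta : nat -> UU,
  [/\ Theta 0 = 1,
      forall N, minus_plus N (Theta N),
      forall (M : amod UU) (x : wt) (v : M), adm_l M -> wvec tinl x v ->
        exists N0 : nat, forall N, (N0 <= N)%N ->
          cop X v = \sum_(j < N) act (Theta j) (act (tinr (uq x)) v)
    & forall (M : amod UU) (x : wt) (v : M), adm_r M -> wvec tinr x v ->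
        exists N0 : nat, forall N, (N0 <= N)%N ->
          cop X v = \sum_(j < N) act (Theta j) (act (tinl (uq x)) v)].

Lemma pi_id_comm (pi : shom U EndV) :
  supercommute (scomp (smx_inl (@gr m k) U) pi) (smx_inr (@gr m k) U).
Proof. by move=> p p' a b ha hb /=; apply: smx_comm => //; exact: shom_homog. Qed.

Definition pi_id (pi : shom U EndV) : shom UU EndVU := tlift (pi_id_comm pi).

Definition Lax (pi : shom U EndV) (X : completion adm) : EndVU :=
  cimg (pi_id pi) X.
Definition LaxT (pi : shom U EndV) (X : completion adm) : EndVU :=
  cimg (scomp (pi_id pi) (ttwist U U)) X.

Definition str_id (X : EndVU) : U := \sum_a cst ((-1) ^+ gr a) * X (a, a).

Definition casimirA (pi : shom U EndV) (X : completion adm) : EndVU :=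
  cst (q - q^-1)^-1 * (LaxT pi X * Lax pi X - 1).

Definition casimir (pi : shom U EndV) (X : completion adm) (r : nat) : U :=
  str_id (smx_inl (@gr m k) U (pi (uq (rho R m k *+ 2))) * casimirA pi X ^+ r).

Definition irreducible (W : vectType C) (a : U -> W -> W) : Prop :=
  {:W}%VS <> 0%VS /\
  forall S : {vspace W}, (forall x v, v \in S -> a x v \in S) ->
    S = 0%VS \/ S = {:W}%VS.

Definition highest_weight (W : lmodType C) (a : U -> W -> W) (L : wt) : Prop :=
  exists v : W,
  [/\ v <> 0, forall w, exists x, w = a x v, forall c, a (ue c) v = 0,
      forall y, a (uh y) v = bil y L *: v
    & forall y, a (uq y) v = qpow (bil y L) *: v].

Local Notation eps := (@eps R m k).
Local Notation rho := (rho R m k).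
Local Notation C0 := (C0 R m k).

(* (eps_a, eps_a + 2 rho + 2 Lambda) and (eps_b, 2 rho + 2 Lambda - eps_b) *)
Definition xplus (L : wt) (a : idx) : C :=
  bil (eps a) (eps a + rho *+ 2 + L *+ 2).
Definition xminus (L : wt) (b : idx) : C :=
  bil (eps b) (rho *+ 2 + L *+ 2 - eps b).

Definition fcoef (L : wt) (a : idx) : C :=
  if ~~ odd m then 1 - (q - q^-1) * (q / (qpow (2 * xplus L a) - 1))
  else if eps a != 0 then
    1 + (q - q^-1) * (qpow (xplus L a) / (qpow (2 * xplus L a) - 1))
  else 1.

Definition eigen_formula (r : nat) (L : wt) : C :=
  \sum_a (-1) ^+ gr a * qpow (C0 - bil (eps a) (eps a)) * fcoef L a *
    ((qpow (xplus L a - C0) - 1) / (q - q^-1)) ^+ r *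
    \prod_(b | b != a) ((qpow (xplus L a) - qpow (xminus L b)) /
                        (qpow (xplus L a) - qpow (xplus L b))).

(* The weights for which no denominator of [eigen_formula] vanishes. *)
Definition regular_wt (L : wt) : Prop :=
  (forall a b, a != b -> qpow (xplus L a) != qpow (xplus L b)) /\
  (forall a, eps a != 0 -> qpow (2 * xplus L a) != 1).

(* chi is the value of [eigen_formula] at L, in the sense of continuation in the
   weight when some denominator vanishes. *)
Definition eigen_value (r : nat) (L : wt) (chi : C) : Prop :=
  (regular_wt L -> chi = eigen_formula r L) /\
  (~ regular_wt L ->
     eigen_formula r L' @[L' --> within regular_wt (nbhs L)] --> chi).
End Osp.

(* Main.v *)
Require Import Defs.
From mathcomp Require Import all_boot all_order all_algebra.
From mathcomp Require Import complex.
From mathcomp Require Import all_classical all_reals all_analysis.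
From mathcomp Require Import ring lra zify.
Require Import Defs.

Set Implicit Arguments.
Unset Strict Implicit.
Unset Printing Implicit Defensive.

Import Order.TTheory GRing.Theory Num.Theory numFieldNormedType.Exports.
Local Open Scope ring_scope.

(** R^T R commutes with (pi (x) id) Delta, hence so does A, and for an even B that
    commutes with it (str (x) id)(q^(2 h_rho) B) is central. On a module generated
    by a highest weight vector v a central element acts by a scalar, which is the
    coefficient vst of v in its value at v. The numbers t_a = vst ((A^r)_aa v) obey
    t^(r+1) = (M t^(r) - t^(r)) / (q - q^-1), where M is triangular for the order of
    the weights eps_a, has the diagonal entries
    q^((eps_a, eps_a + 2 rho + 2 Lambda) - C(Lambda_0)), and is given by the matrix
    elements |a, x> -> |x, a> of (pi (x) pi) R; those follow row by row from
    R Delta(x) = Delta^T(x) R for the Chevalley generators x. Solving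
    (z - M) tau = (1, ..., 1) exhibits sum_a (-1)^[a] q^(2 rho, eps_a) tau_a as an
    explicit rational function of z whose residues at the eigenvalues of M are the
    coefficients of the eigenvalue formula, for regular Lambda. The recursion being
    continuous in Lambda, the other weights follow by passing to the limit. *)

(** * Superalgebras, matrices and completions *)

(** No formula for [Rm] is available: [double_form] gives only the degrees of its terms and the term
    of degree 0. This makes [Lax] triangular with diagonal [uq (eps a)], hence diagonal on v, and
    makes [LaxT] diagonal under [vst]; the rest is extracted from intertwining relations. The
    entries of both operators lie in U itself: a module on which the appropriate leg acts through pi
    is admissible, and by naturality [Rm] acts there as a left multiplication. An entry of [Lax] may
    therefore be taken as u in B Delta(u) = Delta(u) B, and (id (x) Delta) R = R_13 R_12 then brings
    in P_ax, the matrix elements of (pi (x) pi) R. The weights kappa_x = q^((2 rho, eps_x) -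
    C(Lambda_0)) satisfy sum_x P_ax kappa_x = 1 in every row; they collapse the relation to the
    recursion with M_ax = q^(2 (eps_a, Lambda)) P_ax kappa_x, and this is how C(Lambda_0) enters.
    The resolvent of M is solvable because, below the diagonal, a row of P depends on its index only
    at the mirror entry x = bar a: partial sums obey a short recurrence, and the mirror entries
    produce f(a). For odd m the zero weight has the eigenvalue q^(- C(Lambda_0)), which is also a
    pole of the factor f, and is treated apart. *)

Section PresInd.
Variables (K : fieldType) (G : Type) (rel : stm K G -> stm K G -> Prop).

Lemma pres_gen_ind (P : pres rel -> Prop) :
  (forall g, P (pgen rel g)) -> (forall c, P (cst c)) ->
  (forall x y, P x -> P y -> P (x + y)) ->
  (forall x y, P x -> P y -> P (x * y)) ->
  (forall x, P x -> P (par x)) -> forall x, P x.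
Proof.
move=> Pg Pc PD PM Pp; elim/pcls_ind => t.
elim: t => [g|c|x Px y Py|x Px y Py|x Px].
- exact: Pg.
- exact: Pc.
- by rewrite pcls_add; exact: PD.
- by rewrite pcls_mul; exact: PM.
- by rewrite pcls_par; exact: Pp.
Qed.
End PresInd.

Section Generic.
Variable K : fieldType.
Implicit Types A B D : superAlgType K.

Lemma shom0 A B (f : shom A B) : f 0 = 0.
Proof. by rewrite -(@cst0 _ A) shom_cst cst0. Qed.

Lemma shom_sum A B (f : shom A B) (I : Type) (s : seq I) (P : pred I) (F : I -> A) :
  f (\sum_(i <- s | P i) F i) = \sum_(i <- s | P i) f (F i).
Proof. by apply: (big_morph f); [exact: shomD|exact: shom0]. Qed.

Lemma shom_parn A B (f : shom A B) b x : f (parn b x) = parn b (f x).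
Proof. by case: b => //=; rewrite shom_par. Qed.

Lemma stens_ext A B D (f g : shom (stens A B) D) :
  (forall a, f (tinl a) = g (tinl a)) -> (forall b, f (tinr b) = g (tinr b)) ->
  forall x, f x = g x.
Proof.
move=> fl fr; apply: pres_gen_ind => [[a|b]|c|x y fx fy|x y fx fy|x fx].
- exact: fl.
- exact: fr.
- by rewrite !shom_cst.
- by rewrite !shomD fx fy.
- by rewrite !shomM fx fy.
- by rewrite !shom_par fx.
Qed.

Lemma ttwist_inl A B a : ttwist A B (tinl a) = tinr a.
Proof. exact: tlift_inl. Qed.

Lemma ttwist_inr A B b : ttwist A B (tinr b) = tinl b.
Proof. exact: tlift_inr. Qed.

Lemma ttwistK A B (x : stens A B) : ttwist B A (ttwist A B x) = x.
Proof.
apply: (stens_ext (f := scomp (ttwist B A) (ttwist A B)) (g := sid _)) => [a|b].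
  by rewrite [LHS](congr1 (ttwist B A) (ttwist_inl B a)) ttwist_inr.
by rewrite [LHS](congr1 (ttwist B A) (ttwist_inr A b)) ttwist_inl.
Qed.

Section SmxEntries.
Variables (I : finType) (gI : I -> bool) (A : superAlgType K).

Lemma smxMl (X Y : smx gI A) a d :
  (X * Y) (a, d) = \sum_b parn (gI b (+) gI d) (X (a, b)) * Y (b, d).
Proof. by rewrite [LHS]ffunE. Qed.

Lemma smx_cstE c a b : (cst c : smx gI A) (a, b) = if a == b then cst c else 0.
Proof. by rewrite [LHS]ffunE. Qed.

Lemma smx_parE (X : smx gI A) a b :
  (par X) (a, b) = cst ((-1) ^+ (gI a (+) gI b)) * par (X (a, b)).
Proof. by rewrite [LHS]ffunE. Qed.

Lemma smx_inrE x a b : smx_inr gI A x (a, b) = if a == b then x else 0.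
Proof. by rewrite [LHS]ffunE. Qed.

Lemma smx_inlE (X : smx gI K^o) a b : @smx_inl K I gI A X (a, b) = cst (X (a, b) : K).
Proof. by rewrite [LHS]ffunE. Qed.

End SmxEntries.

Section SmxMap.
Variables (I : finType) (gI : I -> bool) (A B : superAlgType K) (f : shom A B).

Definition smx_map_fun (X : smx gI A) : smx gI B := [ffun ab => f (X ab)].

Lemma smx_mapE X ab : smx_map_fun X ab = f (X ab).
Proof. by rewrite [LHS]ffunE. Qed.

Program Definition smx_map : shom (smx gI A) (smx gI B) :=
  @SHom K _ _ smx_map_fun _ _ _ _.
Next Obligation.
by move=> X Y; apply/ffunP => ab; rewrite smx_addE !smx_mapE smx_addE shomD.
Qed.
Next Obligation.
move=> X Y; apply/ffunP => -[a d]; rewrite smx_mapE !smxMl shom_sum.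
by apply: eq_bigr => b _; rewrite shomM shom_parn !smx_mapE.
Qed.
Next Obligation.
move=> c; apply/ffunP => -[a d]; rewrite smx_mapE !smx_cstE.
by case: eqP; rewrite ?shom_cst ?shom0.
Qed.
Next Obligation.
move=> X; apply/ffunP => -[a d]; rewrite smx_mapE !smx_parE smx_mapE.
by rewrite shomM shom_cst shom_par.
Qed.
End SmxMap.

Section Completion.
Variables (B : superAlgType K) (P : amod B -> Prop).
Variable X : completion P.

(** Right multiplication by y is an endomorphism of the left module, so naturality gives X y = (X 1)
    y. *)
Lemma cop_pull_regmod D (f : shom B D) (y : D) :
  P (pull f (regmod D)) -> cop X (y : pull f (regmod D)) = cimg f X * y.
Proof.
move=> Pf.
pose g (z : pull f (regmod D)) : pull f (regmod D) := (z : D) * y.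
have gh : is_amod_hom g.
  split=> [c u v|x v]; last by rewrite /g /= mulrA.
  by rewrite /g /= [(_ + _ : D) * y]mulrDl; congr (_ + _); exact/esym/mulrA.
have := cop_nat X Pf Pf gh (1 : D); rewrite /g /= mul1r => <-.
by [].
Qed.

(** [g] is itself a homomorphism between the two pulled-back regular modules; naturality is
    evaluated at 1. *)
Lemma cimg_natural D E (f : shom B D) (f' : shom B E) (g : shom D E) :
  P (pull f (regmod D)) -> P (pull f' (regmod E)) ->
  (forall x, f' x = g (f x)) -> cimg f' X = g (cimg f X).
Proof.
move=> Pf Pf' gf.
pose h (z : pull f (regmod D)) : pull f' (regmod E) := g z.
have hh : is_amod_hom h.
  split=> [c u v|x v]; last by rewrite /h /= shomM gf.
  by rewrite /h /= shomD shomM shom_cst.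
have := cop_nat X Pf Pf' hh (1 : D).
by rewrite {1}/h => e; rewrite [RHS]e /h shom1.
Qed.

End Completion.
End Generic.

(** * Weights *)

Section Weights.
Variables (R : realType) (m k : nat).
Local Notation C := R[i].
Local Notation n := (2 * k)%N.
Local Notation l := (m./2).
Local Notation wt := (weight R m k).
Local Notation idx := (idx m k).
Local Notation eps := (@eps R m k).
Implicit Types (x y z : wt) (a b : idx).

Lemma bilDr x y z : bil x (y + z) = bil x y + bil x z.
Proof.
rewrite /bil addrACA -opprD -!big_split /=; congr (_ - _);
  by apply: eq_bigr => i _; rewrite mxE mulrDr.
Qed.

Lemma bilC x y : bil x y = bil y x.
Proof. by congr (_ - _); apply: eq_bigr => i _; rewrite mulrC. Qed.

Lemma bilZr c x y : bil x (c *: y) = c * bil x y.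
Proof.
rewrite /bil mulrBr !mulr_sumr; congr (_ - _);
  by apply: eq_bigr => i _; rewrite mxE mulrCA.
Qed.

Lemma bilDl x y z : bil (x + y) z = bil x z + bil y z.
Proof. by rewrite !(bilC _ z) bilDr. Qed.

Lemma bilZl c x y : bil (c *: x) y = c * bil x y.
Proof. by rewrite !(bilC _ y) bilZr. Qed.

Lemma bilNr x y : bil x (- y) = - bil x y.
Proof. by rewrite -scaleN1r bilZr mulN1r. Qed.

Lemma bilNl x y : bil (- x) y = - bil x y.
Proof. by rewrite !(bilC _ y) bilNr. Qed.

Lemma bil0r x : bil x 0 = 0.
Proof. by rewrite -(scale0r (0 : wt)) bilZr mul0r. Qed.

Lemma bil0l x : bil 0 x = 0.
Proof. by rewrite bilC bil0r. Qed.

Lemma bilMnr x y j : bil x (y *+ j) = bil x y *+ j.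
Proof. by elim: j => [|j IH]; rewrite ?mulr0n ?bil0r // !mulrS bilDr IH. Qed.

Lemma bilMnl x y j : bil (x *+ j) y = bil x y *+ j.
Proof. by rewrite !(bilC _ y) bilMnr. Qed.

Lemma barK : involutive (@bar m k).
Proof. by case=> i /=; rewrite rev_ordK. Qed.

Lemma gr_bar a : gr (bar a) = gr a.
Proof. by case: a. Qed.

Lemma eps_bar a : eps (bar a) = - eps a.
Proof. by case: a => i; rewrite /Defs.eps /bar rev_ordK opprB. Qed.

(* The value of the antisymmetric extension of F to {0, ..., N - 1} at j;
   every linear functional of the weights eps_a is of this form. *)
Definition anti (V : zmodType) (N : nat) (F : nat -> V) (j : nat) : V :=
  if (j < N./2)%N then F j else if (N - j.+1 < N./2)%N then - F (N - j.+1)%N else 0.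

Lemma anti_pair (V : zmodType) (N : nat) (F : nat -> V) (j : nat) : (j < N)%N ->
  (if (j < N./2)%N then F j else 0) - (if (N - j.+1 < N./2)%N then F (N - j.+1)%N else 0)
  = anti N F j.
Proof.
move=> jN; rewrite /anti; case: ifP => [j1|]; case: ifP => j2; rewrite ?subr0 ?sub0r //.
have := odd_double_half N; lia.
Qed.

(** The sign of the odd part cancels that of the form on the delta's, so that F and G are the values
    of the functional on the [epsn] and on the [deltan]. *)
Definition wtof (F G : nat -> C) : wt := (\row_(i < l) F i, \row_(u < k) - G u).

Lemma bil_wtof_epsn F G j :
  bil (wtof F G) (epsn R m k j) = if (j < l)%N then F j else 0.
Proof.
rewrite /bil /= [X in _ - X]big1 => [|u _]; last by rewrite !mxE mulr0.
rewrite subr0; case: ifP => [jl|jl].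
  rewrite (bigD1 (Ordinal jl)) //= !mxE eqxx mulr1 big1 ?addr0 // => i ij.
  rewrite !mxE; case: eqP => [e|_]; last by rewrite mulr0.
  by case/eqP: ij; exact: val_inj.
rewrite big1 // => i _; rewrite !mxE; case: eqP => [e|_]; last by rewrite mulr0.
by move: (ltn_ord i); rewrite e jl.
Qed.

Lemma bil_wtof_deltan F G j :
  bil (wtof F G) (deltan R m k j) = if (j < k)%N then G j else 0.
Proof.
rewrite /bil /= [X in X - _]big1 => [|u _]; last by rewrite !mxE mulr0.
rewrite sub0r -sumrN; case: ifP => [jl|jl].
  rewrite (bigD1 (Ordinal jl)) //= !mxE eqxx mulr1 opprK big1 ?addr0 // => i ij.
  rewrite !mxE; case: eqP => [e|_]; last by rewrite mulr0 oppr0.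
  by case/eqP: ij; exact: val_inj.
rewrite big1 // => i _; rewrite !mxE; case: eqP => [e|_]; last by rewrite mulr0 oppr0.
by move: (ltn_ord i); rewrite e jl.
Qed.

Lemma bil_wtof_eps F G a : bil (wtof F G) (eps a) =
  match a with inl i => anti m F i | inr u => anti n G u end.
Proof.
case: a => i /=; rewrite bilDr bilNr.
  by rewrite !bil_wtof_epsn anti_pair.
have n2 : n./2 = k by lia.
by rewrite !bil_wtof_deltan -(anti_pair _ (ltn_ord i)) n2.
Qed.

(* rk enumerates the indices along the path delta_1, ..., delta_k, eps_1, ...,
   eps_m, delta_(k+1), ..., delta_n of decreasing weights. *)
Definition rk a : nat :=
  match a with inl i => (k + i)%N | inr u => if (u < k)%N then u : nat else (m + u)%N end.

Lemma rk_lt a : (rk a < m + n)%N.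
Proof. by case: a => i /=; move: (ltn_ord i); [|case: ifP]; lia. Qed.

Lemma rk_inj : injective rk.
Proof.
case=> [i|u] [j|v] /=; rewrite ?fun_if.
- by move/addnI => e; congr inl; exact: val_inj.
- by have := ltn_ord i; case: ifP; lia.
- by have := ltn_ord j; case: ifP; lia.
- move=> e; congr inr; apply: val_inj; move: e => /=.
  by have := ltn_ord u; have := ltn_ord v; case: ifP; case: ifP; lia.
Qed.

Lemma rk_bar a : rk (bar a) = (m + n - (rk a).+1)%N.
Proof.
case: a => i /=; have := ltn_ord i; first by lia.
by case: ifP; case: ifP; lia.
Qed.

(** A weight whose pairing with [eps a] is affine in [rk a]: a single Cartan element that separates
    all weights of V. *)
Definition wsep : wt :=
  wtof (fun i => (m + n)%:R - 1 - 2 * (k + i)%:R) (fun u => (m + n)%:R - 1 - 2 * u%:R).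

Lemma bil_wsep a : bil wsep (eps a) = (m + n)%:R - 1 - 2 * (rk a)%:R.
Proof.
rewrite bil_wtof_eps /anti; case: a => i /=; have il := ltn_ord i.
  case: ifP => // i1; case: ifP => i2.
    have -> : (k + (m - i.+1) = m + n - 1 - (k + i))%N by lia.
    by rewrite !natrB ?natrD; [ring|lia..].
  have -> : (m + n = (k + i) * 2 + 1)%N by have := odd_double_half m; lia.
  by rewrite [(_ + 1)%:R]natrD natrM; ring.
have -> : n./2 = k by lia.
case: ifP => // i1; rewrite ifT; last by lia.
have -> : (n - i.+1 = m + n - 1 - (m + i))%N by lia.
by rewrite !natrB ?natrD; [ring|lia..].
Qed.

Lemma wsep_inj a b : bil wsep (eps a) = bil wsep (eps b) -> a = b.
Proof.
rewrite !bil_wsep => /addrI /oppr_inj /(mulfI _) e; apply: rk_inj.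
by apply/eqP; rewrite -(eqr_nat C); apply/eqP/e; rewrite pnatr_eq0.
Qed.

(** The shift that gives height 1 to the last even simple root, which is eps_l for odd m and
    eps_(l-1) + eps_l for even m. *)
Definition ctop : nat := (l - ~~ odd m)%N.

(** It pairs to 1 with every simple root ([bil_wht_alpha]), so commutation with [uh wht] measures
    the degree in the raising and lowering generators. *)
Definition wht : wt :=
  wtof (fun i => ctop%:R - i%:R) (fun u => ctop%:R + k%:R - u%:R).

(** The pairing with [wht], kept in the integers. For even m both middle indices have height 0, so
    [hgt] is monotone along [rk] but not injective. *)
Definition hgt a : int :=
  match a with
  | inl i => anti m (fun i => ctop%:Z - i%:Z) i
  | inr u => anti n (fun u => ctop%:Z + k%:Z - u%:Z) u
  end.

Lemma bil_wht a : bil wht (eps a) = (hgt a)%:~R.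
Proof.
rewrite bil_wtof_eps; case: a => i /=; rewrite /anti;
  by case: ifP => _; [|case: ifP => _ //]; rewrite ?rmorphN ?rmorphB ?rmorphD.
Qed.

Lemma hgt_le a b : (rk a <= rk b)%N -> (hgt b <= hgt a)%R.
Proof.
have mE := odd_double_half m; rewrite /hgt /anti /ctop.
have n2 : n./2 = k by lia.
case: a b => [i|u] [j|v] /=; rewrite ?n2.
- by move: (ltn_ord i) (ltn_ord j); repeat case: ifP; lia.
- by move: (ltn_ord i) (ltn_ord v); repeat case: ifP; lia.
- by move: (ltn_ord u) (ltn_ord j); repeat case: ifP; lia.
- by move: (ltn_ord u) (ltn_ord v); repeat case: ifP; lia.
Qed.

Lemma hgt_bound a : (`|hgt a| <= (m + n))%N.
Proof.
have mE := odd_double_half m; rewrite /hgt /anti /ctop.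
have n2 : n./2 = k by lia.
by case: a => [i|u] /=; rewrite ?n2; [move: (ltn_ord i)|move: (ltn_ord u)];
  repeat case: ifP; lia.
Qed.

Hypotheses (m_gt2 : (2 < m)%N) (k_gt0 : (0 < k)%N).

Lemma bil_wht_alpha c : bil wht (@alpha R m k c) = 1.
Proof.
case: c => [i|u|] /=.
- case: ifP => [i1|i1].
    rewrite bilDr bilNr !bil_wtof_epsn i1 ltn_ord -natr1; ring.
  have il := ltn_ord i; have mE := odd_double_half m.
  case: ifP => mo; rewrite ?bilDr !bil_wtof_epsn ltn_ord /ctop mo /=.
    have -> : (l - 0 = i.+1)%N by lia.
    by rewrite -natr1; ring.
  have -> : (i.-1 < l)%N by lia.
  have -> : (l - 1 = i)%N by lia.
  have -> : (i = i.-1.+1 :> nat)%N by lia.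
  by rewrite -natr1 /=; ring.
- have ul := ltn_ord u.
  rewrite bilDr bilNr !bil_wtof_deltan !ifT; [|lia..].
  by rewrite -natr1; ring.
- rewrite bilDr bilNr bil_wtof_deltan bil_wtof_epsn !ifT; [|lia..].
  by rewrite -[in k%:R](prednK k_gt0) -natr1; ring.
Qed.

End Weights.

(** * Relations in the quantum superalgebra *)

Section SuperalgAux.
Variables (K : fieldType) (A : superAlgType K).
Implicit Types x y : A.

Lemma cstMr c d x : cst c * (cst d * x) = cst (c * d) * x.
Proof. by rewrite mulrA -cstM. Qed.

Lemma cst0l x : cst 0 * x = 0.
Proof. by rewrite cst0 mul0r. Qed.

Lemma cst1l x : cst 1 * x = x.
Proof. by rewrite cst1 mul1r. Qed.

Lemma cstDl c d x : cst (c + d) * x = cst c * x + cst d * x.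
Proof. by rewrite cstD mulrDl. Qed.

Lemma mulr_cst c x y : x * (cst c * y) = cst c * (x * y).
Proof. by rewrite mulrA -cstC mulrA. Qed.

Lemma cst_signK b x : cst ((-1) ^+ b) * (cst ((-1) ^+ b) * x) = x.
Proof. by rewrite cstMr -expr2 sqrr_sign cst1l. Qed.
End SuperalgAux.

Lemma smx_mull_inl (K : fieldType) (I : finType) (gI : I -> bool)
    (A : superAlgType K) (X : smx gI K^o) (Y : smx gI A) a d :
  (smx_inl gI A X * Y) (a, d) = \sum_b cst (X (a, b) : K) * Y (b, d).
Proof. by rewrite smxMl; apply: eq_bigr => b _; rewrite smx_inlE parn_cst. Qed.

Lemma smx_mulr_inl (K : fieldType) (I : finType) (gI : I -> bool)
    (A : superAlgType K) (X : smx gI K^o) (Y : smx gI A) a d :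
  (Y * smx_inl gI A X) (a, d) =
  \sum_b cst (X (b, d) : K) * parn (gI b (+) gI d) (Y (a, b)).
Proof. by rewrite smxMl; apply: eq_bigr => b _; rewrite smx_inlE cstC. Qed.

Lemma smx_mull_inr (K : fieldType) (I : finType) (gI : I -> bool)
    (A : superAlgType K) (x : A) (Y : smx gI A) a d :
  (smx_inr gI A x * Y) (a, d) = parn (gI a (+) gI d) x * Y (a, d).
Proof. exact: smx_mul_diagl. Qed.

Lemma smx_mulr_inr (K : fieldType) (I : finType) (gI : I -> bool)
    (A : superAlgType K) (x : A) (Y : smx gI A) a d :
  (Y * smx_inr gI A x) (a, d) = Y (a, d) * x.
Proof. exact: smx_mul_diagr. Qed.

Lemma smx_cstMl (K : fieldType) (I : finType) (gI : I -> bool)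
    (A : superAlgType K) c (Y : smx gI A) a d :
  (cst c * Y) (a, d) = cst c * Y (a, d).
Proof. by rewrite [LHS]smx_mul_diagl parn_cst. Qed.

Lemma smx_scalarMl (K : fieldType) (I : finType) (gI : I -> bool)
    (X Y : smx gI K^o) a d :
  (X * Y) (a, d) = \sum_b X (a, b) * Y (b, d).
Proof. by rewrite smxMl; apply: eq_bigr => b _; case: (_ (+) _). Qed.

Section Relations.
Variables (R : realType) (m k : nat) (hq : R[i]).
Local Notation C := R[i].
Local Notation wt := (weight R m k).
Local Notation U := (Uosp m k hq).
Local Notation alpha := (@alpha R m k).
Local Notation qpow := (qpow hq).
Local Notation uh := (@uh R m k hq).
Local Notation uq := (@uq R m k hq).
Local Notation ue := (@ue R m k hq).
Local Notation uf := (@uf R m k hq).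
Implicit Types (x y : wt) (c d : sroot m k).

Lemma uh_lin a x y : uh (a *: x + y) = cst a * uh x + uh y.
Proof. by rewrite /Defs.uh [LHS](pcls_eq (sc_rel (or_h_lin _ _ _ _))) pcls_add pcls_mul. Qed.

Lemma uhD x y : uh (x + y) = uh x + uh y.
Proof. by rewrite -{1}(scale1r x) uh_lin cst1l. Qed.

Lemma uh0 : uh 0 = 0.
Proof. by apply: (addrI (uh 0)); rewrite -uhD !addr0. Qed.

Lemma uhZ a x : uh (a *: x) = cst a * uh x.
Proof. by rewrite -(addr0 (a *: x)) uh_lin uh0 addr0. Qed.

Lemma uhh x y : uh x * uh y = uh y * uh x.
Proof. by rewrite -[LHS]pcls_mul [LHS](pcls_eq (sc_rel (or_hh _ _ _))) pcls_mul. Qed.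

Lemma uhq x y : uh x * uq y = uq y * uh x.
Proof. by rewrite -[LHS]pcls_mul [LHS](pcls_eq (sc_rel (or_hq _ _ _))) pcls_mul. Qed.

Lemma uhe x c : uh x * ue c = ue c * uh x + cst (bil x (alpha c)) * ue c.
Proof.
have := pcls_eq (sc_rel (or_he hq x c)); rewrite pcls_add !pcls_mul !pcls_cst.
by rewrite cstN cst1 mulN1r => /eqP; rewrite subr_eq addrC => /eqP.
Qed.

Lemma uhf x c : uh x * uf c = uf c * uh x + cst (- bil x (alpha c)) * uf c.
Proof.
have := pcls_eq (sc_rel (or_hf hq x c)); rewrite pcls_add !pcls_mul !pcls_cst.
by rewrite cstN cst1 mulN1r => /eqP; rewrite subr_eq addrC => /eqP.
Qed.

Lemma uqf x c : uq x * uf c = cst (qpow (- bil x (alpha c))) * (uf c * uq x).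
Proof. by rewrite -[LHS]pcls_mul [LHS](pcls_eq (sc_rel (or_qf _ _ _))) !pcls_mul. Qed.

Lemma par_uh x : par (uh x) = uh x.
Proof. by rewrite -[LHS]pcls_par [LHS](pcls_eq (sc_rel (or_par_h _ _))). Qed.

Lemma par_uq x : par (uq x) = uq x.
Proof. by rewrite -[LHS]pcls_par [LHS](pcls_eq (sc_rel (or_par_q _ _))). Qed.

Lemma homog_ue c : homog (sgr c) (ue c).
Proof. by rewrite /homog -[LHS]pcls_par (pcls_eq (sc_rel (or_par_e _ _))) pcls_mul. Qed.

Lemma homog_uf c : homog (sgr c) (uf c).
Proof. by rewrite /homog -[LHS]pcls_par (pcls_eq (sc_rel (or_par_f _ _))) pcls_mul. Qed.

Lemma uef c d : ue c * uf d = cst ((-1) ^+ (sgr c && sgr d)) * (uf d * ue c)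
  + (if `[< c = d >] then
       cst (qpow 1 - (qpow 1)^-1)^-1 * (uq (alpha c) - uq (- alpha c)) else 0).
Proof.
case: asboolP => [->|cd].
  have := pcls_eq (sc_rel (or_ef hq d)).
  rewrite !(pcls_add, pcls_mul) !pcls_cst cstN cst1 !mulN1r andbb.
  by move/eqP; rewrite subr_eq addrC => /eqP.
have := pcls_eq (sc_rel (@or_ef0 _ _ _ hq c d cd)).
rewrite !(pcls_add, pcls_mul) !pcls_cst cstN cst1 !mulN1r cst0 addr0.
by move/eqP; rewrite subr_eq0 => /eqP.
Qed.

(** The generators are homogeneous, so [par] can be eliminated from the induction by proving P for x
    and for [par x] together. *)
Lemma uosp_ind (P : U -> Prop) :
  (forall c, P (ue c)) -> (forall c, P (uf c)) ->
  (forall x, P (uh x)) -> (forall x, P (uq x)) -> (forall z : C, P (cst z)) ->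
  (forall a b : U, P a -> P b -> P (a + b)) ->
  (forall a b : U, P a -> P b -> P (a * b)) -> forall a, P a.
Proof.
move=> Pe Pf Ph Pq Pc PD PM x.
have [] // : P x /\ P (par x).
elim/pres_gen_ind: x => [[c|c|y|y]|c|x y [? ?] [? ?]|x y [? ?] [? ?]|x [? ?]].
- split; first exact: (Pe c).
  by rewrite [par _](homog_ue c); apply: PM => //; exact: Pe.
- split; first exact: (Pf c).
  by rewrite [par _](homog_uf c); apply: PM => //; exact: Pf.
- by rewrite [par _](par_uh y); split; exact: Ph.
- by rewrite [par _](par_uq y); split; exact: Pq.
- by rewrite par_cst; split; exact: Pc.
- by rewrite parD; split; exact: PD.
- by rewrite parM; split; exact: PM.
- by rewrite parK; split.
Qed.

Lemma borel_par (x : sroot m k -> U) : (forall c, homog (sgr c) (x c)) ->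
  forall i a, borel x i a -> borel x i (par a).
Proof.
move=> hx i a; elim=> {i a}.
- by rewrite par1; exact: borel_one.
- by move=> y; rewrite par_uh; exact: borel_h.
- by move=> y; rewrite par_uq; exact: borel_q.
- by move=> c; rewrite hx; apply: borel_Z; exact: borel_x.
- by move=> i j a b _ Ha _ Hb; rewrite parM; exact: borel_M.
- by move=> i a b _ Ha _ Hb; rewrite parD; exact: borel_D.
- by move=> i z a _ Ha; rewrite parM par_cst; exact: borel_Z.
Qed.

Lemma borel_parn (x : sroot m k -> U) : (forall c, homog (sgr c) (x c)) ->
  forall b i a, borel x i a -> borel x i (parn b a).
Proof. by move=> hx [] i a //=; exact: borel_par. Qed.

Lemma borel_prod (x : sroot m k -> U) cs : borel x (size cs) (\prod_(c <- cs) x c).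
Proof.
elim: cs => [|c cs IH] /=; first by rewrite big_nil; exact: borel_one.
by rewrite big_cons -add1n; apply: borel_M => //; exact: borel_x.
Qed.

Hypotheses (m_gt2 : (2 < m)%N) (k_gt0 : (0 < k)%N).
Local Notation wht := (wht R m k).

Lemma borel_wht (x : sroot m k -> U) (z : C) :
  (forall c, uh wht * x c = x c * uh wht + cst z * x c) ->
  forall i a, borel x i a -> uh wht * a = a * uh wht + cst (z *+ i) * a.
Proof.
move=> hx i a; elim=> {i a}.
- by rewrite mulr1 mul1r mulr0n cst0l addr0.
- by move=> y; rewrite uhh mulr0n cst0l addr0.
- by move=> y; rewrite uhq mulr0n cst0l addr0.
- exact: hx.
- move=> i j a b _ Ha _ Hb; rewrite mulrA Ha mulrDl -mulrA Hb mulrDr mulr_cst.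
  by rewrite -[cst _ * a * b]mulrA -addrA -cstDl -mulrnDr mulrA (addnC j).
- by move=> i a b _ Ha _ Hb; rewrite mulrDr Ha Hb mulrDl mulrDr addrACA.
- move=> i c a _ Ha; rewrite [LHS]mulr_cst Ha mulrDr.
  by congr (_ + _); [exact: mulrA|exact: mulr_cst].
Qed.

Lemma borel_uf_wht i a : borel uf i a ->
  uh wht * a = a * uh wht + cst (-1 *+ i) * a.
Proof. by apply: borel_wht => c; rewrite uhf bil_wht_alpha. Qed.

Lemma borel_ue_wht i a : borel ue i a ->
  uh wht * a = a * uh wht + cst (1 *+ i) * a.
Proof. by apply: borel_wht => c; rewrite uhe bil_wht_alpha. Qed.
End Relations.

(** * Pairings between the weights of the vector representation *)

Section BilEps.
Variables (R : realType) (m k : nat).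
Local Notation l := (m./2).

Lemma epsnE j : epsn R m k j = wtof m k (fun i => (i == j)%:R) (fun => 0).
Proof. by congr pair; apply/rowP => u; rewrite !mxE ?oppr0. Qed.

Lemma deltanE j : deltan R m k j = wtof m k (fun => 0) (fun i => - (i == j)%:R).
Proof. by congr pair; apply/rowP => u; rewrite !mxE ?opprK. Qed.

Lemma bil_epsn i j : bil (epsn R m k i) (epsn R m k j) = ((i == j) && (i < l)%N)%:R.
Proof.
rewrite [epsn R m k i]epsnE bil_wtof_epsn eq_sym.
by case: eqP => [->|_]; case: ifP.
Qed.

Lemma bil_deltan i j : bil (deltan R m k i) (deltan R m k j) = - ((i == j) && (i < k)%N)%:R.
Proof.
rewrite [deltan R m k i]deltanE bil_wtof_deltan eq_sym.
by case: eqP => [->|_]; case: ifP; rewrite ?oppr0.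
Qed.

Lemma bil_epsn_deltan i j : bil (epsn R m k i) (deltan R m k j) = 0.
Proof. by rewrite epsnE bil_wtof_deltan; case: ifP. Qed.

Lemma bil_deltan_epsn i j : bil (deltan R m k i) (epsn R m k j) = 0.
Proof. by rewrite bilC bil_epsn_deltan. Qed.

Lemma bil_eps (c a : idx m k) : bil (eps R c) (eps R a) =
  (-1) ^+ gr c * ((a == c)%:R - (a == bar c)%:R).
Proof.
have mE := odd_double_half m.
case: c a => [i|u] [j|v]; rewrite [eps R _ in X in X = _]/eps.
- rewrite bilDl bilNl !epsnE -!epsnE !epsnE !bil_wtof_eps /anti /= mul1r.
  have -> : (inl j == inl i :> idx m k) = (j == i :> nat) by [].
  have -> : (inl j == inl (rev_ord i) :> idx m k) = (j == m - i.+1 :> nat)%N by [].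
  move: (ltn_ord i) (ltn_ord j) => il jl.
  case: ifP => j1; last case: ifP => j2; rewrite ?subr0 //.
    have -> : (m - j.+1 == i)%N = (nat_of_ord j == m - i.+1)%N by apply/eqP/eqP; lia.
    have -> : (m - j.+1 == m - i.+1)%N = (nat_of_ord j == i) by apply/eqP/eqP; lia.
    by rewrite opprK addrC.
  have -> : (nat_of_ord j == m - i.+1)%N = (nat_of_ord j == i) by apply/eqP/eqP; lia.
  by rewrite subrr.
- rewrite bilDl bilNl !epsnE !bil_wtof_eps /anti /=.
  by repeat case: ifP => _; rewrite ?oppr0 ?addr0 ?mulr0.
- rewrite bilDl bilNl !deltanE !bil_wtof_eps /anti /=.
  by repeat case: ifP => _; rewrite ?oppr0 ?addr0 ?mulr0.
- rewrite bilDl bilNl !deltanE !bil_wtof_eps /anti /= expr1 mulN1r.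
  have -> : (inr v == inr u :> idx m k) = (v == u :> nat) by [].
  have -> : (inr v == inr (rev_ord u) :> idx m k) = (v == 2 * k - u.+1 :> nat)%N by [].
  have n2 : (2 * k)./2 = k by lia.
  move: (ltn_ord u) (ltn_ord v) => il jl; rewrite n2.
  case: ifP => j1; last (case: ifP => j2; last lia); rewrite ?opprK ?opprB //; first by rewrite addrC.
    have -> : (2 * k - v.+1 == u)%N = (nat_of_ord v == 2 * k - u.+1)%N by apply/eqP/eqP; lia.
  have -> : (2 * k - v.+1 == 2 * k - u.+1)%N = (nat_of_ord v == u) by apply/eqP/eqP; lia.
  by [].
Qed.

Lemma fst_sum (I : finType) (F : I -> weight R m k) : (\sum_i F i).1 = \sum_i (F i).1.
Proof. by apply: (big_morph fst). Qed.

Lemma snd_sum (I : finType) (F : I -> weight R m k) : (\sum_i F i).2 = \sum_i (F i).2.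
Proof. by apply: (big_morph snd). Qed.

Lemma wt_decomp (y : weight R m k) :
  y = \sum_(i < l) y.1 0 i *: epsn R m k i + \sum_(u < k) y.2 0 u *: deltan R m k u.
Proof.
case: y => y z; rewrite [RHS]surjective_pairing /= !fst_sum !snd_sum.
congr pair; apply/rowP => j; rewrite !mxE !summxE.
  rewrite [X in _ + X]big1 ?addr0 => [|u _]; last by rewrite !mxE mulr0.
  rewrite (bigD1 j) //= !mxE eqxx mulr1 big1 ?addr0 // => i ij.
  by rewrite !mxE; case: eqP => [/val_inj e|_]; [rewrite e eqxx in ij|rewrite mulr0].
rewrite [X in X + _]big1 ?add0r => [|u _]; last by rewrite !mxE mulr0.
rewrite (bigD1 j) //= !mxE eqxx mulr1 big1 ?addr0 // => i ij.
by rewrite !mxE; case: eqP => [/val_inj e|_]; [rewrite e eqxx in ij|rewrite mulr0].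
Qed.

Lemma epsn_ge j : (l <= j)%N -> epsn R m k j = 0.
Proof.
move=> lj; congr pair; apply/rowP => u; rewrite !mxE.
by case: eqP => // e; move: (ltn_ord u); lia.
Qed.

Lemma deltan_ge j : (k <= j)%N -> deltan R m k j = 0.
Proof.
move=> lj; congr pair; apply/rowP => u; rewrite !mxE.
by case: eqP => // e; move: (ltn_ord u); lia.
Qed.

Lemma epsn_eps (i : 'I_m) : (i < l)%N -> epsn R m k i = eps R (inl i : idx m k).
Proof.
move=> il; rewrite /eps (epsn_ge (j := rev_ord i)) ?subr0 //=.
by have := odd_double_half m; lia.
Qed.

Lemma deltan_eps (u : 'I_(2 * k)) : (u < k)%N -> deltan R m k u = eps R (inr u : idx m k).
Proof. by move=> uk; rewrite /eps (deltan_ge (j := rev_ord u)) ?subr0 //=; lia. Qed.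

(** [is_vector_rep] prescribes pi on h_lambda only for lambda = [eps a]; these weights span. *)
Lemma wt_eps_ind (P : weight R m k -> Prop) : P 0 ->
  (forall x y, P x -> P y -> P (x + y)) -> (forall c x, P x -> P (c *: x)) ->
  (forall a, P (eps R a)) -> forall x, P x.
Proof.
move=> P0 PD PZ Pe x; rewrite (wt_decomp x).
apply: (PD); apply: (big_ind P P0 PD) => i _; apply: PZ.
  have im : (i < m)%N by have := ltn_ord i; have := odd_double_half m; lia.
  by rewrite -[nat_of_ord i]/(nat_of_ord (Ordinal im)) epsn_eps; [exact: Pe|exact: (ltn_ord i)].
have ik : (i < 2 * k)%N by have := ltn_ord i; lia.
by rewrite -[nat_of_ord i]/(nat_of_ord (Ordinal ik)) deltan_eps; [exact: Pe|exact: (ltn_ord i)].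
Qed.
End BilEps.

(** The modules are equal and not only isomorphic, since the action laws are propositions;
    admissibility can thus be rewritten along it. *)
Lemma pull_comp (K : fieldType) (A B D : superAlgType K) (f : shom A B)
    (g : shom B D) (M : amod D) : pull f (pull g M) = pull (scomp g f) M.
Proof. by rewrite /pull; congr AMod; exact: Prop_irrelevance. Qed.

(** * The vector representation and admissible modules *)

Section VectorRep.
Variables (R : realType) (m k : nat) (hq : R[i]).
Local Notation C := R[i].
Local Notation wt := (weight R m k).
Local Notation idx := (idx m k).
Local Notation U := (Uosp m k hq).
Local Notation UU := (stens U U).
Local Notation EndV := (smx (@gr m k) C^o).
Local Notation alpha := (@alpha R m k).
Local Notation eps := (@eps R m k).
Local Notation qpow := (qpow hq).
Local Notation uh := (@uh R m k hq).
Local Notation uq := (@uq R m k hq).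
Local Notation ue := (@ue R m k hq).
Local Notation uf := (@uf R m k hq).
Local Notation sroot := (sroot m k).
Hypotheses (m_gt2 : (2 < m)%N) (k_gt0 : (0 < k)%N).
Variable pi : shom U EndV.
Hypothesis piP : is_vector_rep pi.
Implicit Types (a b c d : idx) (x y : wt).

Lemma EmxE a b c d : Emx R a b (c, d) = ((c == a) && (d == b))%:R.
Proof. by rewrite [LHS]ffunE xpair_eqE. Qed.

Lemma pi_uhE y a b : pi (uh y) (a, b) = if a == b then bil y (eps a) else 0.
Proof.
elim/wt_eps_ind: y => [|x y IHx IHy|z x IH|c].
- by rewrite uh0 shom0 ffunE bil0l if_same.
- by rewrite uhD shomD smx_addE IHx IHy bilDl; case: eqP; rewrite ?addr0.
- rewrite uhZ shomM shom_cst smx_cstMl IH bilZl.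
  by case: eqP => _; rewrite ?mulr0.
- have [-> _ _ _ _] := piP; rewrite smx_cstMl smx_addE !EmxE bil_eps.
  have -> : (gr c && (gr c (+) gr c)) = false by rewrite addbb andbF.
  have xc : xi R c * xi R c = 1.
    by rewrite /xi; case: (c) => [i|u]; rewrite ?mulr1 // -exprMn mulrNN mulr1 expr1n.
  rewrite expr0 mul1r xc cst1 mul1r.
  have -> : (- Emx R (bar c) (bar c)) (a, b) = - Emx R (bar c) (bar c) (a, b).
    exact: ffunE.
  rewrite EmxE; case: (eqVneq a b) => [->|ab]; first by rewrite !andbb.
  have E z : (a == z) && (b == z) = false.
    by apply/negP => /andP[/eqP az /eqP bz]; rewrite az bz eqxx in ab.
  by rewrite !E subrr mulr0.
Qed.

Lemma pi_uqE y a b : pi (uq y) (a, b) = if a == b then qpow (bil y (eps a)) else 0.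
Proof.
have [_ -> _ _ _] := piP; rewrite sum_ffunE /= (bigD1 a) //= big1 => [|c ca].
  by rewrite smx_cstMl EmxE eqxx addr0 eq_sym; case: eqP => _; rewrite ?mulr1 ?mulr0.
by rewrite smx_cstMl EmxE eq_sym (negPf ca) mulr0.
Qed.

Lemma pi_diagl y (X : EndV) a b :
  (pi (uh y) * X) (a, b) = bil y (eps a) * X (a, b).
Proof.
rewrite smx_scalarMl (bigD1 a) //= pi_uhE eqxx big1 ?addr0 // => c ca.
by rewrite pi_uhE eq_sym (negPf ca) mul0r.
Qed.

Lemma pi_diagr y (X : EndV) a b :
  (X * pi (uh y)) (a, b) = bil y (eps b) * X (a, b).
Proof.
rewrite smx_scalarMl (bigD1 b) //= pi_uhE eqxx big1 ?addr0 => [|c ca].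
  by rewrite mulrC.
by rewrite pi_uhE (negPf ca) mulr0.
Qed.

Lemma pi_comm_wt y u (z : C) a b : uh y * u = u * uh y + cst z * u ->
  pi u (a, b) != 0 -> bil y (eps a) - bil y (eps b) = z.
Proof.
move=> /(congr1 pi) /ffunP /(_ (a, b)).
rewrite shomD smx_addE !shomM shom_cst smx_cstMl pi_diagl pi_diagr -mulrDl => e n0.
by rewrite (mulIf n0 e) addrC addKr.
Qed.

Lemma pi_ue_wt (c : sroot) a b : pi (ue c) (a, b) != 0 ->
  forall y, bil y (eps a) - bil y (eps b) = bil y (alpha c).
Proof. by move=> n0 y; apply: (pi_comm_wt _ n0); exact: uhe. Qed.

Lemma pi_uf_wt (c : sroot) a b : pi (uf c) (a, b) != 0 ->
  forall y, bil y (eps a) - bil y (eps b) = - bil y (alpha c).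
Proof. by move=> n0 y; apply: (pi_comm_wt _ n0); exact: uhf. Qed.

Lemma pi_homog p u a b : homog p u -> pi u (a, b) != 0 -> gr a (+) gr b = p.
Proof.
move=> /(shom_homog pi) /ffunP /(_ (a, b)); rewrite smx_parE smx_cstMl => e n0.
have /eqP := mulIf n0 e; rewrite -subr_eq0.
by case: (gr a (+) gr b) p {e} => [] [] //=; rewrite ?opprK -?opprD ?oppr_eq0 (_ : 1 + 1 = 2%:R) // pnatr_eq0.
Qed.

Lemma pi_borel_uf i u a b : borel uf i u -> pi u (a, b) != 0 ->
  hgt a = hgt b - i%:Z.
Proof.
move=> /(borel_uf_wht m_gt2 k_gt0) e /(pi_comm_wt e).
rewrite !bil_wht mulNrn (pmulrn 1 i) -rmorphB -rmorphN => /intr_inj E; lia.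
Qed.

Lemma pi_borel_ue i u a b : borel ue i u -> pi u (a, b) != 0 ->
  hgt a = hgt b + i%:Z.
Proof.
move=> /(borel_ue_wht m_gt2 k_gt0) e /(pi_comm_wt e).
rewrite !bil_wht (pmulrn 1 i) -rmorphB => /intr_inj E; lia.
Qed.

Lemma Emx_sum : \sum_a Emx R a a = 1 :> EndV.
Proof.
apply/ffunP => -[x y]; rewrite sum_ffunE -(@cst1 _ EndV) smx_cstE.
rewrite (bigD1 x) //= big1 => [|z zb]; last by rewrite EmxE eq_sym (negPf zb).
by rewrite EmxE eqxx addr0 eq_sym; case: eqP.
Qed.

Lemma pi_uh_Emx y a b : pi (uh y) * Emx R a b = cst (bil y (eps a)) * Emx R a b.
Proof.
apply/ffunP => -[x z]; rewrite pi_diagl smx_cstMl EmxE.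
by case: eqP => [->|_] //; rewrite !mulr0.
Qed.

Lemma pi_uq_Emx y a b : pi (uq y) * Emx R a b = cst (qpow (bil y (eps a))) * Emx R a b.
Proof.
apply/ffunP => -[x z]; rewrite smx_scalarMl smx_cstMl (bigD1 x) //= big1 => [|c cx].
  by rewrite pi_uqE eqxx addr0 !EmxE; case: eqP => [->|_] //; rewrite !mulr0.
by rewrite pi_uqE eq_sym (negPf cx) mul0r.
Qed.

Section Admissible.
Variables (D : superAlgType C) (F : shom UU D) (j : shom EndV D).

Lemma wvec_pull (tin : shom U UU) : (forall u, F (tin u) = j (pi u)) ->
  forall a b (v : D), wvec tin (eps a) (j (Emx R a b) * v : pull F (regmod D)).
Proof.
move=> Fj a b v y; split.
  by rewrite /= Fj mulrA -shomM pi_uh_Emx shomM shom_cst -mulrA.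
by rewrite /= Fj mulrA -shomM pi_uq_Emx shomM shom_cst -mulrA.
Qed.

(** The decomposition 1 = sum_a E^a_a splits any v into the vectors E^a_a v, of weights eps_a. *)
Lemma weightmod_pull (tin : shom U UU) : (forall u, F (tin u) = j (pi u)) ->
  weightmod tin (pull F (regmod D)).
Proof.
move=> Fj v.
pose f a : wt * pull F (regmod D) := (eps a, j (Emx R a a) * (v : D)).
exists [seq f a | a <- enum {: idx}]; split=> [i|].
  have /mapP[a _ ->] := mem_tnth i (in_tuple [seq f a | a <- enum {: idx}]).
  exact: wvec_pull.
rewrite big_map big_enum /=.
rewrite -[LHS](mul1r (v : D)) -(shom1 j) -Emx_sum shom_sum mulr_suml.
by [].
Qed.

(** Each lowering generator shifts the height by -1, while all heights lie between -(m + n) and m +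
    n. *)
Lemma pi_prod_uf0 cs : (2 * (m + 2 * k) < size cs)%N ->
  pi (\prod_(c <- cs) uf c) = 0.
Proof.
move=> sz; apply/ffunP => -[a b]; rewrite [RHS]ffunE; apply/eqP/negPn/negP.
move=> /(pi_borel_uf (borel_prod uf cs)).
by have := hgt_bound a; have := hgt_bound b; lia.
Qed.

Lemma pi_prod_ue0 cs : (2 * (m + 2 * k) < size cs)%N ->
  pi (\prod_(c <- cs) ue c) = 0.
Proof.
move=> sz; apply/ffunP => -[a b]; rewrite [RHS]ffunE; apply/eqP/negPn/negP.
move=> /(pi_borel_ue (borel_prod ue cs)).
by have := hgt_bound a; have := hgt_bound b; lia.
Qed.

Lemma adm_l_pull : (forall u, F (tinl u) = j (pi u)) -> adm_l (pull F (regmod D)).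
Proof.
move=> Fj; split; first exact: weightmod_pull.
move=> v; exists (2 * (m + 2 * k)).+1 => cs sz.
by rewrite /= Fj pi_prod_uf0 // shom0 mul0r.
Qed.

Lemma adm_r_pull : (forall u, F (tinr u) = j (pi u)) -> adm_r (pull F (regmod D)).
Proof.
move=> Fj; split; first exact: weightmod_pull.
move=> v; exists (2 * (m + 2 * k)).+1 => cs sz.
by rewrite /= Fj pi_prod_ue0 // shom0 mul0r.
Qed.
End Admissible.
End VectorRep.

Lemma smx_map_inl (K : fieldType) (I : finType) (gI : I -> bool)
    (A B : superAlgType K) (f : shom A B) (X : smx gI K^o) :
  smx_map gI f (smx_inl gI A X) = smx_inl gI B X.
Proof. by apply/ffunP => -[a b]; rewrite [LHS]smx_mapE !smx_inlE shom_cst. Qed.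

Lemma smx_map_inr (K : fieldType) (I : finType) (gI : I -> bool)
    (A B : superAlgType K) (f : shom A B) (x : A) :
  smx_map gI f (smx_inr gI A x) = smx_inr gI B (f x).
Proof.
by apply/ffunP => -[a b]; rewrite [LHS]smx_mapE !smx_inrE; case: eqP; rewrite ?shom0.
Qed.

(** The identity is a homomorphism between the two modules, so naturality of [cop] replaces a
    transport along [pull_comp]. *)
Lemma cop_pull_comp (K : fieldType) (B B' D : superAlgType K) (P : amod B -> Prop)
    (X : completion P) (f : shom B B') (g : shom B' D) (M : amod D) (v : M) :
  P (pull f (pull g M)) ->
  cop X (v : pull f (pull g M)) = cop X (v : pull (scomp g f) M).
Proof.
move=> P1; have P2 : P (pull (scomp g f) M) by rewrite -pull_comp.
have hid : @is_amod_hom _ _ (pull f (pull g M)) (pull (scomp g f) M) id by [].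
exact: (cop_nat X P1 P2 hid v).
Qed.

(** * The Lax operators *)

Section LaxOperator.
Variables (R : realType) (m k : nat) (hq : R[i]).
Local Notation C := R[i].
Local Notation idx := (idx m k).
Local Notation U := (Uosp m k hq).
Local Notation UU := (stens U U).
Local Notation EndV := (smx (@gr m k) C^o).
Local Notation EndVU := (smx (@gr m k) U).
Local Notation eps := (@eps R m k).
Local Notation uq := (@uq R m k hq).
Local Notation ue := (@ue R m k hq).
Local Notation uf := (@uf R m k hq).
Local Notation jl := (smx_inl (@gr m k) U).
Local Notation jr := (smx_inr (@gr m k) U).
Hypotheses (m_gt2 : (2 < m)%N) (k_gt0 : (0 < k)%N).
Variable Delta : shom U UU.
Variable pi : shom U EndV.
Hypothesis piP : is_vector_rep pi.
Variable Rm : completion (@adm R m k hq).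
Hypotheses (RmP : universal_R Delta Rm) (RmD : double_form Rm).
Implicit Types (a b c d : idx).

Lemma pi_id_inl u : pi_id pi (tinl u) = jl (pi u).
Proof. exact: tlift_inl. Qed.

Lemma pi_id_inr u : pi_id pi (tinr u) = jr u.
Proof. exact: tlift_inr. Qed.

Lemma pi_id_tens u u' : pi_id pi (tens u u') = jl (pi u) * jr u'.
Proof. by rewrite shomM pi_id_inl pi_id_inr. Qed.

Lemma pi_id_twist u u' : pi_id pi (ttwist U U (tens u u')) = jr u * jl (pi u').
Proof. by rewrite !shomM ttwist_inl ttwist_inr pi_id_inl pi_id_inr. Qed.

Local Notation F := (pi_id pi).
Local Notation FT := (scomp (pi_id pi) (ttwist U U)).

Lemma adm_F : adm_l (pull F (regmod EndVU)).
Proof. by apply: (adm_l_pull m_gt2 k_gt0 piP (j := jl)) => u; exact: pi_id_inl. Qed.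

Lemma FT_inr u : FT (tinr u) = jl (pi u).
Proof. exact: (etrans (congr1 F (ttwist_inr U u)) (pi_id_inl u)). Qed.

Lemma FT_inl u : FT (tinl u) = jr u.
Proof. exact: (etrans (congr1 F (ttwist_inl U u)) (pi_id_inr u)). Qed.

Lemma adm_FT : adm_r (pull FT (regmod EndVU)).
Proof. by apply: (adm_r_pull m_gt2 k_gt0 piP (j := jl)) => u; exact: FT_inr. Qed.

(** Evenness of [Rm] compares its action on a module and on the twist of this module by the parity
    automorphism; [par] on End V (x) U is a homomorphism between the corresponding regular
    modules. *)
Lemma Lax_even : par (Lax pi Rm) = Lax pi Rm.
Proof.
have [ev _ _ _ _] := RmP.
pose F' := scomp F (sparity UU).
have aF' : adm (pull F' (regmod EndVU)).
  left; apply: (adm_l_pull m_gt2 k_gt0 piP (j := scomp jl (sparity EndV))) => u.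
  by rewrite /F' [LHS]shom_par pi_id_inl -shom_par.
have <- : cimg F' Rm = par (Lax pi Rm).
  by apply: (@cimg_natural _ _ _ Rm _ _ _ _ (sparity EndVU)) => //; [left; exact: adm_F|move=> x; exact: shom_par].
rewrite /cimg -cop_pull_comp; last by rewrite pull_comp.
exact: (ev (pull F (regmod EndVU)) 1 (or_introl adm_F)).
Qed.

Lemma LaxT_even : par (LaxT pi Rm) = LaxT pi Rm.
Proof.
have [ev _ _ _ _] := RmP.
pose F' := scomp FT (sparity UU).
have aF' : adm (pull F' (regmod EndVU)).
  right; apply: (adm_r_pull m_gt2 k_gt0 piP (j := scomp jl (sparity EndV))) => u.
  by rewrite /F' [LHS]shom_par FT_inr -shom_par.
have <- : cimg F' Rm = par (LaxT pi Rm).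
  by apply: (@cimg_natural _ _ _ Rm _ _ _ _ (sparity EndVU)) => //; [right; exact: adm_FT|move=> x; exact: shom_par].
rewrite /cimg -cop_pull_comp; last by rewrite pull_comp.
exact: (ev (pull FT (regmod EndVU)) 1 (or_intror adm_FT)).
Qed.

Definition piDelta : shom U EndVU := scomp F Delta.
Definition piDeltaT : shom U EndVU := scomp FT Delta.

Lemma Lax_comm u : Lax pi Rm * piDelta u = piDeltaT u * Lax pi Rm.
Proof.
have [_ _ com _ _] := RmP.
have aF : adm (pull F (regmod EndVU)) by left; exact: adm_F.
rewrite -[LHS](cop_pull_regmod Rm _ aF) -[piDelta u]mulr1.
exact: (com u (pull F (regmod EndVU)) 1 aF).
Qed.

(** On the module pulled back along the graded twist, R Delta = Delta^T R has the two coproducts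
    exchanged, because the twist is an involution. *)
Lemma LaxT_comm u : LaxT pi Rm * piDeltaT u = piDelta u * LaxT pi Rm.
Proof.
have [_ _ com _ _] := RmP.
have aF : adm (pull FT (regmod EndVU)) by right; exact: adm_FT.
rewrite -[LHS](cop_pull_regmod Rm _ aF) -[piDeltaT u]mulr1.
rewrite [LHS](com u (pull FT (regmod EndVU)) 1 aF).
exact: (congr1 (fun z => F z * LaxT pi Rm) (ttwistK (Delta u))).
Qed.

Local Notation D2 := (smx (@gr m k) EndVU).

Lemma pi_pi_id_comm : supercommute (scomp (smx_inl (@gr m k) EndVU) pi)
  (scomp (smx_inr (@gr m k) EndVU) F).
Proof.
move=> p p' a b ha hb.
exact: (smx_comm (shom_homog pi ha) (shom_homog F hb)).
Qed.

(** This is (id (x) Delta) R = R_13 R_12 under pi (x) (pi (x) id), with the first factor read as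
    matrix indices: the entries of R_13 lie in 1 (x) U, those of R_12 in (End V) (x) 1. *)
Lemma Lax_piDelta : smx_map (@gr m k) piDelta (Lax pi Rm) =
  smx_map (@gr m k) jr (Lax pi Rm) * smx_map (@gr m k) (scomp jl pi) (Lax pi Rm).
Proof.
have [_ _ _ iD _] := RmP.
pose G : shom (stens U UU) D2 := tlift pi_pi_id_comm.
have Gl u : G (tinl u) = smx_inl (@gr m k) EndVU (pi u) by exact: tlift_inl.
have Gr u : G (tinr u) = smx_inr (@gr m k) EndVU (F u) by exact: tlift_inr.
have aF : adm (pull F (regmod EndVU)) by left; exact: adm_F.
(* Applied to [Delta], [tinl] and [tinr]. In all three cases the first leg still acts through pi,
   which gives admissibility. *)
have key (h : shom U UU) (h' : shom U EndVU) : (forall u, F (h u) = h' u) ->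
    adm (pull (scomp G (tmap (sid U) h)) (regmod D2)) /\
    cimg (scomp G (tmap (sid U) h)) Rm = smx_map (@gr m k) h' (Lax pi Rm).
  move=> hh.
  have tl u : scomp G (tmap (sid U) h) (tinl u) = smx_inl (@gr m k) EndVU (pi u).
    exact: (etrans (congr1 G (tlift_inl (tmap_comm (sid U) h) u)) (Gl u)).
  have tr u : scomp G (tmap (sid U) h) (tinr u) = smx_inr (@gr m k) EndVU (h' u).
    by rewrite -hh; exact: (etrans (congr1 G (tlift_inr (tmap_comm (sid U) h) u)) (Gr (h u))).
  have ad : adm (pull (scomp G (tmap (sid U) h)) (regmod D2)).
    by left; exact: (adm_l_pull m_gt2 k_gt0 piP tl).
  split=> //; apply: cimg_natural => //.
  apply: (stens_ext (g := scomp (smx_map (@gr m k) h') F)) => u.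
    by rewrite tl [RHS](congr1 (smx_map _ _) (pi_id_inl u)) smx_map_inl.
  by rewrite tr [RHS](congr1 (smx_map _ _) (pi_id_inr u)) smx_map_inr.
have [a1 e1] := key Delta piDelta (fun u => erefl).
have [a2 e2] := key tinl (scomp jl pi) pi_id_inl.
have [a3 e3] := key tinr jr pi_id_inr.
rewrite -e1 -e2 -e3 -(cop_pull_regmod Rm _ a3) /cimg.
have pc (h : shom UU (stens U UU)) : adm (pull (scomp G h) (regmod D2)) ->
    adm (pull h (pull G (regmod D2))) by rewrite pull_comp.
rewrite -(cop_pull_comp Rm (1 : regmod D2) (pc _ a1)).
rewrite -(cop_pull_comp Rm (1 : regmod D2) (pc _ a2)).
rewrite -(cop_pull_comp Rm (_ : regmod D2) (pc _ a3)).
exact: (iD (pull G (regmod D2)) (1 : D2) (pc _ a1) (pc _ a2) (pc _ a3)).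
Qed.

Lemma jl_diag (Z : EndVU) a b : (Z * jl (Emx R b b)) (a, b) = Z (a, b).
Proof.
rewrite smx_mulr_inl (bigD1 b) //= big1 ?addr0 => [|c cb].
  by rewrite EmxE eqxx addbb /= mulr1n cst1l.
by rewrite EmxE (negPf cb) cst0l.
Qed.

Lemma mul_jr_diag (Z : EndVU) u a b :
  (Z * (jr u * jl (Emx R b b))) (a, b) = Z (a, b) * u.
Proof. by rewrite mulrA jl_diag smx_mulr_inr. Qed.

Lemma minus_plus_F N s a b : minus_plus N s ->
  borel ue N (F s (a, b)) /\ (hgt a != hgt b - N%:Z -> F s (a, b) = 0).
Proof.
elim=> {s} [u u' hu hu'|s t _ [hs hs0] _ [ht ht0]|z s _ [hs hs0]].
- have -> : F (tens u u') (a, b) = cst (pi u (a, b) : C) * u'.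
    by rewrite pi_id_tens smx_mulr_inr smx_inlE.
  split; first exact: borel_Z.
  move=> ab; case: (eqVneq (pi u (a, b)) 0) => [->|]; first by rewrite cst0l.
  by move=> /(pi_borel_uf m_gt2 k_gt0 piP hu) e; rewrite e eqxx in ab.
- rewrite shomD smx_addE; split; first exact: borel_D.
  by move=> ab; rewrite hs0 // ht0 // addr0.
- rewrite shomM shom_cst smx_cstMl; split; first exact: borel_Z.
  by move=> ab; rewrite hs0 // mulr0.
Qed.

Lemma minus_plus_FT N s a b : minus_plus N s -> borel uf N (FT s (a, b)).
Proof.
elim=> {s} [u u' hu hu'|s t _ hs _ ht|z s _ hs].
- rewrite [FT _]pi_id_twist smx_mull_inr smx_inlE -cstC; apply: borel_Z.
  by apply: borel_parn => //; exact: homog_uf.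
- by rewrite shomD smx_addE; exact: borel_D.
- by rewrite shomM shom_cst smx_cstMl; exact: borel_Z.
Qed.

(** The double form is applied to [jl (Emx R b b)], a weight vector of weight eps_b whose right
    multiplication isolates column b; hence the length of the sum depends on b. The bound [N.+1]
    guarantees that the term [Th 0] is present. *)
Lemma Lax_exp : exists Th : nat -> EndVU, [/\ Th 0 = 1,
  forall j a b, borel ue j (Th j (a, b)),
  forall j a b, hgt a != hgt b - j%:Z -> Th j (a, b) = 0 &
  forall b, exists N, forall a,
    Lax pi Rm (a, b) = \sum_(j < N.+1) Th j (a, b) * uq (eps b)].
Proof.
have [Th [Th0 ThN Xl _]] := RmD.
exists (fun j => F (Th j)); split=> [|j a b|j a b|b].
- by rewrite Th0 shom1.
- by have [] := minus_plus_F a b (ThN j).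
- by have [] := minus_plus_F a b (ThN j).
have wv := wvec_pull piP pi_id_inl b b (1 : EndVU).
have [N0 /(_ N0.+1 (leqnSn _))] := Xl _ _ _ adm_F wv.
rewrite (cop_pull_regmod Rm _ (or_introl adm_F)) mulr1 => E; exists N0 => a.
move/ffunP: E => /(_ (a, b)); rewrite jl_diag => ->.
rewrite sum_ffunE; apply: eq_bigr => j _.
exact: (etrans (congr1 (fun z => (F (Th j) * (z * jl (Emx R b b))) (a, b))
  (pi_id_inr (uq (eps b)))) (mul_jr_diag _ _ _ _)).
Qed.

(** Here pi absorbs the raising leg, so the entries are built from lowering generators and the half
    of [double_form] for [adm_r] applies. *)
Lemma LaxT_exp : exists Th : nat -> EndVU, [/\ Th 0 = 1,
  forall j a b, borel uf j (Th j (a, b)) &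
  forall b, exists N, forall a,
    LaxT pi Rm (a, b) = \sum_(j < N.+1) Th j (a, b) * uq (eps b)].
Proof.
have [Th [Th0 ThN _ Xr]] := RmD.
exists (fun j => FT (Th j)); split=> [|j a b|b].
- by rewrite Th0 shom1.
- exact: minus_plus_FT.
have wv := wvec_pull piP FT_inr b b (1 : EndVU).
have [N0 /(_ N0.+1 (leqnSn _))] := Xr _ _ _ adm_FT wv.
rewrite (cop_pull_regmod Rm _ (or_intror adm_FT)) mulr1 => E; exists N0 => a.
move/ffunP: E => /(_ (a, b)); rewrite jl_diag => ->.
rewrite sum_ffunE; apply: eq_bigr => j _.
exact: (etrans (congr1 (fun z => (FT (Th j) * (z * jl (Emx R b b))) (a, b))
  (FT_inl (uq (eps b)))) (mul_jr_diag _ _ _ _)).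
Qed.

End LaxOperator.

Section Cexp.
Variables (R : realType) (hq : R[i]).
Local Notation C := R[i].
Local Notation qpow := (qpow hq).

Lemma cexpD (z w : C) : cexp (z + w) = cexp z * cexp w.
Proof.
case: z w => [a b] [c d]; rewrite /cexp /= expRD cosD sinD.
by apply/eqP; rewrite eq_complex /=; apply/andP; split; apply/eqP; ring.
Qed.

Lemma cexp0 : cexp 0 = 1 :> C.
Proof. by rewrite /cexp /= expR0 cos0 sin0 mulr1 mulr0. Qed.

Lemma qpowD (x y : C) : qpow (x + y) = qpow x * qpow y.
Proof. by rewrite /Defs.qpow mulrDr cexpD. Qed.

Lemma qpow0 : qpow 0 = 1.
Proof. by rewrite /Defs.qpow mulr0 cexp0. Qed.

Lemma qpowNK x : qpow x * qpow (- x) = 1.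
Proof. by rewrite -qpowD subrr qpow0. Qed.

Lemma qpow_neq0 x : qpow x != 0.
Proof.
by apply/eqP => e; have /eqP := qpowNK x; rewrite e mul0r eq_sym oner_eq0.
Qed.

Lemma qpowN x : qpow (- x) = (qpow x)^-1.
Proof. by apply: (mulfI (qpow_neq0 x)); rewrite qpowNK divff // qpow_neq0. Qed.

Lemma qpowB x y : qpow (x - y) = qpow x / qpow y.
Proof. by rewrite qpowD qpowN. Qed.

Lemma qpowMn x j : qpow (x *+ j) = qpow x ^+ j.
Proof. by elim: j => [|j IH]; rewrite ?mulr0n ?qpow0 // mulrS exprS qpowD IH. Qed.
End Cexp.

Lemma cst_regular (K : fieldType) (z : K) : (cst z : K^o) = z.
Proof. by []. Qed.

(** * Matrix entries of the Lax operator and of the vector R-matrix *)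

Section LaxEntries.
Variables (R : realType) (m k : nat) (hq : R[i]).
Local Notation C := R[i].
Local Notation wt := (weight R m k).
Local Notation idx := (idx m k).
Local Notation U := (Uosp m k hq).
Local Notation UU := (stens U U).
Local Notation EndV := (smx (@gr m k) C^o).
Local Notation EndVU := (smx (@gr m k) U).
Local Notation alpha := (@alpha R m k).
Local Notation eps := (@eps R m k).
Local Notation qpow := (qpow hq).
Local Notation uh := (@uh R m k hq).
Local Notation uq := (@uq R m k hq).
Local Notation ue := (@ue R m k hq).
Local Notation uf := (@uf R m k hq).
Local Notation jl := (smx_inl (@gr m k) U).
Local Notation jr := (smx_inr (@gr m k) U).
Hypotheses (m_gt2 : (2 < m)%N) (k_gt0 : (0 < k)%N).
Variable Delta : shom U UU.
Hypothesis DeltaP : is_coproduct Delta.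
Variable pi : shom U EndV.
Hypothesis piP : is_vector_rep pi.
Implicit Types (a b c d e : idx) (s x y : wt) (u : U) (Z : EndVU).
Local Notation dl := (piDelta Delta pi).
Local Notation dlT := (piDeltaT Delta pi).

(** In an even element of End V (x) U the coefficient of E^a_b has the degree [a] + [b]. *)
Lemma even_entry Z a b p : par Z = Z ->
  parn p (Z (a, b)) = cst ((-1) ^+ (p && (gr a (+) gr b))) * Z (a, b).
Proof.
move=> ev; case: p; last by rewrite expr0 cst1l.
rewrite -[in RHS]ev smx_parE andTb.
by rewrite cst_signK.
Qed.

Lemma mul_q_r Z s u a b : (Z * (jl (pi (uq s)) * jr u)) (a, b) =
  cst (qpow (bil s (eps b))) * (Z (a, b) * u).
Proof.
rewrite [Z * _]mulrA smx_mulr_inr smx_mulr_inl (bigD1 b) //= big1 => [|c cb].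
  by rewrite (pi_uqE piP) eqxx addbb addr0 /= -mulrA.
by rewrite (pi_uqE piP) (negPf cb) cst0l.
Qed.

Lemma mul_x_r Z u u' a b : (Z * (jl (pi u) * jr u')) (a, b) =
  \sum_c cst (pi u (c, b) : C) * (parn (gr c (+) gr b) (Z (a, c)) * u').
Proof.
rewrite [Z * _]mulrA smx_mulr_inr smx_mulr_inl mulr_suml; apply: eq_bigr => c _.
by rewrite mulrA.
Qed.

Lemma mul_q_l Z s u a b : (jl (pi (uq s)) * jr u * Z) (a, b) =
  cst (qpow (bil s (eps a))) * (parn (gr a (+) gr b) u * Z (a, b)).
Proof.
rewrite -[_ * Z]mulrA smx_mull_inl (bigD1 a) //= big1 => [|c ca].
  by rewrite (pi_uqE piP) eqxx addr0 smx_mull_inr.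
by rewrite (pi_uqE piP) eq_sym (negPf ca) cst0l.
Qed.

Lemma mul_x_l Z u u' a b : (jl (pi u) * jr u' * Z) (a, b) =
  \sum_c cst (pi u (a, c) : C) * (parn (gr c (+) gr b) u' * Z (c, b)).
Proof. by rewrite -[_ * Z]mulrA smx_mull_inl; apply: eq_bigr => c _; rewrite smx_mull_inr. Qed.

Lemma mulT_x_l Z u u' a b : (jr u' * jl (pi u) * Z) (a, b) =
  \sum_c cst (pi u (a, c) : C) * (parn (gr a (+) gr b) u' * Z (c, b)).
Proof.
rewrite -[_ * Z]mulrA smx_mull_inr smx_mull_inl mulr_sumr; apply: eq_bigr => c _.
by rewrite mulr_cst.
Qed.

Lemma mulT_q_l Z s u a b : (jr u * jl (pi (uq s)) * Z) (a, b) =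
  cst (qpow (bil s (eps a))) * (parn (gr a (+) gr b) u * Z (a, b)).
Proof.
rewrite mulT_x_l (bigD1 a) //= big1 => [|c ca].
  by rewrite (pi_uqE piP) eqxx addr0.
by rewrite (pi_uqE piP) eq_sym (negPf ca) cst0l.
Qed.

Lemma parn_uq (g : bool) s : parn g (uq s) = uq s.
Proof. by case: g => //=; rewrite par_uq. Qed.

Lemma parn_uh (g : bool) s : parn g (uh s) = uh s.
Proof. by case: g => //=; rewrite par_uh. Qed.

Lemma piDelta_uh x : dl (uh x) = jl (pi (uh x)) + jr (uh x).
Proof.
have [_ _ E _] := DeltaP; rewrite [LHS](congr1 (pi_id pi) (E x)) shomD.
by rewrite !pi_id_tens !shom1 mulr1 mul1r.
Qed.

Lemma piDeltaT_uh x : dlT (uh x) = jl (pi (uh x)) + jr (uh x).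
Proof.
have [_ _ E _] := DeltaP.
rewrite [LHS](congr1 (fun t => pi_id pi (ttwist U U t)) (E x)) !shomD.
by rewrite !pi_id_twist !shom1 mulr1 mul1r addrC.
Qed.

(** Commuting with h (x) 1 + 1 (x) h gives the entry (a, b) the weight eps_b - eps_a. It serves both
    for [Lax] and for the invariants. *)
Lemma comm_uh Z x a b :
  Z * (jl (pi (uh x)) + jr (uh x)) = (jl (pi (uh x)) + jr (uh x)) * Z ->
  uh x * Z (a, b) = Z (a, b) * uh x + cst (bil x (eps b) - bil x (eps a)) * Z (a, b).
Proof.
move=> /ffunP/(_ (a, b)); rewrite mulrDl mulrDr !smx_addE.
rewrite smx_mull_inl smx_mulr_inl smx_mulr_inr smx_mull_inr parn_uh.
rewrite (bigD1 b) //= big1 ?addr0 => [|c cb]; last first.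
  by rewrite (pi_uhE piP) (negPf cb) cst0l.
rewrite [X in _ = X + _](bigD1 a) //= big1 ?addr0 => [|c ca]; last first.
  by rewrite (pi_uhE piP) eq_sym (negPf ca) cst0l.
rewrite !(pi_uhE piP) !eqxx addbb /= => E.
apply: (addrI (cst (bil x (eps a)) * Z (a, b))).
by rewrite -E [RHS]addrCA -cstDl (addrC (bil x (eps a))) subrK addrC.
Qed.

Lemma piDelta_uq x : dl (uq x) = jl (pi (uq x)) * jr (uq x).
Proof.
have [_ _ _ E] := DeltaP; rewrite [LHS](congr1 (pi_id pi) (E x)).
by rewrite !pi_id_tens.
Qed.

(** The common shape of Delta(e_c) and Delta(f_c), with s half the simple root in both cases, so
    that raising and lowering generators are treated at once. *)
Definition skew_prim (u : U) (s : wt) : Prop :=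
  Delta u = tens (uq s) u + tens u (uq (- s)).

Lemma skew_ue (c : sroot m k) : skew_prim (ue c) (2^-1 *: alpha c).
Proof. by have [E _ _ _] := DeltaP; exact: E. Qed.

Lemma skew_uf (c : sroot m k) : skew_prim (uf c) (2^-1 *: alpha c).
Proof. by have [_ E _ _] := DeltaP; exact: E. Qed.

Lemma piDelta_skew u s : skew_prim u s ->
  dl u = jl (pi (uq s)) * jr u + jl (pi u) * jr (uq (- s)).
Proof.
by move=> E; rewrite [LHS](congr1 (pi_id pi) E) shomD !pi_id_tens.
Qed.

Lemma piDeltaT_skew u s : skew_prim u s ->
  dlT u = jr (uq s) * jl (pi u) + jr u * jl (pi (uq (- s))).
Proof.
move=> E; rewrite [LHS](congr1 (fun t => pi_id pi (ttwist U U t)) E) !shomD.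
by rewrite !pi_id_twist.
Qed.

Variable Rm : completion (@adm R m k hq).
Hypotheses (RmP : universal_R Delta Rm) (RmD : double_form Rm).

Local Notation Lax := (Lax pi Rm).
Local Notation rV a b c d := (pi (Lax (a, b)) (c, d)).

(** The term of degree j shifts heights by j, so on the diagonal only the term 1 of degree 0
    survives. *)
Lemma Lax_diag a : Lax (a, a) = uq (eps a).
Proof.
have [Th [Th0 _ Th1 /(_ a) [N E]]] := Lax_exp m_gt2 k_gt0 piP RmD.
rewrite E big_ord_recl big1 ?addr0 => [|j _].
  by rewrite Th0 -(@cst1 _ EndVU) smx_cstE eqxx cst1 mul1r.
by rewrite lift0 Th1 ?mul0r //; apply/eqP; lia.
Qed.

Lemma Lax_tri a b : a != b -> hgt b <= hgt a -> Lax (a, b) = 0.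
Proof.
move=> ab hab.
have [Th [Th0 _ Th1 /(_ b) [N E]]] := Lax_exp m_gt2 k_gt0 piP RmD.
rewrite E big1 // => -[[|j] jN] _ /=.
  by rewrite Th0 -(@cst1 _ EndVU) smx_cstE (negPf ab) mul0r.
by rewrite Th1 ?mul0r //; apply/eqP; lia.
Qed.

Lemma Lax_uh a b x : uh x * Lax (a, b) = Lax (a, b) * uh x
  + cst (bil x (eps b) - bil x (eps a)) * Lax (a, b).
Proof.
apply: comm_uh; have := Lax_comm m_gt2 k_gt0 piP RmP (uh x).
by rewrite piDelta_uh piDeltaT_uh.
Qed.

Lemma rV_supp a b c d x : rV a b c d != 0 ->
  bil x (eps a) + bil x (eps c) = bil x (eps b) + bil x (eps d).
Proof.
by move=> /(pi_comm_wt piP (Lax_uh a b x)) => E; rewrite -(subrK (bil x (eps d)) (bil x (eps c))) E; ring.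
Qed.

Lemma rV_diag a c d : rV a a c d = if c == d then qpow (bil (eps a) (eps c)) else 0.
Proof. by rewrite Lax_diag (pi_uqE piP). Qed.

Lemma rV_tri a b c d : a != b -> hgt b <= hgt a -> rV a b c d = 0.
Proof. by move=> ab h; rewrite Lax_tri // shom0 ffunE. Qed.

(** The coefficient of E^a_b (x) E^c_d in R Delta(u) = Delta^T(u) R on V (x) V; the signs come from
    moving u past an entry of degree [a] + [e] or [a] + [b]. *)
Lemma rV_eq u s p a b c d : skew_prim u s -> homog p u ->
  qpow (bil s (eps b)) * (\sum_z rV a b c z * pi u (z, d)) +
  (\sum_e (-1) ^+ (p && (gr a (+) gr e)) * pi u (e, b) * rV a e c d)
     * qpow (- bil s (eps d)) =
  qpow (bil s (eps c)) * (\sum_e pi u (a, e) * rV e b c d) +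
  (-1) ^+ (p && (gr a (+) gr b)) * qpow (- bil s (eps a)) *
     (\sum_z pi u (c, z) * rV a b z d).
Proof.
move=> su hu; have /ffunP/(_ (a, b)) := Lax_comm m_gt2 k_gt0 piP RmP u.
rewrite (piDelta_skew su) (piDeltaT_skew su) mulrDl mulrDr !smx_addE.
rewrite mul_q_r mul_x_r mulT_x_l mulT_q_l parn_uq => /(congr1 pi)/ffunP/(_ (c, d)).
have ev := Lax_even m_gt2 k_gt0 piP RmP.
rewrite !shomD !smx_addE !shom_sum !sum_ffunE => E.
transitivity (pi (cst (qpow (bil s (eps b))) * (Lax (a, b) * u)) (c, d) +
  \sum_i pi (cst (pi u (i, b) : C) * (parn (gr i (+) gr b) (Lax (a, i)) * uq (- s))) (c, d)).
  congr (_ + _).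
    by rewrite shomM shom_cst smx_cstMl shomM smx_scalarMl.
  rewrite mulr_suml; apply: eq_bigr => e _.
  rewrite shomM shom_cst smx_cstMl shomM smx_scalarMl (bigD1 d) //= big1 => [|z zd].
    rewrite addr0 (pi_uqE piP) eqxx bilNl even_entry // shomM shom_cst smx_cstMl.
    case: (eqVneq (pi u (e, b)) 0) => [->|/(pi_homog hu) ->]; first by rewrite mulr0 !mul0r.
    by rewrite !cst_regular; ring.
  by rewrite (pi_uqE piP) (negPf zd) mulr0.
rewrite E; congr (_ + _).
  rewrite mulr_sumr; apply: eq_bigr => e _.
  rewrite shomM shom_cst smx_cstMl shomM smx_scalarMl (bigD1 c) //= big1 => [|z zd].
    by rewrite addr0 (pi_uqE piP) eqxx !cst_regular; ring.
  by rewrite (pi_uqE piP) eq_sym (negPf zd) mul0r.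
rewrite shomM shom_cst smx_cstMl shomM bilNl (parn_homog _ hu) shomM shom_cst.
rewrite -mulrA smx_cstMl smx_scalarMl andbC !cst_regular; ring.
Qed.
End LaxEntries.

(** * Highest weight vectors *)

Section ActionTheory.
Variables (K : fieldType) (A : superAlgType K) (W : lmodType K) (act : A -> W -> W).
Hypothesis actP : is_action act.
Implicit Types (x y : A) (v w : W).

Lemma act_Dr x v w : act x (v + w) = act x v + act x w.
Proof. exact: is_actDr actP _ _ _. Qed.

Lemma act_Dl x y v : act (x + y) v = act x v + act y v.
Proof. exact: is_actDl actP _ _ _. Qed.

Lemma act_M x y v : act (x * y) v = act x (act y v).
Proof. exact: is_actM actP _ _ _. Qed.

Lemma act_cst z v : act (cst z) v = z *: v.
Proof. exact: is_act_cst actP _ _. Qed.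

Lemma act_Z z x v : act x (z *: v) = z *: act x v.
Proof. by rewrite -!act_cst -!act_M cstC. Qed.

Lemma act_cstM z x v : act (cst z * x) v = z *: act x v.
Proof. by rewrite act_M act_cst. Qed.

Lemma act0r x : act x 0 = 0.
Proof. by have := act_Z 0 x 0; rewrite !scale0r. Qed.

Lemma act0l v : act 0 v = 0.
Proof. by rewrite -(@cst0 _ A) act_cst scale0r. Qed.

Lemma act1 v : act 1 v = v.
Proof. by rewrite -(@cst1 _ A) act_cst scale1r. Qed.

Lemma act_N x v : act (- x) v = - act x v.
Proof. by rewrite -mulN1r -(@cst1 _ A) -cstN act_cstM scaleN1r. Qed.

Lemma act_Nr x v : act x (- v) = - act x v.
Proof. by rewrite -scaleN1r act_Z scaleN1r. Qed.

Lemma act_Br x v w : act x (v - w) = act x v - act x w.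
Proof. by rewrite act_Dr act_Nr. Qed.

Lemma act_suml (I : finType) (F : I -> A) v : act (\sum_i F i) v = \sum_i act (F i) v.
Proof. exact: (big_morph (act^~ v) (fun x y => act_Dl x y v) (act0l v)). Qed.
End ActionTheory.

Section HighestWeight.
Variables (R : realType) (m k : nat) (hq : R[i]).
Local Notation C := R[i].
Local Notation wt := (weight R m k).
Local Notation U := (Uosp m k hq).
Local Notation alpha := (@alpha R m k).
Local Notation qpow := (qpow hq).
Local Notation uh := (@uh R m k hq).
Local Notation uq := (@uq R m k hq).
Local Notation ue := (@ue R m k hq).
Local Notation uf := (@uf R m k hq).
Local Notation wht := (wht R m k).
Local Notation sroot := (sroot m k).
Hypotheses (m_gt2 : (2 < m)%N) (k_gt0 : (0 < k)%N).
Variables (W : lmodType C) (act : U -> W -> W) (L : wt) (v : W).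
Hypotheses (actP : is_action act) (v_neq0 : v <> 0).
Hypotheses (v_gen : forall w, exists x, w = act x v) (v_e : forall c, act (ue c) v = 0).
Hypotheses (v_h : forall y, act (uh y) v = bil y L *: v).
Hypotheses (v_q : forall y, act (uq y) v = qpow (bil y L) *: v).
Implicit Types (y : wt) (c d : sroot) (w : W).

Let fword (cs : seq sroot) : W := foldr (fun c w => act (uf c) w) v cs.

(** The span of the lowering words applied to v. That it is stable under all generators, hence all
    of W ([fspanT]), takes the place of a triangular decomposition of U. *)
Inductive fspan : W -> Prop :=
| fspan0 : fspan 0
| fspanD w w' : fspan w -> fspan w' -> fspan (w + w')
| fspanZ z w : fspan w -> fspan (z *: w)
| fspan_word cs : fspan (fword cs).

Lemma fspan_act x : (forall cs, fspan (act x (fword cs))) ->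
  forall w, fspan w -> fspan (act x w).
Proof.
move=> H w; elim=> {w} [|w w' _ Hw _ Hw'|z w _ Hw|cs].
- by rewrite (act0r actP); exact: fspan0.
- by rewrite (act_Dr actP); exact: fspanD.
- by rewrite (act_Z actP); exact: fspanZ.
- exact: H.
Qed.

Lemma act_h_f y c w z : act (uh y) w = z *: w ->
  act (uh y) (act (uf c) w) = (z - bil y (alpha c)) *: act (uf c) w.
Proof.
move=> E; rewrite -(act_M actP) uhf (act_Dl actP) (act_M actP (uf c)) E (act_Z actP).
by rewrite (act_cstM actP) -scalerDl.
Qed.

Lemma act_q_f y c w z : act (uq y) w = z *: w ->
  act (uq y) (act (uf c) w) = (qpow (- bil y (alpha c)) * z) *: act (uf c) w.
Proof.
move=> E; rewrite -(act_M actP) uqf (act_cstM actP) (act_M actP) E (act_Z actP).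
by rewrite scalerA.
Qed.

Lemma fword_h y cs : exists z, act (uh y) (fword cs) = z *: fword cs.
Proof.
elim: cs => [|c cs [z /act_h_f E]]; first by exists (bil y L); exact: v_h.
by eexists; exact: E.
Qed.

Lemma fword_q y cs : exists z, act (uq y) (fword cs) = z *: fword cs.
Proof.
elim: cs => [|c cs [z /act_q_f E]]; first by exists (qpow (bil y L)); exact: v_q.
by eexists; exact: E.
Qed.

Lemma fword_wht cs :
  act (uh wht) (fword cs) = (bil wht L - (size cs)%:R) *: fword cs.
Proof.
elim: cs => [|c cs IH]; first by rewrite /= subr0 v_h.
by rewrite /= (act_h_f c IH) bil_wht_alpha // -addrA -opprD natr1.
Qed.

Lemma fspan_e c w : fspan w -> fspan (act (ue c) w).
Proof.
apply: fspan_act => cs; elim: cs => [|d cs IH] /=.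
  by rewrite v_e; exact: fspan0.
rewrite -(act_M actP) uef (act_Dl actP); apply: fspanD.
  rewrite (act_cstM actP) (act_M actP); apply/fspanZ.
  by apply: fspan_act IH => ds; exact: (fspan_word (d :: ds)).
case: asboolP => _; last by rewrite (act0l actP); exact: fspan0.
rewrite (act_cstM actP) (act_Dl actP) (act_N actP); apply: fspanZ.
have [z ->] := fword_q (alpha c) cs; have [z' ->] := fword_q (- alpha c) cs.
by rewrite -scalerBl; apply/fspanZ/fspan_word.
Qed.

Lemma fspanT w : fspan w.
Proof.
have [x ->] := v_gen w; have : fspan v by exact: (fspan_word [::]).
elim/uosp_ind: x v => {w} [c|c|y|y|z|x y Hx Hy|x y Hx Hy] w Hw.
- exact: fspan_e.
- by apply: fspan_act Hw => cs; exact: (fspan_word (c :: cs)).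
- apply: fspan_act Hw => cs; have [z ->] := fword_h y cs.
  exact/fspanZ/fspan_word.
- apply: fspan_act Hw => cs; have [z ->] := fword_q y cs.
  exact/fspanZ/fspan_word.
- by rewrite (act_cst actP); exact: fspanZ.
- by rewrite (act_Dl actP); apply: fspanD; [exact: Hx|exact: Hy].
- by rewrite (act_M actP); apply: Hx; exact: Hy.
Qed.

(* hop = h - h(v) has eigenvalue -j on words of length j, so the span of the
   nonempty words is the union of the kernels of (hop + 1) ... (hop + j). *)
Definition hop w : W := act (uh wht) w - bil wht L *: w.

Lemma hopE w : hop w = act (uh wht) w - bil wht L *: w.
Proof. by []. Qed.

Fixpoint hopn (j : nat) w : W :=
  if j is i.+1 then hop (hopn i w) + j%:R *: hopn i w else w.

Definition below w : Prop := exists j, hopn j w = 0.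

Lemma hopD w w' : hop (w + w') = hop w + hop w'.
Proof. by rewrite !hopE (act_Dr actP) scalerDr opprD addrACA. Qed.

Lemma hopZ z w : hop (z *: w) = z *: hop w.
Proof. by rewrite !hopE (act_Z actP) scalerBr !scalerA mulrC. Qed.

Lemma hop0 : hop 0 = 0.
Proof. by have := hopZ 0 0; rewrite !scale0r. Qed.

Lemma hopnD j w w' : hopn j (w + w') = hopn j w + hopn j w'.
Proof. by elim: j => //= j ->; rewrite hopD scalerDr addrACA. Qed.

Lemma hopnZ j z w : hopn j (z *: w) = z *: hopn j w.
Proof.
elim: j => //= j ->; rewrite hopZ [RHS]scalerDr !scalerA.
by congr (_ + _ *: _); exact: mulrC.
Qed.

Lemma hop_eig z w : act (uh wht) w = (bil wht L + z) *: w -> hop w = z *: w.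
Proof. by rewrite !hopE => ->; rewrite -scalerBl addrC addKr. Qed.

Lemma hopn_eig j z w : hop w = z *: w ->
  hopn j w = (\prod_(i < j) (z + i.+1%:R)) *: w.
Proof.
move=> E; elim: j => [|j IH] /=; first by rewrite big_ord0 scale1r.
by rewrite IH hopZ E big_ord_recr /= !scalerA -scalerDl; congr (_ *: _); ring.
Qed.

Lemma hopn_comm (f : W -> W) j w : (forall z u, f (z *: u) = z *: f u) ->
  (forall u u', f (u + u') = f u + f u') -> (forall u, hop (f u) = f (hop u)) ->
  hopn j (f w) = f (hopn j w).
Proof. by move=> fZ fD fh; elim: j => //= j ->; rewrite fh -fZ -fD. Qed.

Lemma hop_hopn j w : hop (hopn j w) = hopn j (hop w).
Proof. by rewrite hopn_comm // => *; [exact: hopZ|exact: hopD]. Qed.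

Lemma hopn_le i j w : (i <= j)%N -> hopn i w = 0 -> hopn j w = 0.
Proof.
move=> /subnK <- E; elim: (j - i)%N => //= d ->.
by rewrite hop0 scaler0 addr0.
Qed.

Lemma below0 : below 0. Proof. by exists 0. Qed.

Lemma belowD w w' : below w -> below w' -> below (w + w').
Proof.
move=> [i Ei] [j Ej]; exists (maxn i j); rewrite hopnD.
by rewrite (hopn_le (leq_maxl i j) Ei) (hopn_le (leq_maxr i j) Ej) addr0.
Qed.

Lemma belowZ z w : below w -> below (z *: w).
Proof. by move=> [j E]; exists j; rewrite hopnZ E scaler0. Qed.

Lemma hop_f c w : hop (act (uf c) w) = act (uf c) (hop w) - act (uf c) w.
Proof.
have E : act (uh wht) (act (uf c) w) = act (uf c) (act (uh wht) w) - act (uf c) w.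
  by rewrite -!(act_M actP) uhf bil_wht_alpha // (act_Dl actP) (act_cstM actP) scaleN1r.
by rewrite !hopE E (act_Dr actP) -!scaleNr (act_Z actP) addrAC.
Qed.

(** Moving f_c to the left turns each factor [hop + i] into [hop + (i - 1)]; the first factor
    becomes [hop] itself, which kills v. *)
Lemma hopn_f j c w : hopn j.+1 (act (uf c) w) = act (uf c) (hopn j (hop w)).
Proof.
elim: j => [|j IH]; first by rewrite /= hop_f scale1r subrK.
have -> : hopn j.+2 (act (uf c) w) =
  hop (hopn j.+1 (act (uf c) w)) + j.+2%:R *: hopn j.+1 (act (uf c) w) by [].
rewrite IH hop_f [hopn j.+1 (hop w)]/= [RHS](act_Dr actP) (act_Z actP) -addrA.
by congr (_ + _); rewrite -[in LHS]natr1 scalerDl scale1r addrC addrK.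
Qed.

Lemma hop_v : hop v = 0.
Proof. by rewrite (hop_eig (z := 0)) ?scale0r // addr0 v_h. Qed.

(** On v the operator [hopn j] is multiplication by j!, which is nonzero in characteristic 0. *)
Lemma below_hw z : below (z *: v) -> z = 0.
Proof.
move=> [j]; rewrite hopnZ (hopn_eig j (z := 0)); last first.
  by apply: hop_eig; rewrite addr0 v_h.
rewrite scalerA => /eqP; rewrite scaler_eq0 => /orP[|/eqP //].
rewrite mulf_eq0 => /orP[/eqP //|/prodf_eq0[i _]].
by rewrite add0r pnatr_eq0.
Qed.

Lemma hw_decomp w : exists z, below (w - z *: v).
Proof.
elim: (fspanT w) => {w} [|w w' _ [z Hz] _ [z' Hz']|x w _ [z Hz]|[|c cs]].
- by exists 0; rewrite scale0r subr0; exact: below0.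
- by exists (z + z'); rewrite scalerDl opprD addrACA; exact: belowD.
- by exists (x * z); rewrite -scalerA -scalerBr; exact: belowZ.
- by exists 1; rewrite scale1r subrr; exact: below0.
- exists 0; rewrite scale0r subr0; exists (size cs).+1.
  rewrite (hopn_eig _ (hop_eig (fword_wht (c :: cs)))) big_ord_recr /=.
  by rewrite addNr mulr0 scale0r.
Qed.

(** The covector dual to v: the projection to the line of v along the span of the nonempty lowering
    words. By [vst_uniq] it does not depend on the choice made here. *)
Definition vst w : C := projT1 (cid (hw_decomp w)).

Lemma vstP w : below (w - vst w *: v).
Proof. exact: (projT2 (cid (hw_decomp w))). Qed.

Lemma vst_uniq w z : below (w - z *: v) -> vst w = z.
Proof.
move=> Hz; apply/eqP; rewrite -subr_eq0; apply/eqP/below_hw.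
have := belowD Hz (belowZ (-1) (vstP w)).
by rewrite scaleN1r opprB addrC addrA subrK scalerBl.
Qed.

Lemma vst_v : vst v = 1.
Proof. by apply: vst_uniq; rewrite scale1r subrr; exact: below0. Qed.

Lemma vstD w w' : vst (w + w') = vst w + vst w'.
Proof.
apply: vst_uniq; rewrite scalerDl opprD addrACA.
by apply: belowD; exact: vstP.
Qed.

Lemma vstZ z w : vst (z *: w) = z * vst w.
Proof. by apply: vst_uniq; rewrite -scalerA -scalerBr; exact/belowZ/vstP. Qed.

Lemma vst0 : vst 0 = 0.
Proof. by have := vstZ 0 0; rewrite scale0r mul0r. Qed.

Lemma vst_sum (I : finType) (F : I -> W) : vst (\sum_i F i) = \sum_i vst (F i).
Proof. by apply: (big_morph vst); [exact: vstD|exact: vst0]. Qed.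

(** The component of w along v is removed by [hop], which by [hopn_f] acts before f_c; what remains
    is killed by [hopn j] for some j. *)
Lemma below_f c w : below (act (uf c) w).
Proof.
have [j E] := vstP w; exists j.+1; rewrite hopn_f.
have -> : hop w = hop (w - vst w *: v).
  by rewrite hopD -scaleNr hopZ hop_v scaler0 addr0.
by rewrite -hop_hopn E hop0 (act0r actP).
Qed.

Lemma vst_f c w : vst (act (uf c) w) = 0.
Proof. by apply: vst_uniq; rewrite scale0r subr0; exact: below_f. Qed.

(** An element that commutes with [uh wht] commutes with [hop] and thus preserves [below]. *)
Lemma vst_comm x z w : act x v = z *: v -> uh wht * x = x * uh wht ->
  vst (act x w) = z * vst w.
Proof.
move=> xv xh; apply: vst_uniq.
have -> : act x w - (z * vst w) *: v = act x (w - vst w *: v).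
  by rewrite (act_Br actP) (act_Z actP) xv scalerA mulrC.
have [j E] := vstP w; exists j; rewrite hopn_comm ?E ?(act0r actP) //.
- by move=> *; exact: act_Z.
- by move=> *; exact: act_Dr.
- by move=> u; rewrite !hopE -(act_M actP) xh (act_M actP) (act_Br actP) (act_Z actP).
Qed.

Lemma vst_h y w : vst (act (uh y) w) = bil y L * vst w.
Proof. by apply: vst_comm; [exact: v_h|exact: uhh]. Qed.

Lemma vst_q y w : vst (act (uq y) w) = qpow (bil y L) * vst w.
Proof. by apply: vst_comm; [exact: v_q|exact: uhq]. Qed.

(* x v - vst (x v) v has the weight of v and lies in [below], hence vanishes. *)
Lemma central_scalar x : (forall u : U, x * u = u * x) ->
  forall w, act x w = vst (act x v) *: w.
Proof.
move=> xC w; have [y ->] := v_gen w.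
suff E : act x v = vst (act x v) *: v.
  by rewrite -(act_M actP) xC (act_M actP) {1}E (act_Z actP).
apply/eqP; rewrite -subr_eq0; apply/eqP; set z := vst _.
have [j] := vstP (act x v); rewrite -/z; set w0 := (_ - _).
have h0 : hop w0 = 0 *: w0.
  apply: hop_eig; rewrite addr0 /w0 (act_Br actP) (act_Z actP) v_h.
  rewrite -(act_M actP) -xC (act_M actP) v_h (act_Z actP) scalerBr !scalerA.
  by rewrite mulrC.
rewrite (hopn_eig j h0) => /eqP; rewrite scaler_eq0 => /orP[/prodf_eq0[i _]|/eqP //].
by rewrite add0r pnatr_eq0.
Qed.

Lemma borel_ue_v i x : borel ue i x -> exists z : C,
  act x v = z *: v /\ ((0 < i)%N -> z = 0).
Proof.
elim=> {i x} [|y|y|c|i j x x2 _ [z [Ez Hz]] _ [z' [Ez' Hz']]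
  |i x x2 _ [z [Ez Hz]] _ [z' [Ez' Hz']]|i t x _ [z [Ez Hz]]].
- by exists 1; rewrite (act1 actP) scale1r.
- by exists (bil y L); rewrite v_h.
- by exists (qpow (bil y L)); rewrite v_q.
- by exists 0; rewrite v_e scale0r.
- exists (z * z'); rewrite (act_M actP) Ez' (act_Z actP) Ez scalerA mulrC.
  split=> //; rewrite addn_gt0 => /orP[/Hz|/Hz'] ->; rewrite ?mul0r ?mulr0 //.
- exists (z + z'); rewrite (act_Dl actP) Ez Ez' -scalerDl; split=> // i0.
  by rewrite Hz // Hz' // addr0.
- exists (t * z); rewrite (act_cstM actP) Ez scalerA; split=> // i0.
  by rewrite Hz // mulr0.
Qed.

(** Dual to [borel_ue_v]: the covector [vst] is annihilated by the lowering generators and is an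
    eigenvector of the Cartan elements. *)
Lemma borel_uf_vst i x : borel uf i x -> exists z : C,
  (forall w, vst (act x w) = z * vst w) /\ ((0 < i)%N -> z = 0).
Proof.
elim=> {i x} [|y|y|c|i j x x2 _ [z [Ez Hz]] _ [z' [Ez' Hz']]
  |i x x2 _ [z [Ez Hz]] _ [z' [Ez' Hz']]|i t x _ [z [Ez Hz]]].
- by exists 1; split=> // w; rewrite (act1 actP) mul1r.
- by exists (bil y L); split=> // w; rewrite vst_h.
- by exists (qpow (bil y L)); split=> // w; rewrite vst_q.
- by exists 0; split=> // w; rewrite vst_f mul0r.
- exists (z * z'); split=> [w|]; first by rewrite (act_M actP) Ez Ez' mulrA.
  by rewrite addn_gt0 => /orP[/Hz|/Hz'] ->; rewrite ?mul0r ?mulr0.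
- exists (z + z'); split=> [w|i0]; first by rewrite (act_Dl actP) vstD Ez Ez' mulrDl.
  by rewrite Hz // Hz' // addr0.
- exists (t * z); split=> [w|i0]; first by rewrite (act_cstM actP) vstZ Ez mulrA.
  by rewrite Hz // mulr0.
Qed.
End HighestWeight.

(** * Invariants and central elements *)

Section RhoAlpha.
Variables (R : realType) (m k : nat).
Local Notation C := R[i].
Local Notation l := (m./2).
Local Notation alpha := (@alpha R m k).
Hypotheses (m_gt2 : (2 < m)%N) (k_gt0 : (0 < k)%N).

Lemma half_double (x : weight R m k) : (2^-1 *: x) *+ 2 = x.
Proof. by rewrite -scaler_nat scalerA divff ?pnatr_eq0 // scale1r. Qed.

Lemma rho2E : rho R m k *+ 2 = wtof m k (fun i => m%:R - 2 * i.+1%:R)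
  (fun u => - ((2 * k)%:R - m%:R + 2 - 2 * u.+1%:R)).
Proof.
have two : (2 : C) != 0 by rewrite pnatr_eq0.
by congr pair; apply/rowP => i; rewrite !mxE; field.
Qed.

Lemma bil_rho2_alpha c : bil (rho R m k *+ 2) (alpha c) = bil (alpha c) (alpha c).
Proof.
have mE := odd_double_half m.
case: c => [i|u|] /=; rewrite rho2E.
- have il := ltn_ord i; case: ifP => i1.
    rewrite bilDr bilNr !bil_wtof_epsn i1 il.
    rewrite !bilDl !bilDr !bilNl !bilNr !bil_epsn i1 il !eqxx (gtn_eqF (ltnSn i)) (ltn_eqF (ltnSn i)).
    by rewrite -[i.+2%:R]natr1 /=; ring.
  case: ifP => mo.
    rewrite bil_wtof_epsn bil_epsn il eqxx.
    have -> : m%:R = (2 * i.+1 + 1)%:R :> C by congr (_%:R); lia.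
    by rewrite natrD natrM /=; ring.
  rewrite bilDr !bil_wtof_epsn !bilDl !bilDr !bil_epsn il !eqxx.
  have i0 : (i.-1.+1 = i)%N by lia.
  have -> : (i.-1 < l)%N by lia.
  have -> : (i == i.-1 :> nat) = false by apply/eqP; lia.
  have -> : (i.-1 == i :> nat) = false by apply/eqP; lia.
  have -> : i.-1.+1%:R = i.+1%:R - 1 :> C by rewrite i0 -natr1 addrK.
  have -> : m%:R = (2 * i.+1)%:R :> C by congr (_%:R); lia.
  by rewrite natrM /=; ring.
- have ul := ltn_ord u.
  have u1 : (u < k)%N by lia.
  have u2 : (u.+1 < k)%N by lia.
  rewrite bilDr bilNr !bil_wtof_deltan u1 u2.
  rewrite !bilDl !bilDr !bilNl !bilNr !bil_deltan u1 u2 !eqxx (gtn_eqF (ltnSn u)) (ltn_eqF (ltnSn u)).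
  by rewrite -[u.+2%:R]natr1 /=; ring.
- rewrite bilDr bilNr bil_wtof_deltan bil_wtof_epsn !bilDl !bilDr !bilNl !bilNr.
  rewrite bil_deltan bil_epsn bil_epsn_deltan bil_deltan_epsn.
  have -> : (k.-1 < k)%N by lia.
  have -> : (0 < l)%N by lia.
  by rewrite prednK // !eqxx natrM /=; ring.
Qed.
End RhoAlpha.

Section Invariants.
Variables (R : realType) (m k : nat) (hq : R[i]).
Local Notation C := R[i].
Local Notation wt := (weight R m k).
Local Notation idx := (idx m k).
Local Notation U := (Uosp m k hq).
Local Notation UU := (stens U U).
Local Notation EndV := (smx (@gr m k) C^o).
Local Notation EndVU := (smx (@gr m k) U).
Local Notation alpha := (@alpha R m k).
Local Notation eps := (@eps R m k).
Local Notation qpow := (qpow hq).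
Local Notation uh := (@uh R m k hq).
Local Notation uq := (@uq R m k hq).
Hypotheses (m_gt2 : (2 < m)%N) (k_gt0 : (0 < k)%N).
Variable Delta : shom U UU.
Hypothesis DeltaP : is_coproduct Delta.
Variable pi : shom U EndV.
Hypothesis piP : is_vector_rep pi.
Implicit Types (a b c d e x y z : idx) (s : wt) (u : U) (B Z : EndVU).
Local Notation dl := (piDelta Delta pi).
Local Notation rho2 := (rho R m k *+ 2).

Definition invariant B : Prop := par B = B /\ forall u, B * dl u = dl u * B.

Lemma invariant1 : invariant 1.
Proof. by split=> [|u]; rewrite ?par1 // mulr1 mul1r. Qed.

Lemma invariantM B Z : invariant B -> invariant Z -> invariant (B * Z).
Proof.
move=> [eB cB] [eZ cZ]; split=> [|u]; first by rewrite parM eB eZ.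
by rewrite -mulrA cZ mulrA cB mulrA.
Qed.

Lemma invariantX B r : invariant B -> invariant (B ^+ r).
Proof.
move=> iB; elim: r => [|r IH]; first exact: invariant1.
by rewrite exprS; exact: invariantM.
Qed.

Lemma invariant_uq B s a b : invariant B ->
  uq s * B (a, b) = cst (qpow (bil s (eps b) - bil s (eps a))) * (B (a, b) * uq s).
Proof.
move=> [_ /(_ (uq s))]; rewrite (piDelta_uq DeltaP) => /ffunP/(_ (a, b)).
rewrite (mul_q_r piP) (mul_q_l piP) parn_uq => E.
apply/esym; rewrite qpowB mulrC -cstMr E cstMr mulVf ?cst1l //; exact: qpow_neq0.
Qed.

(* The twist by q^(2 h_rho) makes the supertrace invariant because
   (2 rho, alpha) = (alpha, alpha) for every simple root alpha. *)
Lemma strq_skew B u s p (beta : wt) : invariant B ->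
  skew_prim Delta u s -> homog p u ->
  (forall a b, pi u (a, b) != 0 ->
     forall y : wt, bil y (eps a) - bil y (eps b) = bil y beta) ->
  bil rho2 beta = bil (s *+ 2) beta ->
  (\sum_a cst ((-1) ^+ gr a * qpow (bil rho2 (eps a))) * B (a, a)) * u =
  u * (\sum_a cst ((-1) ^+ gr a * qpow (bil rho2 (eps a))) * B (a, a)).
Proof.
move=> iB su hu wu rb; rewrite mulr_suml mulr_sumr.
pose w a : C := (-1) ^+ gr a * qpow (bil rho2 (eps a)).
(* The commutator of the term of index a with u is sum_b X a b - sum_b Y a b. The choice of the
   weights makes X a b = Y b a, so everything cancels in the sum over a. *)
pose X a b := cst (w a * qpow (- bil s (eps a)) * pi u (a, b)) * (uq (- s) * B (b, a)).
pose Y a b := cst (w a * qpow (- bil s (eps a)) * pi u (b, a)) *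
  (parn (gr b (+) gr a) (B (a, b)) * uq (- s)).
have XY a b : X a b = Y b a.
  rewrite /X /Y; case: (eqVneq (pi u (a, b)) 0) => [->|n0]; first by rewrite !mulr0 !cst0l.
  rewrite (invariant_uq _ _ _ iB) (even_entry _ _ _ (proj1 iB)) (pi_homog hu n0).
  rewrite -[cst _ * B _ * _]mulrA !cstMr; congr (cst _ * _).
  have pab := pi_homog hu n0; have wab := wu a b n0.
  have -> : gr b (+) gr a = p by rewrite addbC.
  have -> : (-1) ^+ (p && p) = (-1) ^+ gr a * (-1) ^+ gr b :> C.
    by rewrite andbb -pab signr_addb.
  rewrite !bilNl /w.
  have E : qpow (bil rho2 (eps a)) * qpow (- bil s (eps a)) *
     qpow (- bil s (eps a) - - bil s (eps b)) =
     qpow (bil rho2 (eps b)) * qpow (- bil s (eps b)).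
    rewrite -!qpowD; congr (qpow _); have := rb; rewrite -!wab !(bilMnl s) => E.
    have -> : bil rho2 (eps a) = bil rho2 (eps b) + (bil s (eps a) *+ 2 - bil s (eps b) *+ 2).
      by rewrite -E addrC subrK.
    ring.
  transitivity ((-1) ^+ gr a * pi u (a, b) * (qpow (bil rho2 (eps a)) * qpow (- bil s (eps a)) *
     qpow (- bil s (eps a) - - bil s (eps b)))); first by ring.
  rewrite E; transitivity ((-1) ^+ gr a * ((-1) ^+ gr b * (-1) ^+ gr b) * pi u (a, b) *
    (qpow (bil rho2 (eps b)) * qpow (- bil s (eps b)))); last by ring.
  by rewrite -expr2 sqrr_sign; ring.
have key a : cst (w a) * B (a, a) * u - u * (cst (w a) * B (a, a)) =
    \sum_b X a b - \sum_b Y a b.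
  have /ffunP/(_ (a, a)) := proj2 iB u.
  rewrite (piDelta_skew pi su) mulrDr mulrDl !smx_addE.
  rewrite (mul_q_r piP) (mul_q_l piP) (mul_x_r pi) (mul_x_l pi) addbb /= => E.
  have {}E : cst (qpow (bil s (eps a))) * (B (a, a) * u - u * B (a, a)) =
     \sum_c cst (pi u (a, c) : C) * (parn (gr c (+) gr a) (uq (- s)) * B (c, a)) -
     \sum_c cst (pi u (c, a) : C) * (parn (gr c (+) gr a) (B (a, c)) * uq (- s)).
    by apply/eqP; rewrite mulrBr subr_eq addrAC eq_sym subr_eq E addrC.
  rewrite mulr_cst -mulrA -mulrBr.
  have -> : cst (w a) * (B (a, a) * u - u * B (a, a)) = cst (w a * qpow (- bil s (eps a))) *
      (cst (qpow (bil s (eps a))) * (B (a, a) * u - u * B (a, a))).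
    by rewrite cstMr -mulrA [qpow (- _) * _]mulrC qpowNK mulr1.
  rewrite E mulrBr !mulr_sumr; congr (_ - _); apply: eq_bigr => b _.
    by rewrite cstMr parn_uq.
  by rewrite cstMr.
apply/eqP; rewrite -subr_eq0 -sumrB; apply/eqP.
rewrite (eq_bigr _ (fun a _ => key a)) sumrB exchange_big /=.
apply/eqP; rewrite subr_eq0; apply/eqP/eq_bigr => a _; apply: eq_bigr => b _.
exact: XY.
Qed.

Lemma strq_uh B s : invariant B ->
  (\sum_a cst ((-1) ^+ gr a * qpow (bil rho2 (eps a))) * B (a, a)) * uh s =
  uh s * (\sum_a cst ((-1) ^+ gr a * qpow (bil rho2 (eps a))) * B (a, a)).
Proof.
move=> [_ /(_ (uh s))]; rewrite (piDelta_uh DeltaP) => E.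
rewrite mulr_suml mulr_sumr; apply: eq_bigr => a _.
by rewrite mulr_cst (comm_uh piP a a E) subrr cst0l addr0 mulrA.
Qed.

Lemma strq_central B : invariant B -> forall u,
  (\sum_a cst ((-1) ^+ gr a * qpow (bil rho2 (eps a))) * B (a, a)) * u =
  u * (\sum_a cst ((-1) ^+ gr a * qpow (bil rho2 (eps a))) * B (a, a)).
Proof.
move=> iB; elim/uosp_ind => [c|c|s|s|z|x y Hx Hy|x y Hx Hy].
- apply: (strq_skew iB (skew_ue DeltaP c) (homog_ue hq c) (beta := alpha c)).
    by move=> a b; exact: pi_ue_wt.
  by rewrite half_double bil_rho2_alpha.
- apply: (strq_skew iB (skew_uf DeltaP c) (homog_uf hq c) (beta := - alpha c)).
    by move=> a b n0 y; rewrite bilNr; exact: (pi_uf_wt piP n0).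
  by rewrite half_double !bilNr bil_rho2_alpha.
- exact: strq_uh.
- rewrite mulr_suml mulr_sumr; apply: eq_bigr => a _.
  by rewrite mulr_cst (invariant_uq _ _ _ iB) subrr qpow0 cst1l mulrA.
- by rewrite cstC.
- by rewrite mulrDr Hx Hy mulrDl.
- by rewrite [LHS]mulrA Hx -[LHS]mulrA Hy [LHS]mulrA.
Qed.
End Invariants.

(** * Diagonal matrix elements of powers of A *)

Section Recursion.
Variables (R : realType) (m k : nat) (hq : R[i]).
Local Notation C := R[i].
Local Notation wt := (weight R m k).
Local Notation idx := (idx m k).
Local Notation U := (Uosp m k hq).
Local Notation UU := (stens U U).
Local Notation EndV := (smx (@gr m k) C^o).
Local Notation EndVU := (smx (@gr m k) U).
Local Notation eps := (@eps R m k).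
Local Notation qpow := (qpow hq).
Local Notation uh := (@uh R m k hq).
Local Notation uq := (@uq R m k hq).
Local Notation ue := (@ue R m k hq).
Local Notation uf := (@uf R m k hq).
Local Notation jl := (smx_inl (@gr m k) U).
Local Notation jr := (smx_inr (@gr m k) U).
Hypotheses (m_gt2 : (2 < m)%N) (k_gt0 : (0 < k)%N).
Variable Delta : shom U UU.
Hypothesis DeltaP : is_coproduct Delta.
Variable pi : shom U EndV.
Hypothesis piP : is_vector_rep pi.
Variable Rm : completion (@adm R m k hq).
Hypotheses (RmP : universal_R Delta Rm) (RmD : double_form Rm).
Local Notation dl := (piDelta Delta pi).
Local Notation Lax := (Lax pi Rm).
Local Notation LaxT := (LaxT pi Rm).
Local Notation rV a b c d := (pi (Lax (a, b)) (c, d)).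
Local Notation invariant := (invariant Delta pi).
Implicit Types (a b c x y z : idx) (B Z : EndVU).

Lemma invariant_LaxTLax : invariant (LaxT * Lax).
Proof.
split=> [|u].
  by rewrite parM (LaxT_even m_gt2 k_gt0 piP RmP) (Lax_even m_gt2 k_gt0 piP RmP).
rewrite -mulrA (Lax_comm m_gt2 k_gt0 piP RmP) !mulrA.
by rewrite (LaxT_comm m_gt2 k_gt0 piP RmP).
Qed.

Lemma invariant_casimirA : invariant (casimirA pi Rm).
Proof.
have [e c] := invariant_LaxTLax; split=> [|u].
  by rewrite /casimirA parM par_cst parD e -(@cst1 _ EndVU) -cstN par_cst.
have E : (LaxT * Lax - 1) * dl u = dl u * (LaxT * Lax - 1).
  by rewrite mulrBl mulrBr c mul1r mulr1.
by rewrite /casimirA -[LHS]mulrA E [RHS]mulr_cst.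
Qed.

Lemma dl_Lax a b : dl (Lax (a, b)) =
  \sum_c cst ((-1) ^+ ((gr c (+) gr b) && (gr a (+) gr c))) *
     (jr (Lax (a, c)) * jl (pi (Lax (c, b)))).
Proof.
have /ffunP/(_ (a, b)) := Lax_piDelta m_gt2 k_gt0 piP RmP.
rewrite [in X in X = _ -> _]smx_mapE => ->; rewrite smxMl; apply: eq_bigr => c _.
rewrite !smx_mapE -shom_parn (even_entry _ _ _ (Lax_even m_gt2 k_gt0 piP RmP)).
by rewrite shomM shom_cst mulrA.
Qed.

Variables (W : lmodType C) (act : U -> W -> W) (L : wt) (v : W) (vst : W -> C).
Hypotheses (actP : is_action act)
  (vstD : forall w w', vst (w + w') = vst w + vst w')
  (vstZ : forall (z : C) w, vst (z *: w) = z * vst w)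
  (vst_v : vst v = 1)
  (v_q : forall y : wt, act (uq y) v = qpow (bil y L) *: v)
  (v_h : forall y : wt, act (uh y) v = bil y L *: v)
  (vst_q : forall (y : wt) w, vst (act (uq y) w) = qpow (bil y L) * vst w)
  (vst_h : forall (y : wt) w, vst (act (uh y) w) = bil y L * vst w)
  (ue_v : forall i u, borel ue i u ->
     exists z : C, act u v = z *: v /\ ((0 < i)%N -> z = 0))
  (vst_uf : forall i u, borel uf i u ->
     exists z : C, (forall w, vst (act u w) = z * vst w) /\ ((0 < i)%N -> z = 0)).

Let vst0 : vst 0 = 0.
Proof. by have := vstZ 0 0; rewrite scale0r mul0r. Qed.

Let vst_sum (I : finType) (F : I -> W) : vst (\sum_i F i) = \sum_i vst (F i).
Proof. exact: (big_morph vst vstD vst0). Qed.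

(** The terms of positive degree contain raising generators and kill v. *)
Lemma Lax_v a b :
  act (Lax (a, b)) v = (if a == b then qpow (bil (eps a) L) else 0) *: v.
Proof.
have [Th [Th0 Thb _ /(_ b) [N ->]]] := Lax_exp m_gt2 k_gt0 piP RmD.
rewrite (act_suml actP) big_ord_recl big1 ?addr0 => [|j _].
  rewrite (act_M actP) v_q (act_Z actP) Th0 -(@cst1 _ EndVU) smx_cstE.
  case: eqP => [->|_]; first by rewrite (act_cst actP) scale1r.
  by rewrite (act0l actP) scaler0 scale0r.
have [z [E Hz]] := ue_v (Thb (lift ord0 j) a b).
by rewrite (act_M actP) v_q (act_Z actP) E Hz ?scale0r ?scaler0.
Qed.

(** The terms of positive degree contain lowering generators and are killed by [vst]. *)
Lemma LaxT_vst a b w :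
  vst (act (LaxT (a, b)) w) = (if a == b then qpow (bil (eps a) L) else 0) * vst w.
Proof.
have [Th [Th0 Thb /(_ b) [N ->]]] := LaxT_exp m_gt2 k_gt0 piP RmD.
rewrite (act_suml actP) vst_sum big_ord_recl big1 ?addr0 => [|j _].
  rewrite (act_M actP) Th0 -(@cst1 _ EndVU) smx_cstE.
  case: eqP => [->|_]; first by rewrite (act_cst actP) scale1r vst_q.
  by rewrite (act0l actP) vst0 mul0r.
have [z [E Hz]] := vst_uf (Thb (lift ord0 j) a b).
by rewrite (act_M actP) E Hz ?mul0r.
Qed.

Definition hwe B a : C := vst (act (B (a, a)) v).

(** The entry has the weight eps_y - eps_x, which [wsep] detects as nonzero, while v and [vst] have
    the same weight. *)
Lemma invariant_offdiag B x y : invariant B -> x != y -> vst (act (B (x, y)) v) = 0.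
Proof.
move=> [_ /(_ (uh (wsep R m k)))]; rewrite (piDelta_uh DeltaP) => E xy.
have := congr1 (fun u => vst (act u v)) (comm_uh piP x y E).
rewrite (act_Dl actP) vstD !(act_M actP) vst_h v_h (act_Z actP) vstZ.
rewrite (act_cst actP) vstZ => /eqP.
rewrite -subr_eq0 opprD addrA subrr sub0r oppr_eq0 mulf_eq0 => /orP[|/eqP //].
by rewrite subr_eq0 => /eqP/wsep_inj e; rewrite e eqxx in xy.
Qed.

(* Matrix coefficients, between v and vst, of the fact that B commutes with
   (pi (x) id) Delta (Lax (a, b)). *)
Lemma exchange_rel B a b x y : invariant B ->
  \sum_c \sum_z (-1) ^+ ((gr c (+) gr b) && (gr a (+) gr c)) *
     ((-1) ^+ ((gr x (+) gr y) && (gr a (+) gr c)) *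
      (rV c b x z * vst (act (Lax (a, c) * B (z, y)) v))) =
  qpow (bil (eps a) L) * rV a b x y * hwe B x.
Proof.
move=> iB; have /ffunP/(_ (x, y)) := proj2 iB (Lax (a, b)).
rewrite dl_Lax mulr_suml mulr_sumr !sum_ffunE.
move=> /(congr1 (fun u => vst (act u v))); rewrite !(act_suml actP) !vst_sum => E.
transitivity (\sum_c vst (act ((cst ((-1) ^+ ((gr c (+) gr b) && (gr a (+) gr c))) *
    (jr (Lax (a, c)) * jl (pi (Lax (c, b)))) * B) (x, y)) v)).
  apply: eq_bigr => c _.
  rewrite -[_ * _ * B]mulrA smx_cstMl (mulT_x_l pi) (act_cstM actP) vstZ.
  rewrite (act_suml actP) vst_sum mulr_sumr; apply: eq_bigr => z _; congr (_ * _).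
  rewrite (act_cstM actP) vstZ (even_entry _ _ _ (Lax_even m_gt2 k_gt0 piP RmP)).
  by rewrite -mulrA (act_cstM actP) vstZ mulrCA.
(* On this side [Lax (a, c)] acts directly on v, which leaves c = a by [Lax_v]; then
   [invariant_offdiag] leaves z = x. *)
rewrite -E (bigD1 a) //= big1 => [|c ca].
  rewrite addbb andbF expr0 cst1 mul1r addr0 mulrA smx_mulr_inl.
  rewrite (act_suml actP) vst_sum (bigD1 x) //= big1 => [|z zx].
    rewrite addr0 smx_mulr_inr (act_cstM actP) vstZ parnM.
    rewrite (even_entry _ _ _ (proj1 iB)) addbb andbF expr0 cst1l.
    rewrite (even_entry _ _ _ (Lax_even m_gt2 k_gt0 piP RmP)) addbb andbF expr0 cst1l.
    by rewrite (act_M actP) Lax_v eqxx (act_Z actP) vstZ /hwe; ring.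
  rewrite smx_mulr_inr (act_cstM actP) vstZ parnM.
  rewrite (even_entry _ _ _ (proj1 iB)).
  rewrite (even_entry _ _ _ (Lax_even m_gt2 k_gt0 piP RmP)) addbb andbF expr0 cst1l.
  rewrite (act_M actP) Lax_v eqxx (act_Z actP) vstZ (act_cstM actP) vstZ.
  by rewrite (invariant_offdiag iB) ?mulr0 // eq_sym.
rewrite mulr_cst smx_cstMl (act_cstM actP) vstZ mulrA smx_mulr_inl.
rewrite (act_suml actP) vst_sum big1 ?mulr0 // => z _.
rewrite smx_mulr_inr (act_cstM actP) vstZ parnM (act_M actP).
rewrite (even_entry _ _ _ (Lax_even m_gt2 k_gt0 piP RmP)) (act_cstM actP).
by rewrite Lax_v eq_sym (negPf ca) scale0r scaler0 (act0r actP) vst0 mulr0.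
Qed.

Variable kap : idx -> C.
Hypothesis kapP : forall c, \sum_x rV c x x c * kap x = 1.

(** In [exchange_rel] with b = x and y = a, weight conservation forces z = c. Summing over x with
    the weights [kap] replaces the coefficients [rV c x x c] by 1, and what remains is the diagonal
    entry of [Lax * B]. *)
Lemma LaxB_hwe B a : invariant B ->
  hwe (Lax * B) a = qpow (bil (eps a) L) * \sum_x rV a x x a * kap x * hwe B x.
Proof.
move=> iB.
rewrite mulr_sumr; under eq_bigr => x _.
  rewrite (_ : _ * (_ * _ * _) = kap x * (qpow (bil (eps a) L) * rV a x x a * hwe B x)); last by ring.
  rewrite -(exchange_rel a x x a iB) mulr_sumr; over.
rewrite exchange_big /= /hwe smxMl (act_suml actP) vst_sum; apply: eq_bigr => c _.
rewrite (even_entry _ _ _ (Lax_even m_gt2 k_gt0 piP RmP)) -mulrA (act_cstM actP) vstZ.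
rewrite -[LHS]mulr1 -[X in _ * X = _](kapP c) mulr_sumr; apply: eq_bigr => x _.
rewrite (bigD1 c) //= big1 => [|z zc].
  rewrite addr0.
  have -> : (-1) ^+ ((gr c (+) gr x) && (gr a (+) gr c)) =
     (-1) ^+ ((gr c (+) gr a) && (gr a (+) gr c)) *
     (-1) ^+ ((gr x (+) gr a) && (gr a (+) gr c)) :> C.
    by rewrite -signr_addb; case: (gr c) (gr x) (gr a) => [] [] [].
  set s := (-1) ^+ ((gr x (+) gr a) && _).
  have ss : s * s = 1 by rewrite -expr2 sqrr_sign.
  by rewrite -[LHS]mulr1 -ss; ring.
(* Weight conservation: a nonzero coefficient needs eps_c = eps_z, that is z = c. *)
case: (eqVneq (rV c x x z) 0) => [->|/(rV_supp m_gt2 k_gt0 DeltaP piP RmP (wsep R m k))].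
  by rewrite mul0r !mulr0.
by rewrite addrC => /addrI/wsep_inj e; rewrite e eqxx in zc.
Qed.

Lemma casimirA_hwe B a : invariant B ->
  hwe (casimirA pi Rm * B) a = (qpow 1 - (qpow 1)^-1)^-1 *
    (qpow (bil (eps a) L) ^+ 2 * (\sum_x rV a x x a * kap x * hwe B x) - hwe B a).
Proof.
move=> iB; rewrite /hwe /casimirA -mulrA smx_cstMl (act_cstM actP) vstZ; congr (_ * _).
rewrite mulrBl mul1r smx_addE.
have -> : (- B) (a, a) = - B (a, a) by exact: ffunE.
rewrite (act_Dl actP) (act_N actP) vstD -scaleN1r vstZ mulN1r -mulrA; congr (_ - _).
rewrite smxMl (act_suml actP) vst_sum (bigD1 a) //= big1 => [|c ca].
  by rewrite addbb (act_M actP) LaxT_vst eqxx addr0 -/(hwe _ _) LaxB_hwe // expr2 mulrA.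
rewrite (even_entry _ _ _ (LaxT_even m_gt2 k_gt0 piP RmP)) -mulrA (act_cstM actP) vstZ.
by rewrite (act_M actP) LaxT_vst eq_sym (negPf ca) mul0r mulr0.
Qed.
End Recursion.

(** * The R-matrix in the vector representation *)

Section VectorRMatrix.
Variables (R : realType) (m k : nat) (hq : R[i]).
Local Notation C := R[i].
Local Notation wt := (weight R m k).
Local Notation idx := (idx m k).
Local Notation U := (Uosp m k hq).
Local Notation UU := (stens U U).
Local Notation EndV := (smx (@gr m k) C^o).
Local Notation eps := (@eps R m k).
Local Notation xi := (@xi R m k).
Local Notation qpow := (qpow hq).
Hypotheses (m_gt2 : (2 < m)%N) (k_gt0 : (0 < k)%N).
Variable Delta : shom U UU.
Hypothesis DeltaP : is_coproduct Delta.
Variable pi : shom U EndV.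
Hypothesis piP : is_vector_rep pi.
Variable Rm : completion (@adm R m k hq).
Hypotheses (RmP : universal_R Delta Rm) (RmD : double_form Rm).
Local Notation Lax := (Lax pi Rm).
Local Notation rV a b c d := (pi (Lax (a, b)) (c, d)).
Local Notation rho2 := (rho R m k *+ 2).
Implicit Types (a b c d x y z p : idx).

Lemma xi_sq a : xi a * xi a = 1.
Proof. by case: a => [i|u] /=; rewrite ?mulr1 // -exprMn mulrNN mulr1 expr1n. Qed.

Lemma xi_bar a : xi (bar a) = (-1) ^+ gr a * xi a.
Proof.
case: a => [i|u] /=; first by rewrite mulr1.
have uk := ltn_ord u; have -> : ((2 * k - u.+1).+1 = 2 * k - u)%N by lia.
rewrite -signr_odd oddB ?(ltnW uk) // oddM /= signr_odd.
by rewrite expr1 exprS mulrA mulrNN mulr1 mul1r.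
Qed.

Definition pdeg a b : bool := gr a (+) gr b.
(** The sign in Sigma^a_b = E^a_b - [ftheta b a] E^(bar b)_(bar a). *)
Definition ftheta a b : C := (-1) ^+ (gr b && pdeg a b) * (xi a * xi b).

Lemma ftheta_sq a b : ftheta a b * ftheta a b = 1.
Proof. by rewrite /ftheta mulrACA -expr2 sqrr_sign mul1r mulrACA !xi_sq mulr1. Qed.

Lemma ftheta_mul a b : ftheta a b * ftheta b a = (-1) ^+ pdeg a b.
Proof.
have E : xi a * xi b * (xi b * xi a) = 1.
  by rewrite mulrA -(mulrA (xi a)) xi_sq mulr1 xi_sq.
rewrite /ftheta mulrACA E mulr1 -signr_addb.
by rewrite /pdeg; case: (gr a) (gr b) => [] [].
Qed.

Lemma ftheta_bar a b : ftheta (bar b) (bar a) = ftheta a b.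
Proof.
rewrite /ftheta /pdeg !gr_bar !xi_bar mulrACA [xi b * _]mulrC mulrA.
by rewrite -!signr_addb; case: (gr a) (gr b) => [] [].
Qed.

Lemma SigE a b x y : Sig R a b (x, y) =
  ((x == a) && (y == b))%:R - ftheta b a * ((x == bar b) && (y == bar a))%:R.
Proof.
rewrite /Sig smx_addE EmxE; congr (_ + _).
have -> (X : EndV) : (- X) (x, y) = - X (x, y) by exact: ffunE.
rewrite smx_cstMl EmxE /ftheta /pdeg; congr (- (_ * _)).
by rewrite addbC -mulrA; congr (_ * _); exact: mulrC.
Qed.

(* The weight of a' is that of a minus a simple root, whose root vectors act by
   multiples of Sigma^a_a' and Sigma^a'_a. *)
Definition simple_step a a' : Prop := [/\ a != a', a' != bar a &
  exists (e f : U) (phi psi : C), let s := 2^-1 *: (eps a - eps a') in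
  [/\ skew_prim Delta e s /\ homog (pdeg a a') e,
      skew_prim Delta f s /\ homog (pdeg a a') f,
      phi != 0 /\ (forall x y, pi f (x, y) = phi * Sig R a' a (x, y)),
      psi != 0 /\ (forall x y, pi e (x, y) = psi * Sig R a a' (x, y)) &
      bil rho2 (eps a - eps a') = bil (eps a - eps a') (eps a - eps a')]].

Lemma Sig_bar a b x y : Sig R (bar b) (bar a) (x, y) = - ftheta b a * Sig R a b (x, y).
Proof.
rewrite [LHS]SigE [Sig R a b _]SigE !barK ftheta_bar; have := ftheta_sq b a.
move: (ftheta b a) => t tt; rewrite mulNr mulrBr opprB.
by rewrite [t * (t * _)]mulrA tt mul1r.
Qed.

Lemma ftheta_neq0 a b : ftheta a b != 0.
Proof.
by apply/eqP => E; have /eqP := ftheta_sq a b; rewrite E mul0r eq_sym oner_eq0.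
Qed.

(** By [Sig_bar] the matrices Sigma of mirror pairs are proportional, so one simple root provides a
    step at two mirror places, with rescaled [phi] and [psi]. *)
Lemma simple_step_bar a a' : simple_step a a' -> simple_step (bar a') (bar a).
Proof.
move=> [n1 n2 [e [f [phi [psi [H1 H2 [p0 pf] [q0 pe] rr]]]]]].
have E : eps (bar a') - eps (bar a) = eps a - eps a'.
  by rewrite !eps_bar opprK addrC.
split; first by rewrite (inj_eq (inv_inj (@barK m k))) eq_sym.
  by rewrite barK eq_sym.
have pd : pdeg (bar a') (bar a) = pdeg a a' by rewrite /pdeg !gr_bar addbC.
exists e, f, (- phi * ftheta a a'), (- psi * ftheta a' a).
cbv zeta; rewrite pd E; split; [exact: H1|exact: H2| | |exact: rr].
- split; first by rewrite mulf_neq0 ?oppr_eq0 // ftheta_neq0.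
  move=> x y; rewrite Sig_bar pf mulrA; congr (_ * _).
  by rewrite mulrN !mulNr opprK -mulrA ftheta_sq mulr1.
- split; first by rewrite mulf_neq0 ?oppr_eq0 // ftheta_neq0.
  move=> x y; rewrite Sig_bar pe mulrA; congr (_ * _).
  by rewrite mulrN !mulNr opprK -mulrA ftheta_sq mulr1.
Qed.

Definition Pcoef a x : C := rV a x x a.
(** Up to sign the matrix element |bar a, a> -> |a', bar a'>, the only one besides the diagonal ones
    and [Pcoef] that the relations for a simple step involve. *)
Definition Zcoef a a' : C := rV a' (bar a) (bar a') a.

Lemma Pcoef_diag a : Pcoef a a = qpow (bil (eps a) (eps a)).
Proof. by rewrite /Pcoef (rV_diag m_gt2 k_gt0 piP RmD) eqxx. Qed.

Lemma Pcoef_tri a x : (rk a < rk x)%N -> Pcoef a x = 0.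
Proof.
move=> ax; rewrite /Pcoef (rV_tri m_gt2 k_gt0 piP RmD) //.
  by apply/eqP => e; rewrite e ltnn in ax.
by apply: hgt_le; exact: ltnW.
Qed.

(** Each sum in [rV_eq] has at most two nonzero terms, and the common factor [phi] cancels. *)
Lemma rV_Sig u s (g : bool) (phi : C) p q a b c d :
  skew_prim Delta u s -> homog g u -> phi != 0 ->
  (forall x y, pi u (x, y) = phi * Sig R p q (x, y)) ->
  let t := ftheta q p in
  qpow (bil s (eps b)) *
    ((d == q)%:R * rV a b c p - t * ((d == bar p)%:R * rV a b c (bar q))) +
  ((-1) ^+ (g && pdeg a p) * ((b == q)%:R * rV a p c d)
    - t * (-1) ^+ (g && pdeg a (bar q)) * ((b == bar p)%:R * rV a (bar q) c d))
    * qpow (- bil s (eps d)) =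
  qpow (bil s (eps c)) *
    ((a == p)%:R * rV q b c d - t * ((a == bar q)%:R * rV (bar p) b c d)) +
  (-1) ^+ (g && pdeg a b) * qpow (- bil s (eps a)) *
    ((c == p)%:R * rV a b q d - t * ((c == bar q)%:R * rV a b (bar p) d)).
Proof.
move=> su hu p0 pu t.
have {}pu x y : pi u (x, y) = phi * (((x == p) && (y == q))%:R
    - t * ((x == bar q) && (y == bar p))%:R) by rewrite pu SigE.
clearbody t.
have E1 (f : idx -> C) y : \sum_x f x * pi u (x, y) =
    phi * ((y == q)%:R * f p - t * (y == bar p)%:R * f (bar q)).
  under eq_bigr => x _ do rewrite pu mulrCA mulrBr.
  rewrite -mulr_sumr sumrB; congr (_ * (_ - _)).
    rewrite (bigD1 p) //= eqxx big1 => [|x xp]; last by rewrite (negPf xp) mulr0.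
    by rewrite addr0 mulrC.
  rewrite (bigD1 (bar q)) //= eqxx big1 ?addr0 => [|x xp].
    by rewrite /=; ring.
  by rewrite (negPf xp) !mulr0.
have E2 (f : idx -> C) x : \sum_y pi u (x, y) * f y =
    phi * ((x == p)%:R * f q - t * (x == bar q)%:R * f (bar p)).
  under eq_bigr => y _ do rewrite pu -mulrA mulrBl.
  rewrite -mulr_sumr sumrB; congr (_ * (_ - _)).
    rewrite (bigD1 q) //= eqxx andbT big1 ?addr0 // => y yq.
    by rewrite (negPf yq) andbF mul0r.
  rewrite (bigD1 (bar p)) //= eqxx andbT big1 ?addr0 // => y yq.
  by rewrite (negPf yq) andbF mulr0 mul0r.
have := rV_eq m_gt2 k_gt0 piP RmP a b c d su hu.
rewrite E1 E2 E2.
under eq_bigr => e _ do rewrite mulrAC.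
rewrite E1 => E; apply: (mulfI p0); move: E; rewrite /pdeg => E.
transitivity (qpow (bil s (eps b)) *
    (phi * ((d == q)%:R * rV a b c p - t * (d == bar p)%:R * rV a b c (bar q))) +
  (phi * ((b == q)%:R * ((-1) ^+ (g && (gr a (+) gr p)) * rV a p c d)
    - t * (b == bar p)%:R * ((-1) ^+ (g && (gr a (+) gr (bar q))) * rV a (bar q) c d)))
    * qpow (- bil s (eps d))); first by ring.
by rewrite E; ring.
Qed.

(** The relation for f at the indices (a', y, y, a), which compares two consecutive rows of [Pcoef].
    [Zcoef] enters only in the columns bar a and bar a'. *)
Lemma step_F a a' y : simple_step a a' ->
  let s := 2^-1 *: (eps a - eps a') in
  let p := pdeg a a' in let th := ftheta a a' in
  qpow (bil s (eps y)) * (Pcoef a' y - Pcoef a y) =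
  - (y == a)%:R * (qpow (bil (eps a') (eps a)) * qpow (- bil s (eps a)))
  + th * (-1) ^+ p * (y == bar a')%:R * Zcoef a a' * qpow (- bil s (eps a))
  + (-1) ^+ (p && pdeg a' y) * qpow (- bil s (eps a')) *
      ((y == a')%:R * qpow (bil (eps a') (eps a)) - th * (y == bar a)%:R * Zcoef a a').
Proof.
move=> [n1 n2 [e [f [phi [psi /= [_ [sf hf] [p0 pf] _ _]]]]]].
have := rV_Sig a' y y a sf hf p0 pf; cbv zeta.
have -> : (a == bar a') = false.
  by apply/negP => /eqP E; rewrite E barK eqxx in n2.
have dlt (g : idx -> C) z : (y == z)%:R * g y = (y == z)%:R * g z.
  by case: eqP => [->|_] //; rewrite !mul0r.
rewrite (dlt (fun y => rV a' a' y a)) (dlt (fun y => rV a' (bar a) y a)).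
rewrite (dlt (fun y => rV a' y a a)) (dlt (fun y => rV a' y (bar a') a)).
rewrite !eqxx (negPf n2) /Pcoef /Zcoef (rV_diag m_gt2 k_gt0 piP RmD a' a a) eqxx.
have -> : pdeg a' a' = false by rewrite /pdeg addbb.
have -> : pdeg a a' && pdeg a' (bar a) = pdeg a a'.
  by rewrite /pdeg gr_bar addbC; case: (gr a) (gr a') => [] [].
rewrite andbF expr0 !mul0r !mulr0 !subr0 !mul1r => E.
rewrite mulrBr (canRL (addrK _) E); ring.
Qed.

(** The relation for e at the indices (a, bar a, bar a', a), which expresses [Zcoef] by the earlier
    row. *)
Lemma step_E a a' : simple_step a a' ->
  let s := 2^-1 *: (eps a - eps a') in
  Zcoef a a' = ftheta a' a * (qpow (bil s (eps a')) * qpow (- bil s (eps a))) *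
    ((a != bar a)%:R * Pcoef a (bar a) - (-1) ^+ pdeg a a' * Pcoef a (bar a')).
Proof.
move=> [n1 n2 [e [f [phi [psi /= [[se he] _ _ [p0 pe] _]]]]]].
set s := 2^-1 *: _.
have := rV_Sig a (bar a) (bar a') a se he p0 pe; cbv zeta.
have -> : (bar a' == a) = false.
  by apply/negP => /eqP E; rewrite -E barK eqxx in n2.
rewrite [bar a == a']eq_sym !(negPf n2) (negPf n1) !eqxx.
have -> : (a == bar a') = false.
  by apply/negP => /eqP E; rewrite E barK eqxx in n2.
have -> : pdeg a (bar a) = false by rewrite /pdeg gr_bar addbb.
have -> : pdeg a a' && pdeg a (bar a') = pdeg a a'.
  by rewrite /pdeg gr_bar andbb.
have q0 (y : wt) z : qpow (bil y (eps (bar z))) = qpow (- bil y (eps z)).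
  by rewrite eps_bar bilNr.
rewrite andbF expr0 !q0 !mul0r !mulr0 !sub0r !subr0 !mul1r -/(Pcoef a (bar a)).
rewrite -/(Pcoef a (bar a')) -/(Zcoef a a') => E.
apply: (mulfI (qpow_neq0 hq (- bil s (eps a')))).
have K := qpowNK hq (bil s (eps a')).
transitivity (- (qpow (- bil s (eps a)) *
   (ftheta a' a * ((a == bar a)%:R * rV a (bar a) (bar a') (bar a')))) -
   ftheta a' a * (-1) ^+ pdeg a a' * Pcoef a (bar a') * qpow (- bil s (eps a)) +
   qpow (- bil s (eps a)) * (ftheta a' a * Pcoef a (bar a))).
  rewrite -[LHS](addrK (qpow (- bil s (eps a)) * - (ftheta a' a * Pcoef a (bar a)))).
  by rewrite -E; ring.
transitivity (qpow (bil s (eps a')) * qpow (- bil s (eps a')) * (ftheta a' a * qpow (- bil s (eps a))) *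
    ((a != bar a)%:R * Pcoef a (bar a) - (-1) ^+ pdeg a a' * Pcoef a (bar a'))); last by ring.
(* For a = bar a one more matrix element appears. Since eps_a = 0, it and [Pcoef a (bar a)] both
   equal 1 and cancel, hence the factor a != bar a. *)
rewrite K; case: (eqVneq a (bar a)) => [ab|_]; last by rewrite /=; ring.
have e0 (y : wt) : bil y (eps a) = 0.
  have := eps_bar R a; rewrite -ab => /(congr1 (bil y)); rewrite bilNr => /eqP.
  by rewrite -addr_eq0 -mulr2n mulrn_eq0 => /eqP.
have -> : rV a (bar a) (bar a') (bar a') = 1.
  by rewrite -ab (rV_diag m_gt2 k_gt0 piP RmD) eqxx bilC e0 qpow0.
have -> : Pcoef a (bar a) = 1 by rewrite -ab Pcoef_diag e0 qpow0.
by rewrite e0 oppr0 qpow0 /=; ring.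
Qed.

End VectorRMatrix.

Lemma rk_surj (m k r : nat) : (r < m + 2 * k)%N -> exists a : idx m k, rk a = r.
Proof.
move=> rN; case: (ltnP r k) => rk1.
  have u : (r < 2 * k)%N by lia.
  by exists (inr (Ordinal u)); rewrite /= rk1.
case: (ltnP r (k + m)) => rk2.
  have u : (r - k < m)%N by lia.
  by exists (inl (Ordinal u)); rewrite /= subnKC.
have u : (r - m < 2 * k)%N by lia.
exists (inr (Ordinal u)); rewrite /=; case: ifP; lia.
Qed.

(** * Closed form of the matrix elements |a, x> -> |x, a> *)

Section RMatrixRows.
Variables (R : realType) (m k : nat) (hq : R[i]).
Local Notation C := R[i].
Local Notation l := (m./2).
Local Notation wt := (weight R m k).
Local Notation idx := (idx m k).
Local Notation U := (Uosp m k hq).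
Local Notation UU := (stens U U).
Local Notation EndV := (smx (@gr m k) C^o).
Local Notation alpha := (@alpha R m k).
Local Notation eps := (@eps R m k).
Local Notation qpow := (qpow hq).
Local Notation ue := (@ue R m k hq).
Local Notation uf := (@uf R m k hq).
Hypotheses (m_gt2 : (2 < m)%N) (k_gt0 : (0 < k)%N).
Variable Delta : shom U UU.
Hypothesis DeltaP : is_coproduct Delta.
Variable pi : shom U EndV.
Hypothesis piP : is_vector_rep pi.
Variable Rm : completion (@adm R m k hq).
Hypotheses (RmP : universal_R Delta Rm) (RmD : double_form Rm).
Local Notation rho2 := (rho R m k *+ 2).
Local Notation simple_step := (simple_step Delta pi).
Local Notation Pcoef := (Pcoef pi Rm).
Local Notation Zcoef := (Zcoef pi Rm).
Implicit Types (a b c d x y z p : idx).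

Definition sg a : C := (-1) ^+ gr a.
Definition qh : C := qpow 1 - (qpow 1)^-1.
Definition kk a : C := qpow (bil rho2 (eps a)).

(** The term [sg x * qh] is the coefficient familiar from the R-matrix of type gl; the correction at
    x = bar a is due to the invariant bilinear form on V. *)
Definition Pform a x : C :=
  if (rk a < rk x)%N then 0 else if a == x then qpow (bil (eps a) (eps a))
  else sg x * qh * (1 - (x == bar a)%:R * (sg a * kk a)).

Lemma sg_sq a : sg a * sg a = 1.
Proof. by rewrite /sg -expr2 sqrr_sign. Qed.

Lemma sg_bar a : sg (bar a) = sg a.
Proof. by rewrite /sg gr_bar. Qed.

Lemma eps_self a : bil (eps a) (eps a) = if a == bar a then 0 else sg a.
Proof. by rewrite bil_eps eqxx; case: eqP; rewrite ?subrr ?mulr0 ?subr0 ?mulr1. Qed.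

Lemma qpow_sg a : qpow (sg a) - qpow (- sg a) = sg a * qh.
Proof.
rewrite /sg /qh; case: (gr a); rewrite ?expr0 ?expr1 ?opprK qpowN; first by ring.
by rewrite mul1r.
Qed.

Lemma sg_pdeg a b : (-1) ^+ pdeg a b * sg b = sg a.
Proof. by rewrite /sg -signr_addb /pdeg -addbA addbb addbF. Qed.

Lemma self_bar_even a : a = bar a -> sg a = 1 /\ forall y : wt, bil y (eps a) = 0.
Proof.
move=> ab; split; last first.
  move=> y; have := eps_bar R a; rewrite -ab => /(congr1 (bil y)); rewrite bilNr => /eqP.
  by rewrite -addr_eq0 -mulr2n mulrn_eq0 => /eqP.
case: a ab => [i|u] //= /(congr1 (fun a => if a is inr v then nat_of_ord v else 0)) /=.
by have := ltn_ord u; lia.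
Qed.

(* The matrix elements of R Delta(f) = Delta^T(f) R for the simple root eps a - eps a'
   express row a' of Pcoef through row a and the coefficient Zcoef, which the
   relation for e reduces to row a again. *)
Section Step.
Variables (a a' : idx).
Hypothesis st : simple_step a a'.
(** The second alternative is alpha_l for even m: its step leads from rank k + l - 2 to rank k + l
    and jumps over bar a'. The condition on [kk a'] is [Pform a' (bar a') = 0]. *)
Hypothesis rk_aa' : rk a' = (rk a).+1 \/
  [/\ rk a' = (rk a).+2, rk (bar a') = (rk a).+1 & sg a' * kk a' = 1].
Hypothesis row : forall x, Pcoef a x = Pform a x.

Let n1 : a != a'. Proof. by case: st. Qed.
Let n2 : a' != bar a. Proof. by case: st. Qed.
Let n3 : a != bar a'.
Proof. by apply/eqP => E; move: n2; rewrite E barK eqxx. Qed.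
Let A := bil (eps a) (eps a).
Let A' := bil (eps a') (eps a').
Let s := 2^-1 *: (eps a - eps a').
Let aa' : bil (eps a') (eps a) = 0.
Proof. by rewrite bil_eps (negPf n1) (negPf n3) subrr mulr0. Qed.
Let sa : bil s (eps a) = 2^-1 * A.
Proof. by rewrite bilZl bilDl bilNl aa' subr0. Qed.
Let sa' : bil s (eps a') = - (2^-1 * A').
Proof. by rewrite bilZl bilDl bilNl bilC aa' sub0r mulrN. Qed.
Let kk_a' : kk a' = kk a * (qpow (- (2^-1 * A)) * qpow (- (2^-1 * A')) *
  (qpow (- (2^-1 * A)) * qpow (- (2^-1 * A')))).
Proof.
rewrite /kk -!qpowD; congr (qpow _).
have [_ _ [e [f [phi [psi /= [_ _ _ _]]]]]] := st.
rewrite bilDr bilNr bilDl !bilNl !bilDr !bilNr aa' [bil (eps a) (eps a')]bilC aa'.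
rewrite -/A -/A' => E; rewrite -[LHS](subrK (bil rho2 (eps a))) -[X in X + _]opprB E.
by field.
Qed.

Let rk_bara' : rk (bar a') = (m + 2 * k - (rk a').+1)%N. Proof. exact: rk_bar. Qed.
Let rk_bara : rk (bar a) = (m + 2 * k - (rk a).+1)%N. Proof. exact: rk_bar. Qed.
Let rk_ltN : (rk a' < m + 2 * k)%N. Proof. exact: rk_lt. Qed.

Let rk_or : (rk a' = (rk a).+1 \/ rk a' = (rk a).+2 /\ rk (bar a') = (rk a).+1)%N.
Proof. by case: rk_aa' => [|[? ? _]]; [left|right]. Qed.

Let rk_neq x y : x != y -> rk x != rk y.
Proof. by apply: contra => /eqP/rk_inj ->. Qed.

Let ZE : Zcoef a a' = if (rk (bar a) <= rk a)%N then
  - ftheta R a' a * qh * kk a * (qpow (- (2^-1 * A')) * qpow (- (2^-1 * A))) else 0.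
Proof.
rewrite (step_E m_gt2 k_gt0 piP RmP RmD st) -/s sa sa' !row /Pform.
have r3 := rk_neq n3; have ba : (bar a' == bar a) = false.
  by rewrite (inj_eq (inv_inj (@barK m k))) eq_sym (negPf n1).
case: leqP => h.
  have -> : (rk a < rk (bar a'))%N = false by apply/negP; lia.
  rewrite (negPf n3) ba eqxx mul0r subr0 mulr1 !sg_bar.
  rewrite [_ * (sg a' * qh)]mulrA sg_pdeg.
  case: (eqVneq a (bar a)) => [ab|_].
    have [s1 e0] := self_bar_even ab.
    by rewrite /kk (e0 rho2) qpow0 s1 /= mulr0n mul0r sub0r; ring.
  rewrite /= mul1r.
  transitivity (- ftheta R a' a * (qpow (- (2^-1 * A')) * qpow (- (2^-1 * A))) *
    (sg a * sg a * qh * kk a)); first by ring.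
  by rewrite sg_sq; ring.
have -> : (rk a < rk (bar a'))%N by lia.
by rewrite !mulr0 subr0 !mulr0.
Qed.

Lemma step_row x : Pcoef a' x = Pform a' x.
Proof.
rewrite /Pform; case: ltnP => xa'; first exact: (Pcoef_tri m_gt2 k_gt0 piP RmD).
case: eqVneq => [->|na'x]; first exact: (Pcoef_diag m_gt2 k_gt0 piP RmD).
have r3 := rk_neq n3; have rx := rk_neq na'x.
have := step_F m_gt2 k_gt0 piP RmP RmD x st; cbv zeta; rewrite -/s sa sa' aa' qpow0 mul1r.
rewrite opprK row /Pform ZE [x == a']eq_sym (negPf na'x) mulr0n mul0r sub0r.
move: (Pcoef a' x) => P'.
have ba : (bar a' == bar a) = false.
  by rewrite (inj_eq (inv_inj (@barK m k))) eq_sym (negPf n1).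
have qA : qpow (2^-1 * A) * qpow (- (2^-1 * A)) = 1 by exact: qpowNK.
have qA' : qpow (2^-1 * A') * qpow (- (2^-1 * A')) = 1 by exact: qpowNK.
have n0 (y : C) : qpow y != 0 := qpow_neq0 hq y.
have AA : qpow A = qpow (2^-1 * A) * qpow (2^-1 * A).
  by rewrite -qpowD; congr (qpow _); field.
case: ltnP => ax.
  (* A rank strictly between those of a and a' occurs only in the jump over the middle, and belongs
     to bar a'. *)
  have [|[r2 r2' kk1]] := rk_aa'; first by lia.
  have xb : x = bar a' by apply: rk_inj; lia.
  have -> : (rk (bar a) <= rk a)%N = false by apply/negP; lia.
  have -> : (x == a) = false by apply/negP => /eqP e; rewrite e ltnn in ax.
  rewrite subr0 xb eqxx kk1 => E.
  have /eqP : qpow (bil s (eps (bar a'))) * P' = 0 by rewrite E /=; ring.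
  by rewrite mulf_eq0 (negPf (n0 _)) => /eqP ->; rewrite /=; ring.
case: (eqVneq x a) => [xa|xa].
  rewrite xa ?eqxx (negPf n3) -/A sa /=.
  have -> : sg a * qh * (1 - 0 * (sg a' * kk a')) = sg a * qh by ring.
  (* For a = bar a the column a is also the column bar a, so [Zcoef] contributes here too. *)
  case: (eqVneq a (bar a)) => [ab|ab].
    have [s1 e0] := self_bar_even ab.
    have A0 : A = 0 by exact: e0.
    have -> : (rk (bar a) <= rk a)%N by rewrite -ab.
    have -> : pdeg a' a = pdeg a a' by rewrite /pdeg addbC.
    rewrite s1 /kk (e0 rho2) A0 !mulr0 oppr0 qpow0 => E.
    have : P' - 1 = -1 + ftheta R a a' * ftheta R a' a * (-1) ^+ (pdeg a a' && pdeg a a')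
        * qh * (qpow (2^-1 * A') * qpow (- (2^-1 * A'))).
      by rewrite -[LHS]mul1r E /=; ring.
    rewrite ftheta_mul qA' mulr1 andbb -expr2 sqrr_sign mul1r addrC => /(addrI _) ->.
    by rewrite ?mul1r; ring.
  move=> E; have {}E : qpow (2^-1 * A) * (P' - qpow A) = - qpow (- (2^-1 * A)).
    by rewrite E /=; ring.
  rewrite -qpow_sg -(_ : A = sg a); last by rewrite /A eps_self (negPf ab).
  apply: (mulfI (n0 (2^-1 * A))); move: E; rewrite [_ * (P' - _)]mulrBr => /(canRL (subrK _)) ->.
  rewrite [_ * (qpow A - _)]mulrBr; have -> : qpow (2^-1 * A) * qpow (- A) = qpow (- (2^-1 * A)).
    by rewrite -qpowD; congr (qpow _); field.
  by rewrite addrC.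
rewrite mulr0n oppr0 mul0r add0r ?(negPf xa).
case: (eqVneq x (bar a')) => [xb|xb].
  have h : (rk (bar a) <= rk a)%N by have := rk_neq xa; have := congr1 (@rk m k) xb; lia.
  rewrite xb ba h /= eps_bar bilNr sa' opprK !sg_bar => E.
  have {}E : qpow (2^-1 * A') * P' = ftheta R a a' * (-1) ^+ pdeg a a' *
      (- ftheta R a' a * qh * kk a * (qpow (- (2^-1 * A')) * qpow (- (2^-1 * A)))) *
      qpow (- (2^-1 * A)) + qpow (2^-1 * A') * (sg a' * qh).
    transitivity (qpow (2^-1 * A') * (P' - sg a' * qh * (1 - 0 * (sg a * kk a))) +
      qpow (2^-1 * A') * (sg a' * qh)); first by ring.
    by rewrite E /=; ring.
  apply: (mulfI (n0 (2^-1 * A'))); rewrite E kk_a'.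
  transitivity (qpow (2^-1 * A') * (sg a' * qh) -
    ftheta R a a' * ftheta R a' a * (-1) ^+ pdeg a a' * (qh * kk a *
      (qpow (- (2^-1 * A')) * qpow (- (2^-1 * A)) * qpow (- (2^-1 * A))))); first by ring.
  rewrite ftheta_mul -expr2 sqrr_sign mul1r.
  transitivity (qpow (2^-1 * A') * (sg a' * qh) - sg a' * sg a' * (qh * kk a) *
      ((qpow (2^-1 * A') * qpow (- (2^-1 * A'))) * (qpow (- (2^-1 * A')) *
        qpow (- (2^-1 * A)) * qpow (- (2^-1 * A))))); last by ring.
  by rewrite sg_sq qA' !mul1r; ring.
case: (eqVneq x (bar a)) => [xb'|xb'].
  have h : (rk (bar a) <= rk a)%N by have := congr1 (@rk m k) xb'; lia.
  rewrite xb' h /= eps_bar bilNr sa !sg_bar.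
  have -> : pdeg a a' && pdeg a' (bar a) = pdeg a a'.
    by rewrite /pdeg gr_bar addbC; case: (gr a) (gr a') => [] [].
  move=> E; have {}E : qpow (- (2^-1 * A)) * P' = (-1) ^+ pdeg a a' * qpow (2^-1 * A') *
     (- (ftheta R a a' * (- ftheta R a' a * qh * kk a *
        (qpow (- (2^-1 * A')) * qpow (- (2^-1 * A)))))) +
      qpow (- (2^-1 * A)) * (sg a * qh * (1 - sg a * kk a)).
    transitivity (qpow (- (2^-1 * A)) * (P' - sg a * qh * (1 - 1 * (sg a * kk a))) +
      qpow (- (2^-1 * A)) * (sg a * qh * (1 - sg a * kk a))); first by ring.
    by rewrite E /=; ring.
  apply: (mulfI (n0 (- (2^-1 * A)))); rewrite E mul0r subr0 mulr1.
  transitivity (qpow (- (2^-1 * A)) * (sg a * qh) - sg a * sg a * qh * kk a * qpow (- (2^-1 * A)) +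
    ftheta R a a' * ftheta R a' a * (-1) ^+ pdeg a a' * (qh * kk a *
      ((qpow (2^-1 * A') * qpow (- (2^-1 * A'))) * qpow (- (2^-1 * A))))); first by ring.
  by rewrite ftheta_mul sg_sq -expr2 sqrr_sign qA'; ring.
(* In the remaining columns the relation has no inhomogeneous term: the rows a and a' agree
   there. *)
move=> E; have /eqP : qpow (bil s (eps x)) * (P' - sg x * qh * (1 - 0 * (sg a * kk a))) = 0.
  by rewrite E /=; ring.
by rewrite mulf_eq0 (negPf (n0 _)) subr_eq0 => /eqP ->; rewrite !mul0r.
Qed.
End Step.

Lemma step_of_root (c : sroot m k) p p' (sigma : C) : p != p' -> p' != bar p ->
  alpha c = eps p - eps p' -> sgr c = pdeg p p' -> sigma != 0 ->
  pi (ue c) = Sig R p p' ->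
  (forall x y, pi (uf c) (x, y) = sigma * Sig R p' p (x, y)) -> simple_step p p'.
Proof.
move=> n1 n2 al gc s0 pe pf; split=> //.
exists (ue c), (uf c), sigma, 1; cbv zeta; rewrite -al -gc; split.
- by split; [exact: skew_ue|exact: homog_ue].
- by split; [exact: skew_uf|exact: homog_uf].
- by split.
- by split; [exact: oner_neq0|move=> x y; rewrite pe mul1r].
- exact: bil_rho2_alpha.
Qed.

Lemma SigN p p' x y : (- Sig R p p') (x, y) = -1 * Sig R p p' (x, y).
Proof. by rewrite mulN1r; exact: ffunE. Qed.

(** The bound allows p' up to rank k + l - 1 for even m, and up to the middle index, of rank k + l,
    for odd m. *)
Lemma upper_step p p' : rk p' = (rk p).+1 -> (rk p' + ~~ odd m <= k + l)%N ->
  simple_step p p'.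
Proof.
move=> pp' bd; have mE := odd_double_half m; have [_ _ P3 _ [P5 P6]] := piP.
have N1 : -1 != 0 :> C by rewrite oppr_eq0 oner_eq0.
have n1 : p != p' by apply/eqP => e; move: pp'; rewrite e; lia.
have n2 : p' != bar p.
  apply/eqP => e; have := congr1 (@rk m k) e; rewrite rk_bar; have := rk_lt p.
  by case: (odd m) mE bd => /=; lia.
case: p p' pp' bd n1 n2 => [i|u] [j|v] /= pp' bd n1 n2.
- have ji : j = i.+1 :> nat by lia.
  have il : (i < l)%N by case: (odd m) mE bd => /=; lia.
  have im : (i.+1 < l)%N || odd m by case: (odd m) mE bd => /=; lia.
  have [pe pf] := P3 (Ordinal il) i j im erefl ji.
  have al : alpha (REven k (Ordinal il)) = eps (inl i) - eps (inl j).
    rewrite -(epsn_eps R k il) [LHS]/=; case: ifP => i1.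
      by rewrite -(epsn_eps R k (i := j)) ji.
    (* The last root for odd m: p' is the middle index, of weight 0, in accordance with alpha_l =
       eps_l. *)
    rewrite i1 /= in im; have m1 : (1 + l.*2 = m)%N by rewrite -[RHS]mE im.
    have jm := ltn_ord j; have -> : eps (inl j) = 0; last by rewrite subr0 im.
    by rewrite /eps !epsn_ge ?subr0 //=; lia.
  apply: (step_of_root n1 n2 al erefl (oner_neq0 C) pe) => x y.
  by rewrite mul1r pf.
- by have := ltn_ord v; have := ltn_ord i; case: ifP pp' bd => h; case: (odd m) mE => /=; lia.
- case: ifP pp' bd n1 n2 => uk pp' bd n1 n2; last first.
    by have := ltn_ord u; case: (odd m) mE bd => /=; lia.
  have uE : u = k.-1 :> nat by lia.
  have jE : j = 0 :> nat by lia.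
  have [pe pf] := P6 u j uE jE.
  have al : alpha (RS m k) = eps (inr u) - eps (inl j).
    by rewrite -(deltan_eps R m uk) -(epsn_eps R k (i := j)) jE ?uE //; lia.
  apply: (@step_of_root _ (inr u) (inl j) _ isT isT al erefl N1 pe) => x y.
  by rewrite pf SigN.
- case: ifP pp' bd n1 n2 => uk; case: ifP => vk pp' bd n1 n2; try by
    have := ltn_ord u; have := ltn_ord v; case: (odd m) mE bd => /=; lia.
  have uk1 : (u < k.-1)%N by lia.
  have [pe pf] := P5 (Ordinal uk1) u v erefl pp'.
  have al : alpha (ROdd m (Ordinal uk1)) = eps (inr u) - eps (inr v).
    by rewrite -(deltan_eps R m uk) -(deltan_eps R m vk) pp'.
  apply: (step_of_root n1 n2 al erefl N1 pe) => x y.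
  by rewrite pf SigN.
Qed.

(** For even m, alpha_l = eps_(l-1) + eps_l is the difference of the weights of the indices l - 1
    and bar l. The second part holds because (2 rho, eps_l) = m - 2l = 0. *)
Lemma middle_step (p p' : idx) : ~~ odd m -> rk p = (k + l).-2 -> rk p' = (k + l)%N ->
  simple_step p p' /\ sg p' * kk p' = 1.
Proof.
move=> mo pE p'E; have mE := odd_double_half m; rewrite (negPf mo) add0n in mE.
have [_ _ _ P4 _] := piP.
case: p p' pE p'E => [i|u] [j|v] /= pE p'E; try by
  [move: pE; have := ltn_ord u; case: ifP; lia|move: p'E; have := ltn_ord v; case: ifP; lia].
have i2 : i.+2 = l :> nat by lia.
have jl : j = l :> nat by lia.
have b1 : (l.-1 < m)%N by lia.
have l1 : (l.-1 < l)%N by lia.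
have jb : inl j = bar (inl (Ordinal b1)) :> idx.
  by congr inl; apply: val_inj => /=; lia.
have e1 : (nat_of_ord (Ordinal l1)).+1 = l by move=> /=; lia.
have e2 : i.+1 = Ordinal l1 :> nat by move=> /=; lia.
have [pe pf] := P4 (Ordinal l1) i (Ordinal b1) e1 mo e2 erefl.
rewrite -jb in pe pf; split.
  have n1 : inl i != inl j :> idx by apply/eqP => -[e]; move: jl; rewrite -e; lia.
  have n2 : inl j != bar (inl i) :> idx.
    by apply/eqP => -[e]; move: (congr1 val e) => /=; lia.
  have al : alpha (REven k (Ordinal l1)) = eps (inl i) - eps (inl j).
    rewrite jb eps_bar opprK -(epsn_eps R k (i := i)); last lia.
    rewrite -(epsn_eps R k (i := Ordinal b1)) // [LHS]/= ifF; last by lia.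
    by rewrite (negPf mo) addrC; congr (epsn _ _ _ _ + _); lia.
  apply: (step_of_root n1 n2 al erefl (oner_neq0 C) pe) => x y.
  by rewrite mul1r pf.
rewrite /sg /kk jb gr_bar eps_bar bilNr rho2E -(epsn_eps R k (i := Ordinal b1)) //.
rewrite bil_wtof_epsn l1 expr0 mul1r.
have -> : m%:R = (2 * l.-1.+1)%:R :> C by congr (_%:R); lia.
by rewrite natrM subrr oppr0 qpow0.
Qed.

(** Row 0 follows from triangularity alone. A later row is reached from the preceding one by a
    simple step, in the lower half by the mirror image of a step of the upper half, and at rank k +
    l for even m from the row k + l - 2. *)
Lemma Pcoef_form a x : Pcoef a x = Pform a x.
Proof.
have mE := odd_double_half m.
have [n] := ubnP (rk a); elim: n a x => // n IH a' x rn.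
have rN := rk_lt a'.
case: (posnP (rk a')) => r0.
  rewrite /Pform; case: (ltnP (rk a') (rk x)) => ax.
    exact: (Pcoef_tri m_gt2 k_gt0 piP RmD).
  have -> : a' = x by apply: rk_inj; lia.
  by rewrite eqxx; exact: (Pcoef_diag m_gt2 k_gt0 piP RmD).
case: (leqP (rk a' + ~~ odd m) (k + l)) => h1.
  have [a aE] : exists a : idx, rk a = (rk a').-1 by apply: rk_surj; lia.
  have aa' : rk a' = (rk a).+1 by lia.
  apply: (step_row (upper_step aa' h1)) => [|y]; first by left.
  by apply: IH; lia.
case: (ltnP (k + l) (rk a')) => h2.
  have [a aE] : exists a : idx, rk a = (rk a').-1 by apply: rk_surj; lia.
  have aa' : rk a' = (rk a).+1 by lia.
  have st : simple_step (bar a') (bar a).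
    apply: upper_step; rewrite !rk_bar; first by lia.
    by case: (odd m) mE h1 => /=; lia.
  have := simple_step_bar m_gt2 k_gt0 st; rewrite !barK => {}st.
  apply: (step_row st) => [|y]; first by left.
  by apply: IH; lia.
have mo : ~~ odd m by move: h1; case: (odd m) => /=; lia.
have [a aE] : exists a : idx, rk a = (k + l).-2 by apply: rk_surj; lia.
have a'E : rk a' = (k + l)%N by move: h1; rewrite mo /=; lia.
have [st sk] := middle_step mo aE a'E.
apply: (step_row st) => [|y]; last by apply: IH; lia.
right; split=> //; first by lia.
by rewrite rk_bar a'E aE; move: mE; rewrite (negPf mo) /=; lia.
Qed.
End RMatrixRows.

(** * Partial fractions of a triangular resolvent *)

(** Of [size p + size S] distinct integers at most [size S] are excluded, which leaves at least
    [size p] roots. *)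
Lemma poly_cofinite (F : numFieldType) (p : {poly F}) (S : seq F) :
  (forall z, z \notin S -> p.[z] = 0) -> p = 0.
Proof.
move=> H; apply/eqP/negPn/negP => p0.
pose T := [seq (i%:R : F) | i <- iota 0 (size p + size S)%N].
have uT : uniq T by rewrite map_inj_uniq ?iota_uniq // => i j /eqP; rewrite eqr_nat => /eqP.
pose T' := [seq z <- T | z \notin S].
have rT' : all (root p) T'.
  by apply/allP => z; rewrite mem_filter => /andP[/H /eqP].
have := max_poly_roots p0 rT' (filter_uniq _ uT).
have cS : (count (mem S) T <= size S)%N.
  rewrite -size_filter; apply: uniq_leq_size; first exact: filter_uniq.
  by move=> z; rewrite mem_filter => /andP[].
rewrite size_filter -(ltn_add2l (count (mem S) T)) count_predC size_map size_iota.
by rewrite addnC ltn_add2r ltnNge cS.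
Qed.

(** The vectors are l_a(M) (1, ..., 1) for the Lagrange interpolation polynomials l_a of the
    diagonal entries: (M - M_aa) l_a(M) = 0 by Cayley-Hamilton, and the l_a sum to 1, as the
    difference has more roots than its degree allows. *)
Lemma eigen_decomp (F : fieldType) n (M : 'I_n -> 'I_n -> F) :
  (forall i j : 'I_n, (i < j)%N -> M i j = 0) -> injective (fun i => M i i) ->
  exists U : 'I_n -> 'I_n -> F,
    (forall a i, \sum_j M i j * U a j = M a a * U a i) /\ forall i, \sum_a U a i = 1.
Proof.
case: n M => [|n] M trM injM; first by exists M; split=> [[]|[]].
pose A := \matrix_(i, j) M i j.
pose l a : {poly F} := \prod_(b | b != a) (('X - (M b b)%:P) * ((M a a - M b b)^-1)%:P).
pose v : 'cV[F]_n.+1 := const_mx 1.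
have dM a b : b != a -> M a a - M b b != 0.
  by move=> ba; rewrite subr_eq0; apply: contraNneq ba => /injM ->.
have chA : char_poly A = \prod_b ('X - (M b b)%:P).
  rewrite char_poly_trig; last by apply/is_trig_mxP => i j ij; rewrite mxE trM.
  by apply: eq_bigr => b _; rewrite mxE.
have lroot a : (A - (M a a)%:M) *m (horner_mx A (l a)) = 0.
  have -> : A - (M a a)%:M = horner_mx A ('X - (M a a)%:P).
    by rewrite rmorphB /= horner_mx_X horner_mx_C.
  have -> : l a = \prod_(b | b != a) ('X - (M b b)%:P) *
     \prod_(b | b != a) ((M a a - M b b)^-1)%:P by rewrite -big_split.
  by rewrite mulmxE -rmorphM mulrA -(bigD1 a (P := xpredT)) // -chA rmorphM /=
    Cayley_Hamilton mul0r.
have lsum : \sum_a l a = 1.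
  apply/eqP; rewrite -subr_eq0; apply/negPn/negP => p0.
  have rs : all (root (\sum_a l a - 1)) [seq M b b | b <- enum 'I_n.+1].
    apply/allP => _ /mapP[b _ ->]; rewrite /root hornerE hornerN horner_sum hornerC.
    rewrite (bigD1 b) //= big1 ?addr0 => [|a ab].
      rewrite horner_prod big1 ?subrr // => c cb.
      by rewrite !hornerE divff // dM.
    by rewrite horner_prod (bigD1 b) 1?eq_sym //= !hornerE subrr !mul0r.
  have := max_poly_roots p0 rs; rewrite map_inj_uniq ?enum_uniq // size_map size_enum_ord.
  move=> /(_ isT); rewrite ltnNge => /negP; apply.
  rewrite (leq_trans (size_polyD _ _)) // geq_max size_polyN size_poly1 andbT.
  apply: (leq_trans (size_sum _ _ _)); apply/bigmax_leqP => a _.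
  rewrite /l big_split /= mulrC.
  have -> : \prod_(b | b != a) ((M a a - M b b)^-1)%:P =
     (\prod_(b | b != a) (M a a - M b b)^-1)%:P :> {poly F} by rewrite rmorph_prod.
  rewrite mul_polyC (leq_trans (size_scale_leq _ _)) //.
  rewrite -big_filter size_prod_XsubC size_filter -sum1_count.
  rewrite (eq_bigl (fun i : 'I_n.+1 => i \in predC1 a)) // sum1_card.
  by have := cardC1 a; rewrite card_ord => ->.
exists (fun a i => (horner_mx A (l a) *m v) i 0); split=> [a i|i]; last first.
  rewrite -summxE -mulmx_suml -(rmorph_sum (horner_mx A)) lsum rmorph1 mul1mx /= mxE //.
have /(congr1 (fun B => (B *m v) i 0)) := lroot a.
rewrite mul0mx -mulmxA mulmxBl mul_scalar_mx !mxE => /eqP; rewrite subr_eq0 => /eqP <-.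
by apply: eq_bigr => j _; rewrite !mxE.
Qed.

(* In terms of ranks j = rk a, with opp j the rank of bar a, N = m + n and
   o the parity of m: e j = q^(eps_a, eps_a), s j = (-1)^[a], k j = q^(2 rho, eps_a),
   d j = q^(eps_a, Lambda) and c0 = q^(- C(Lambda_0)). Then tri is Pform, and lam j,
   mu j are q^((eps_a, 2 rho + 2 Lambda +- eps_a) - C(Lambda_0)). *)
Section TriangularResolvent.
Variables (F : numFieldType) (u : nat) (o : bool).
Local Notation N := (u + u + o)%N.
Variables (q c0 : F) (e s k : nat -> F).
Local Notation h := (q - q^-1).
Local Notation opp j := (N - j.+1)%N.
Hypotheses (u_gt0 : (0 < u)%N) (q_neq0 : q != 0) (h_neq0 : h != 0) (c0_neq0 : c0 != 0).
Hypotheses (e_neq0 : forall j, (j < N)%N -> e j != 0)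
  (k_neq0 : forall j, (j < N)%N -> k j != 0).
Hypotheses (s_sq : forall j, (j < N)%N -> s j * s j = 1)
  (s_opp : forall j, (j < N)%N -> s (opp j) = s j)
  (e_opp : forall j, (j < N)%N -> e (opp j) = e j)
  (k_opp : forall j, (j < N)%N -> k j * k (opp j) = 1).
(** [k_rec] is (2 rho, alpha) = (alpha, alpha) along the upper half, [k_last] is (2 rho, eps_l) = m
    - 2l, and [k_first] is C(Lambda_0) = (delta_1, delta_1 + 2 rho). *)
Hypotheses (e_s : forall j, (j < u)%N -> e j - (e j)^-1 = s j * h)
  (k_rec : forall j, (j.+1 < u)%N -> k j / e j = k j.+1 * e j.+1)
  (k_last : k u.-1 / e u.-1 = if o then 1 else q^-1)
  (k_first : k 0 * c0 * e 0 = 1).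
Hypothesis mid : o -> [/\ e u = 1, s u = 1 & k u = 1].

Definition lowb (i : nat) : bool := (opp i < i)%N.
Definition tri (i j : nat) : F :=
  if (i < j)%N then 0 else if i == j then e i
  else s j * h * (1 - (j == opp i)%:R * (s i * k i)).

(** Left of the diagonal, rows differ only by their length and by the entry at the mirror index, so
    they all act through the partial sums of one sequence, with one correction term in the lower
    half. *)
Lemma tri_sum (y : nat -> F) i : (i < N)%N ->
  \sum_(j < N) tri i j * y j = \sum_(j < i) s j * h * y j
     - (lowb i)%:R * (h * k i * y (opp i)) + e i * y i.
Proof.
move=> iN; rewrite (bigID (fun j : 'I_N => (j < i)%N)) /=.
have -> : \sum_(j < N | ~~ (j < i)%N) tri i j * y j = e i * y i.
  rewrite (bigD1 (Ordinal iN)) ?ltnn //= big1 ?addr0 => [|j /andP[ji jn]].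
    by rewrite /tri ltnn eqxx.
  have {}jn : nat_of_ord j != i by apply: contra jn => /eqP e1; apply/eqP/val_inj.
  by rewrite /tri ifT ?mul0r //; move: jn; lia.
congr (_ + _).
rewrite -(big_ord_widen_cond N xpredT (fun j => tri i j * y j) (ltnW iN)).
rewrite [in RHS](eq_bigr (fun j : 'I_i => s j * h * y j)) //.
transitivity (\sum_(j < i) (s j * h * y j - (nat_of_ord j == opp i)%:R *
    (s j * h * (s i * k i) * y j))).
  apply: eq_bigr => j _; have ji := ltn_ord j.
  by rewrite /tri ltnNge (ltnW ji) /= (gtn_eqF ji); ring.
rewrite sumrB; congr (_ - _); rewrite /lowb; case: ltnP => oi.
  rewrite (bigD1 (Ordinal oi)) //= eqxx big1 ?addr0 => [|j jn].
    rewrite mul1r s_opp // -[RHS]mul1r mul1r; transitivity (s i * s i * (h * k i * y (opp i))).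
      by ring.
    by rewrite s_sq // mul1r mul1r.
  have -> : (nat_of_ord j == opp i) = false.
    by apply: contraNF jn => /eqP e1; apply/eqP/val_inj.
  by rewrite mul0r.
rewrite mul0r big1 // => j _; have ji := ltn_ord j.
have -> : (nat_of_ord j == opp i) = false by apply/eqP; lia.
by rewrite mul0r.
Qed.

Definition Tpart (i : nat) : F := 1 - \sum_(j < i) s j * h * (k j * c0).

Lemma TpartS i : Tpart i.+1 = Tpart i - s i * h * (k i * c0).
Proof. by rewrite /Tpart big_ord_recr /= opprD addrA. Qed.

Lemma e_s' j : (j < N)%N -> ~~ (o && (j == u)) -> e j - (e j)^-1 = s j * h.
Proof.
move=> jN; rewrite negb_and => H; case: (ltnP j u) => ju; first exact: e_s.
have {}H : (opp j < u)%N by case: o H jN => /=; [move=> /eqP|]; lia.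
by rewrite -e_opp // -(s_opp jN); exact: e_s.
Qed.

Lemma k_opp' j : (j < N)%N -> k (opp j) = (k j)^-1.
Proof. by move=> jN; apply: (mulfI (k_neq0 jN)); rewrite k_opp // divff // k_neq0. Qed.

(** The sum telescopes: s_i h = e_i - 1/e_i by [e_s], and k_i / e_i = k_(i+1) e_(i+1) by [k_rec]. *)
Lemma Tpart_upper i : (i < u)%N -> Tpart i = e i * (k i * c0).
Proof.
elim: i => [|i IH] iu; first by rewrite /Tpart big_ord0 subr0 -k_first; ring.
have iN : (i < N)%N by lia.
rewrite TpartS IH ?(ltnW iu) // -e_s ?(ltnW iu) //.
transitivity (k i / e i * c0); first by ring.
by rewrite k_rec //; ring.
Qed.

Lemma Tpart_mid : Tpart u = c0 * (if o then 1 else q^-1).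
Proof.
have u1 : (u.-1 < u)%N by lia.
rewrite -[u in LHS]prednK // TpartS Tpart_upper // -e_s // -k_last; ring.
Qed.

(** The mirrored relations continue the telescoping. Crossing the middle leaves the defect h c0,
    which is exactly the mirror term of [tri_sum] that [tri_kappa] has to absorb. *)
Lemma Tpart_lower i : (u + o <= i)%N -> (i < N)%N ->
  Tpart i = e i * (k i * c0) - h * c0.
Proof.
elim: i => [|i IH] ui iN; first lia.
have iN' : (i < N)%N by lia.
have uN : (u.-1 < N)%N by lia.
case: (ltnP i (u + o)) => iu; last first.
  rewrite TpartS IH // -e_s' //; last by case: o iu => //=; lia.
  have E : k i / e i = k i.+1 * e i.+1.
    have jN : (opp i.+1 < N)%N by lia.
    have j1 : ((opp i.+1).+1 = opp i)%N by lia.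
    have := k_rec (j := opp i.+1); rewrite j1 => /(_ ltac:(by case: o iN iu => /=; lia)).
    rewrite (k_opp' iN) (k_opp' iN') !e_opp // => H.
    by have := congr1 (fun x => x^-1) H; rewrite !invfM !invrK => ->.
  transitivity (k i / e i * c0 - h * c0); first by ring.
  by rewrite E; ring.
have iE : i.+1 = (u + o)%N by lia.
have op : opp i.+1 = u.-1 by rewrite iE; lia.
have ek : e i.+1 * k i.+1 = if o then 1 else q.
  rewrite -(e_opp iN) op; have := k_opp' iN; rewrite op => K.
  have := k_last; rewrite K => /(congr1 (fun x => x^-1)).
  by rewrite invfM !invrK mulrC => ->; case: o; rewrite ?invr1 ?invrK.
rewrite mulrA ek; case: ifP => o1.
  have [_ su ku] := mid o1; have -> : i = u by rewrite o1 in iE; lia.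
  by rewrite TpartS Tpart_mid o1 su ku; ring.
have -> : i.+1 = u by rewrite iE o1 addn0.
by rewrite Tpart_mid o1; ring.
Qed.

Lemma lowb_lt i : (i < u + o)%N -> lowb i = false.
Proof. by rewrite /lowb => iu; apply/negP; case: o iu => /=; lia. Qed.

Lemma lowb_ge i : (u + o <= i)%N -> (i < N)%N -> lowb i.
Proof. by rewrite /lowb; case: o => /=; lia. Qed.

(** This supplies the weights required by [kapP]. For d = 1 it says that M fixes (1, ..., 1), as it
    must for the trivial module. *)
Lemma tri_kappa i : (i < N)%N -> \sum_(j < N) tri i j * (k j * c0) = 1.
Proof.
move=> iN; rewrite (tri_sum (fun j => k j * c0)) //.
have -> : h * k i * (k (opp i) * c0) = h * c0.
  by rewrite -[RHS]mulr1 -(k_opp iN); ring.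
have -> : \sum_(j < i) s j * h * (k j * c0) = 1 - Tpart i by rewrite /Tpart subKr.
case: (ltnP i (u + o)) => iu.
  rewrite lowb_lt // mul0r subr0; case: (ltnP i u) => iu'.
    by rewrite Tpart_upper //; ring.
  have ie : i = u by case: o iu => /=; lia.
  have o1 : o by case: o iu => //=; lia.
  by have [eu _ ku] := mid o1; rewrite ie Tpart_mid o1 eu ku; ring.
by rewrite lowb_ge // Tpart_lower // mulr1n; ring.
Qed.

Variable d : nat -> F.
Hypotheses (d_neq0 : forall j, (j < N)%N -> d j != 0)
  (d_opp : forall j, (j < N)%N -> d j * d (opp j) = 1) (d_mid : o -> d u = 1).

Definition lam (i : nat) : F := d i ^+ 2 * (e i * (k i * c0)).
Definition mu (i : nat) : F := d i ^+ 2 * ((e i)^-1 * (k i * c0)).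
(** Up to a factor independent of j, the part of [V_mirror] without a product of ratios. For odd m
    it is also the value at z = c0 of the product of the ratios between j and its mirror, the middle
    one omitted. *)
Definition Wmir (j : nat) : F :=
  if (j < u)%N then k (opp j) / e j else if o then 1 else q.

Lemma WmirS j : (j < u)%N -> Wmir j.+1 = e j * k (opp j).
Proof.
move=> ju; have jN : (j < N)%N by lia.
rewrite /Wmir (k_opp' jN); case: ltnP => j1.
  have j1N : (j.+1 < N)%N by lia.
  by rewrite (k_opp' j1N) -invfM -k_rec // invfM invrK mulrC.
have jE : j = u.-1 by lia.
have := congr1 (fun x => x^-1) k_last; rewrite -jE invfM invrK mulrC => ->.
by case: o; rewrite ?invr1 ?invrK.
Qed.

Lemma d_opp' j : (j < N)%N -> d (opp j) = (d j)^-1.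
Proof. by move=> jN; apply: (mulfI (d_neq0 jN)); rewrite d_opp // divff // d_neq0. Qed.

(** At z = c0 the factors at i < u and at its mirror index multiply to e_i^(-2), whatever d is,
    since the mirror inverts both d and k. The product is built outwards from the middle. *)
Lemma mid_prod (lc : forall i, (i < N)%N -> i != u -> c0 - lam i != 0) : o ->
  \prod_(0 <= i < N | i != u) ((c0 - mu i) / (c0 - lam i)) = k (opp 0) / e 0.
Proof.
move=> ho; rewrite big_mkcond /=.
pose G i := if i != u then (c0 - mu i) / (c0 - lam i) else 1.
rewrite -[LHS]/(\prod_(0 <= i < N) G i).
suff H j : (j <= u)%N -> \prod_(j <= i < N - j) G i = Wmir j.
  by have := H 0 (leq0n _); rewrite subn0 /Wmir u_gt0.
move=> ju; rewrite -(subKn ju); move: (u - j)%N (leq_subr j u) => t.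
elim: t => [_|t IH tu].
  rewrite subn0 /Wmir ltnn; have -> : (N - u = u.+1)%N by case: (o) ho => //= _; lia.
  by rewrite big_nat1 /G eqxx ho.
have {IH} := IH (ltnW tu); have jS : (u - t = (u - t.+1).+1)%N by lia.
set j' := (u - t.+1)%N in jS *; rewrite jS => IH.
have ju' : (j' < u)%N by rewrite /j'; lia.
have jN : (j' < N)%N by lia.
have iN : (opp j' < N)%N by lia.
have SN : (opp j').+1 = (N - j')%N by lia.
have nj : j' != u by apply/eqP; lia.
have ni : opp j' != u by apply/eqP; case: (o) ho => //= _; lia.
rewrite (big_ltn (m := j')); last lia.
rewrite -SN (big_nat_recr (opp j')) /=; last lia.
rewrite IH (WmirS ju') /Wmir ju' /G nj ni.
have l1 := lc _ jN nj; have l2 := lc _ iN ni; move: l1 l2.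
rewrite /lam /mu (d_opp' jN) (e_opp jN) (k_opp' jN).
have ej := e_neq0 jN; have kj := k_neq0 jN; have dj := d_neq0 jN => l1 l2.
have l2' : c0 * (d j' ^+ 2 * k j') - e j' * c0 != 0.
  apply: contraNneq l2 => E.
  have -> : c0 - (d j')^-1 ^+ 2 * (e j' * ((k j')^-1 * c0)) = 
     (c0 * (d j' ^+ 2 * k j') - e j' * c0) / (d j' ^+ 2 * k j').
    by field; rewrite dj kj.
  by rewrite E mul0r.
field; by rewrite ej kj dj l2' l1.
Qed.

(** * The trace of the resolvent *)

Section Resolvent.
Variables (z : F) (tau : nat -> F).
Hypotheses (z_neq0 : z != 0) (zc : z ^+ 2 - c0 ^+ 2 != 0)
  (z_lam : forall i, (i < N)%N -> z - lam i != 0).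
Hypothesis tauP : forall i, (i < N)%N ->
  z * tau i - d i ^+ 2 * (\sum_(j < N) tri i j * (k j * c0) * tau j) = 1.

(** By [tri_kappa] this shift absorbs the right-hand side 1 of the resolvent equation, which
    reappears as the initial value 1/z of the partial sums [V]. *)
Let tau' i := tau i - z^-1.
Let V i := z^-1 + \sum_(j < i) s j * h * ((k j * c0) * tau' j).

Let VS i : V i.+1 = V i + s i * h * ((k i * c0) * tau' i).
Proof. by rewrite /V big_ord_recr /= addrA. Qed.

Let tau'E i : (i < N)%N -> (z - lam i) * tau' i =
  d i ^+ 2 * (V i - (lowb i)%:R * (h * k i * ((k (opp i) * c0) * tau' (opp i)))).
Proof.
move=> iN; have := tauP iN.
have -> : \sum_(j < N) tri i j * (k j * c0) * tau j =
    \sum_(j < N) tri i j * ((k j * c0) * tau' j) + z^-1.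
  transitivity (\sum_(j < N) (tri i j * ((k j * c0) * tau' j) + tri i j * (k j * c0) * z^-1)).
    by apply: eq_bigr => j _; rewrite /tau'; ring.
  by rewrite big_split /= -mulr_suml tri_kappa // mul1r.
rewrite (tri_sum (fun j => (k j * c0) * tau' j)) // => E.
have {}E : z * tau' i = d i ^+ 2 * (\sum_(j < i) s j * h * (k j * c0 * tau' j) -
      (lowb i)%:R * (h * k i * (k (opp i) * c0 * tau' (opp i))) +
      e i * (k i * c0 * tau' i) + z^-1).
  by rewrite {1}/tau' mulrBr divff // -[X in _ - X]E; ring.
rewrite mulrBl E /V /lam; ring.
Qed.

(* The partial sums V satisfy a two-term recurrence up to the middle; below it the
   extra term of tri involves only V at the mirror index, so that V (N - j) is
   V j times an explicit rational function of z (V_mirror). *)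
Let V_upper i : (i < u)%N -> (z - lam i) * V i.+1 = (z - mu i) * V i.
Proof.
move=> iu; have iN : (i < N)%N by lia.
rewrite VS mulrDr [(z - lam i) * (_ * _)]mulrCA [(z - lam i) * (_ * _)]mulrCA tau'E //.
rewrite lowb_lt ?mul0r ?subr0 -?e_s //; last by case: o; lia.
by rewrite /lam /mu; ring.
Qed.

Let V_lower i : (u + o <= i)%N -> (i < N)%N ->
  (z - lam (opp i)) * ((z - lam i) * V i.+1) =
  (z - mu i) * ((z - lam (opp i)) * V i) - k i * c0 * s i * h ^+ 2 * c0 * V (opp i).
Proof.
move=> iu iN; have oN : (opp i < N)%N by lia.
have oo : opp (opp i) = i by lia.
have Eo : (z - lam (opp i)) * tau' (opp i) = d (opp i) ^+ 2 * V (opp i).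
  by rewrite tau'E // lowb_lt ?mul0r ?subr0 //; case: o iu iN => /=; lia.
rewrite VS mulrDr [(z - lam i) * (_ * _)]mulrCA [(z - lam i) * (_ * _)]mulrCA tau'E //.
rewrite lowb_ge // mul1r.
transitivity ((z - lam (opp i)) * ((z - lam i) * V i) +
   d i ^+ 2 * (k i * c0) * (s i * h) * ((z - lam (opp i)) * V i) -
   d i ^+ 2 * (k i * c0) * (s i * h) * h * (k i * k (opp i)) * c0 *
      ((z - lam (opp i)) * tau' (opp i))); first by ring.
rewrite Eo k_opp // -e_s'; [|by []|by case: o iu => //=; lia].
transitivity ((z - mu i) * ((z - lam (opp i)) * V i) - (k i * c0) * (e i - (e i)^-1) *
   h * c0 * (d i * d (opp i)) ^+ 2 * V (opp i)); first by rewrite /lam /mu; ring.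
rewrite d_opp // e_s'; [|by []|by case: o iu => //=; lia].
by ring.
Qed.

(** At z = [lam a], for a nonzero weight, this is the coefficient f(a). It is determined by the
    middle of the recurrence: Phi + Psi u = 1 for even m, and Phi + Psi u = 1 + h c0 / (z - c0) for
    odd m. *)
Definition Phi : F := if o then 1 + h * z * c0 / (z ^+ 2 - c0 ^+ 2)
  else 1 - h * q * c0 ^+ 2 / (z ^+ 2 - c0 ^+ 2).
Definition Psi (j : nat) : F := h * Wmir j * c0 ^+ 2 / (z ^+ 2 - c0 ^+ 2).
Definition ratio (i : nat) : F := (z - mu i) / (z - lam i).

Let PsiS j : (j < u)%N -> Psi j.+1 = e j ^+ 2 * Psi j.
Proof.
move=> ju; have jN : (j < N)%N by lia.
rewrite /Psi (WmirS ju) /Wmir ju; have ej := e_neq0 jN; field.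
by rewrite ej zc.
Qed.

Let V_mirror j : (j <= u)%N ->
  V (N - j)%N = V j * (Phi * (\prod_(j <= i < N - j) ratio i) + Psi j).
Proof.
(* Induction from the middle outwards, with j = u - t. *)
move=> ju; rewrite -(subKn ju); move: (u - j)%N (leq_subr j u) => t.
elim: t => [_|t IH tu].
  rewrite subn0; have -> : (N - u = u + o)%N by lia.
  rewrite /Psi /Wmir ltnn /Phi; case: (boolP o) => [ho|ho].
    have [eu su ku] := mid ho; have du := d_mid ho; have uN : (u < N)%N by rewrite ho; lia.
    have lu : lam u = c0 by rewrite /lam eu ku (d_mid ho); ring.
    have muu : mu u = c0 by rewrite /mu eu ku du invr1; ring.
    have := z_lam uN; rewrite lu => zc0.
    have zpc : z + c0 != 0 by apply: contraNneq zc => E; rewrite subr_sqr E mulr0.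
    rewrite ?ho addn1 big_nat1 /ratio lu muu divff // mulr1 VS su ku.
    have := tau'E uN; rewrite lowb_lt ?ho ?addn1 // lu du => E.
    have -> : tau' u = (z - c0)^-1 * V u.
      apply: (mulfI zc0); rewrite E [RHS]mulrA divff // mulr0n; ring.
    by field; rewrite zc q_neq0 zc0.
  rewrite ?(negPf ho) addn0 big_geq //.
  by rewrite -[LHS]mulr1; congr (_ * _); field; rewrite ?zc ?q_neq0.
have {IH} := IH (ltnW tu); have jS : (u - t = (u - t.+1).+1)%N by lia.
set j' := (u - t.+1)%N in jS *; rewrite jS => IH.
have ju' : (j' < u)%N by rewrite /j'; lia.
have jN : (j' < N)%N by lia.
have iN : (opp j' < N)%N by lia.
have oo : opp (opp j') = j' by lia.
have iu : (u + o <= opp j')%N by case: (o); lia.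
have SN : (opp j').+1 = (N - j')%N by lia.
have EL := V_lower iu iN; rewrite oo SN IH in EL.
have EU := V_upper ju'.
have zl1 := z_lam jN; have zl2 := z_lam iN.
apply: (mulfI zl1); apply: (mulfI zl2); rewrite [LHS]mulrCA EL.
rewrite (big_ltn (m := j')); last lia.
rewrite -SN (big_nat_recr (opp j')) /=; last lia.
set Pr := \prod_(_ <= _ < _) _.
transitivity ((z - mu (opp j')) * ((z - mu j') * V j') * (Phi * Pr + Psi j'.+1) -
    k (opp j') * c0 * s (opp j') * h ^+ 2 * c0 * V j').
  by rewrite -EU; ring.
transitivity (V j' * (Phi * Pr * ((z - mu j') * (z - mu (opp j'))) +
   (z - lam j') * (z - lam (opp j')) * Psi j')); last first.
  by rewrite /ratio; field; rewrite zl1 zl2.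
transitivity (V j' * (Phi * Pr * ((z - mu j') * (z - mu (opp j'))) +
   ((z - mu j') * (z - mu (opp j')) * Psi j'.+1 -
     k (opp j') * c0 * s (opp j') * h ^+ 2 * c0))); first by ring.
congr (_ * (_ + _)); rewrite PsiS // s_opp // /Psi /Wmir ju' /lam /mu.
have ej := e_neq0 jN; have kj := k_neq0 jN; have dj := d_neq0 jN.
rewrite e_opp // k_opp' //.
have -> : d (opp j') = (d j')^-1.
  by apply: (mulfI dj); rewrite d_opp // divff.
have -> : (k j')^-1 * c0 * s j' * h ^+ 2 * c0 = (k j')^-1 * c0 * (s j' * h) * h * c0 by ring.
rewrite -(e_s ju'); move: (q - q^-1) => H; field.
by rewrite zc kj dj ej.
Qed.

(** The trace is itself a complete partial sum: up to the factor h c0 and the shift by 1/z it is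
    [V N], which [V_mirror] gives at j = 0. *)
Lemma resolvent_trace : \sum_(i < N) s i * k i * tau i =
  (Phi * (\prod_(i < N) ratio i) + Psi 0 - Tpart N) / (c0 * h * z).
Proof.
have := V_mirror (leq0n u); rewrite subn0 big_mkord [V 0]/V big_ord0 addr0 => E.
have chz : c0 * h * z != 0 by rewrite !mulf_neq0.
apply: (mulIf chz); rewrite divfK //.
have -> : Phi * \prod_(i < N) ratio i + Psi 0 = z * V N.
  by rewrite E mulrA divff // mul1r.
rewrite /V /Tpart.
have -> : \sum_(j < N) s j * h * (k j * c0 * tau' j) = \sum_(j < N) s j * h * (k j * c0) * tau j
    - (\sum_(j < N) s j * h * (k j * c0)) * z^-1.
  by rewrite mulr_suml -sumrB; apply: eq_bigr => j _; rewrite /tau'; ring.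
rewrite mulr_suml; have -> : \sum_(i < N) s i * k i * tau i * (c0 * h * z) =
    z * \sum_(j < N) s j * h * (k j * c0) * tau j.
  by rewrite mulr_sumr; apply: eq_bigr => j _; ring.
by field.
Qed.
End Resolvent.

Hypotheses (lam_inj : forall i j, (i < N)%N -> (j < N)%N -> i != j -> lam i != lam j)
  (lam_c0 : forall i, (i < N)%N -> ~~ (o && (i == u)) -> lam i ^+ 2 - c0 ^+ 2 != 0).

Definition numPhi : {poly F} := 'X^2 - (c0 ^+ 2)%:P +
  if o then (h * c0)%:P * 'X else - (h * q * c0 ^+ 2)%:P.

Lemma PhiE z : z ^+ 2 - c0 ^+ 2 != 0 -> (z ^+ 2 - c0 ^+ 2) * Phi z = numPhi.[z].
Proof.
move=> zc; rewrite /Phi /numPhi !hornerE; case: (o); rewrite !hornerE.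
  by rewrite mulrDr mulr1; congr (_ + _); rewrite mulrC divfK //; ring.
by rewrite mulrBr mulr1; congr (_ - _); rewrite mulrC divfK //; ring.
Qed.

Lemma lam_neq0 i : (i < N)%N -> lam i != 0.
Proof.
by move=> iN; rewrite /lam !mulf_neq0 ?expf_neq0 ?e_neq0 ?k_neq0 ?d_neq0.
Qed.

(** * Residues of the trace *)

Section PartialFractions.
Variable c : 'I_N -> F.
Hypothesis cP : forall z, z != 0 -> z ^+ 2 - c0 ^+ 2 != 0 ->
  (forall i, (i < N)%N -> z - lam i != 0) ->
  \sum_a c a / (z - lam a) =
    (Phi z * (\prod_(i < N) ratio z i) + Psi z 0 - Tpart N) / (c0 * h * z).

Lemma prod_ratio (P : pred 'I_N) z : (forall i : 'I_N, z - lam i != 0) ->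
  (\prod_(i | P i) ratio z i) * (\prod_(i | P i) (z - lam i)) = \prod_(i | P i) (z - mu i).
Proof.
by move=> zl; rewrite -big_split; apply: eq_bigr => i _; rewrite /ratio /= divfK.
Qed.

Lemma residue_identity z : z != 0 -> z ^+ 2 - c0 ^+ 2 != 0 ->
  (forall i, (i < N)%N -> z - lam i != 0) ->
  c0 * h * z * (z ^+ 2 - c0 ^+ 2) * (\sum_a c a * \prod_(b | b != a) (z - lam b)) =
  numPhi.[z] * (\prod_(b < N) (z - mu b)) +
   (h * Wmir 0 * c0 ^+ 2 - Tpart N * (z ^+ 2 - c0 ^+ 2)) * (\prod_(b < N) (z - lam b)).
Proof.
move=> z0 zc zl; have zl' (i : 'I_N) : z - lam i != 0 by exact: zl.
have -> : \sum_a c a * \prod_(b | b != a) (z - lam b) =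
    (\sum_a c a / (z - lam a)) * \prod_(b < N) (z - lam b).
  rewrite mulr_suml; apply: eq_bigr => a _; rewrite [in RHS](bigD1 a) //= mulrA divfK //.
rewrite cP // -(PhiE zc) -(prod_ratio xpredT zl').
have chz : c0 * h * z != 0 by rewrite !mulf_neq0.
rewrite /Psi; move: (\prod_(i < N) ratio z i) (\prod_(i < N) (z - lam i)) => X Y.
move: (Phi z) (Tpart N) (Wmir 0) => P T W.
move: chz; move: (q - q^-1) => H chz.
have {chz} /andP[/andP[H0 C0] _] : (c0 != 0) && (H != 0) && true.
  by rewrite andbT; move: chz; rewrite !mulf_eq0 !negb_or => /andP[].
by field; rewrite zc z0 H0 C0.
Qed.

Lemma generic_poly0 (p : {poly F}) : (forall z, z != 0 -> z ^+ 2 - c0 ^+ 2 != 0 ->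
  (forall i, (i < N)%N -> z - lam i != 0) -> p.[z] = 0) -> p = 0.
Proof.
move=> H; apply: (@poly_cofinite _ _ (0 :: c0 :: - c0 :: [seq lam i | i <- iota 0 N])) => z.
rewrite !inE !negb_or => /and4P[z0 z1 z2 z3]; apply: H => //.
  by rewrite subr_sqr mulf_neq0 // ?subr_eq0 // addr_eq0.
move=> i iN; rewrite subr_eq0; apply: contraNneq z3 => ->.
by apply: map_f; rewrite mem_iota.
Qed.

(** After clearing denominators the identity is one of polynomials, hence holds at the excluded
    point z = [lam a] as well, where only the term of index a survives in the sum. *)
Lemma residue (a : 'I_N) : ~~ (o && (nat_of_ord a == u)) ->
  c0 * h * lam a * (lam a ^+ 2 - c0 ^+ 2) * c a =
  numPhi.[lam a] * (lam a - mu a) * \prod_(b < N | b != a) ratio (lam a) b.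
Proof.
move=> am.
pose p : {poly F} := (c0 * h)%:P * 'X * ('X^2 - (c0 ^+ 2)%:P) *
    (\sum_a (c a)%:P * \prod_(b < N | b != a) ('X - (lam b)%:P)) -
  numPhi * (\prod_(b < N) ('X - (mu b)%:P)) -
  ((h * Wmir 0 * c0 ^+ 2)%:P - (Tpart N)%:P * ('X^2 - (c0 ^+ 2)%:P)) *
     (\prod_(b < N) ('X - (lam b)%:P)).
have pE z : p.[z] = c0 * h * z * (z ^+ 2 - c0 ^+ 2) *
     (\sum_a c a * \prod_(b | b != a) (z - lam b)) -
   numPhi.[z] * (\prod_(b < N) (z - mu b)) -
   (h * Wmir 0 * c0 ^+ 2 - Tpart N * (z ^+ 2 - c0 ^+ 2)) * (\prod_(b < N) (z - lam b)).
  rewrite /p !(hornerE, horner_prod, horner_sum).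
  congr (_ * _ - _ * _ - _ * _).
  - by apply: eq_bigr => b _; rewrite !(hornerE, horner_prod); congr (_ * _);
      apply: eq_bigr => b' _; rewrite !hornerE.
  - by apply: eq_bigr => b _; rewrite !hornerE.
  - by apply: eq_bigr => b _; rewrite !hornerE.
have /(congr1 (fun p => p.[lam a])) : p = 0.
  apply: generic_poly0 => z z0 zc zl; rewrite pE residue_identity //; ring.
rewrite pE horner0 [\prod_(b < N) (_ - lam b)](bigD1 a) //= subrr mul0r mulr0 subr0.
rewrite (bigD1 a) //= [\sum_(i | i != a) _]big1 => [|b ba]; last first.
  by rewrite (bigD1 a) 1?eq_sym //= subrr mul0r mulr0.
have la (b : 'I_N) : b != a -> lam a - lam b != 0.
  by move=> ba; rewrite subr_eq0 lam_inj // eq_sym.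
have L0 : \prod_(b | b != a) (lam a - lam b) != 0 by apply/prodf_neq0 => b; exact: la.
rewrite addr0 => /eqP; rewrite subr_eq0 => /eqP E.
apply: (mulIf L0); rewrite -[LHS]mulrA E (bigD1 a) //= mulrA -[RHS]mulrA; congr (_ * _).
by rewrite -big_split; apply: eq_bigr => b ba; rewrite /ratio /= divfK // la.
Qed.

Lemma lam_mid : o -> lam u = c0.
Proof. by move=> ho; have [eu _ ku] := mid ho; rewrite /lam eu ku (d_mid ho); ring. Qed.

Lemma mu_mid : o -> mu u = c0.
Proof. by move=> ho; have [eu _ ku] := mid ho; rewrite /mu eu ku (d_mid ho) invr1; ring. Qed.

(** At the zero weight lam = mu = c0, so all terms have the factor z - c0, which is divided out
    before evaluating at c0. There the terms from [Phi] and [Psi] are equal by [mid_prod], and their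
    factor 2 cancels that of z + c0. *)
Lemma residue_mid (a : 'I_N) : o && (nat_of_ord a == u) ->
  c a = c0^-1 * \prod_(b < N | b != a) ratio (lam a) b.
Proof.
move=> /andP[ho /eqP au]; have la0 : lam a = c0 by rewrite au lam_mid.
have ma0 : mu a = c0 by rewrite au mu_mid.
pose p : {poly F} := (c0 * h)%:P * 'X * ('X + c0%:P) *
    (\sum_a (c a)%:P * \prod_(b < N | b != a) ('X - (lam b)%:P)) -
  numPhi * (\prod_(b < N | b != a) ('X - (mu b)%:P)) -
  ((h * Wmir 0 * c0 ^+ 2)%:P - (Tpart N)%:P * ('X^2 - (c0 ^+ 2)%:P)) *
     (\prod_(b < N | b != a) ('X - (lam b)%:P)).
have pE z : p.[z] = c0 * h * z * (z + c0) *
     (\sum_a c a * \prod_(b | b != a) (z - lam b)) -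
   numPhi.[z] * (\prod_(b < N | b != a) (z - mu b)) -
   (h * Wmir 0 * c0 ^+ 2 - Tpart N * (z ^+ 2 - c0 ^+ 2)) *
     (\prod_(b < N | b != a) (z - lam b)).
  rewrite /p !(hornerE, horner_prod, horner_sum).
  congr (_ * _ - _ * _ - _ * _).
  - by apply: eq_bigr => b _; rewrite !(hornerE, horner_prod); congr (_ * _);
      apply: eq_bigr => b' _; rewrite !hornerE.
  - by apply: eq_bigr => b _; rewrite !hornerE.
  - by apply: eq_bigr => b _; rewrite !hornerE.
have /(congr1 (fun p => p.[c0])) : p = 0.
  apply: generic_poly0 => z z0 zc zl.
  have zc0 : z - c0 != 0 by rewrite -la0; exact: zl.
  (* Multiplication by z - c0 restores the form of [residue_identity]. *)
  apply: (mulfI zc0); rewrite pE mulr0.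
  have := residue_identity z0 zc zl; rewrite subr_sqr.
  rewrite [\prod_(b < N) (_ - mu b)](bigD1 a) //= ma0.
  rewrite [\prod_(b < N) (_ - lam b)](bigD1 a) //= la0.
  move=> E; apply/eqP; rewrite -subr_eq0 subr0; apply/eqP.
  transitivity (c0 * h * z * ((z - c0) * (z + c0)) *
      (\sum_a c a * \prod_(b | b != a) (z - lam b)) -
    (numPhi.[z] * ((z - c0) * (\prod_(b < N | b != a) (z - mu b))) +
     (h * Wmir 0 * c0 ^+ 2 - Tpart N * ((z - c0) * (z + c0))) *
     ((z - c0) * \prod_(b < N | b != a) (z - lam b)))); first by ring.
  by rewrite E subrr.
rewrite pE horner0 (bigD1 a) //= [\sum_(i | i != a) _]big1 => [|b ba]; last first.
  by rewrite (bigD1 a) 1?eq_sym //= la0 subrr mul0r mulr0.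
have la (b : 'I_N) : b != a -> c0 - lam b != 0.
  by move=> ba; rewrite subr_eq0 -la0 lam_inj // eq_sym.
have L0 : \prod_(b < N | b != a) (c0 - lam b) != 0 by apply/prodf_neq0 => b; exact: la.
have rE : \prod_(b < N | b != a) ratio c0 b = Wmir 0.
  have lc i : (i < N)%N -> i != u -> c0 - lam i != 0.
    move=> iN iu; apply: (la (Ordinal iN)); apply: contraNneq iu => E.
    by have := congr1 val E; rewrite /= au => ->.
  rewrite /Wmir u_gt0 -(mid_prod lc ho) big_mkord; apply: eq_bigl => b.
  by rewrite -(inj_eq val_inj) /= au.
have mE : \prod_(b < N | b != a) (c0 - mu b) =
    Wmir 0 * \prod_(b < N | b != a) (c0 - lam b).
  rewrite -rE -big_split; apply: eq_bigr => b ba; rewrite /ratio /= divfK // la //.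
have numE : numPhi.[c0] = h * c0 ^+ 2.
  rewrite /numPhi ho !(hornerD, hornerM, hornerN, hornerXn, hornerC, hornerX); ring.
rewrite addr0 mE numE la0 rE => E; apply: (mulfI c0_neq0); rewrite mulrA divff // mul1r.
have chc : h * c0 ^+ 2 * 2%:R != 0 by rewrite !mulf_neq0 ?expf_neq0 // pnatr_eq0.
apply: (mulfI chc); apply: (mulIf L0); apply/eqP; rewrite -subr_eq0; apply/eqP.
rewrite -[RHS]E; ring.
Qed.
End PartialFractions.

Fixpoint iterT (r : nat) (i : nat) : F :=
  if r is r'.+1 then
    h^-1 * (d i ^+ 2 * (\sum_(j < N) tri i j * (k j * c0) * iterT r' j) - iterT r' i)
  else 1.

Definition fres (a : nat) : F :=
  if o then if a == u then 1 else 1 + h * (lam a * c0 / (lam a ^+ 2 - c0 ^+ 2))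
  else 1 - h * (q * c0 ^+ 2 / (lam a ^+ 2 - c0 ^+ 2)).

(** With (1, ..., 1) decomposed into eigenvectors of M, the same coefficients c_a give the resolvent
    trace as the sum of c_a / (z - lam_a) and the trace of the r-th iterate as the sum of c_a
    ((lam_a - 1) / h)^r. *)
Theorem trace_iterT r : \sum_(i < N) s i * k i * iterT r i =
  \sum_(a < N) s a * (c0^-1 * (e a)^-1) * fres a * ((lam a - 1) / h) ^+ r *
    \prod_(b < N | b != a) ratio (lam a) b.
Proof.
pose M (i j : 'I_N) := d i ^+ 2 * (tri i j * (k j * c0)).
have Mii i : M i i = lam i by rewrite /M /tri ltnn eqxx.
have [||U [UP U1]] := @eigen_decomp _ _ M.
- by move=> i j ij; rewrite /M /tri ij mul0r mulr0.
- move=> i j; rewrite !Mii => E; apply/eqP/negPn/negP => ij.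
  by have := lam_inj (ltn_ord i) (ltn_ord j) ij; rewrite E eqxx.
have {}UP a i : \sum_j M i j * U a j = lam a * U a i by rewrite UP Mii.
pose c a := \sum_(i < N) s i * k i * U a i.
have cP z : z != 0 -> z ^+ 2 - c0 ^+ 2 != 0 -> (forall i, (i < N)%N -> z - lam i != 0) ->
  \sum_a c a / (z - lam a) =
    (Phi z * (\prod_(i < N) ratio z i) + Psi z 0 - Tpart N) / (c0 * h * z).
  move=> z0 zc zl.
  (* The solution of (z - M) tau = (1, ..., 1) in the eigenvector expansion; [insub] only extends it
     to all natural numbers. *)
  pose tau i := \sum_(a < N) (if insub i is Some i' then U a i' else 0) / (z - lam a).
  have tauE (i : 'I_N) : tau i = \sum_a U a i / (z - lam a).
    by rewrite /tau; apply: eq_bigr => a _; rewrite valK.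
  rewrite -(resolvent_trace (tau := tau)) // => [|i iN].
    rewrite [RHS](eq_bigr (fun i : 'I_N => \sum_(a < N) s i * k i * U a i / (z - lam a))).
      by rewrite exchange_big; apply: eq_bigr => a _; rewrite mulr_suml.
    by move=> i _; rewrite tauE mulr_sumr; apply: eq_bigr => a _; rewrite mulrA.
  rewrite -(U1 (Ordinal iN)) (tauE (Ordinal iN)) /= mulr_sumr mulr_sumr.
  rewrite [X in _ - X](eq_bigr (fun j : 'I_N => \sum_a M (Ordinal iN) j * U a j / (z - lam a))).
    rewrite exchange_big -sumrB; apply: eq_bigr => a _.
    by rewrite -mulr_suml UP; field; rewrite zl.
  move=> j _; rewrite tauE !mulr_sumr; apply: eq_bigr => a _.
  by rewrite /M /=; ring.
have itE t (i : 'I_N) : iterT t i = \sum_(a < N) ((lam a - 1) / h) ^+ t * U a i.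
  elim: t i => [|t IH] i /=; first by rewrite -(U1 i); apply: eq_bigr => a _; rewrite mul1r.
  have -> : d i ^+ 2 * (\sum_(j < N) tri i j * (k j * c0) * iterT t j) =
     \sum_(a < N) ((lam a - 1) / h) ^+ t * (lam a * U a i).
    rewrite mulr_sumr [LHS](eq_bigr (fun j : 'I_N =>
       \sum_(a < N) ((lam a - 1) / h) ^+ t * (M i j * U a j))).
      rewrite exchange_big; apply: eq_bigr => a _.
      by rewrite -mulr_sumr UP.
    by move=> j _; rewrite IH !mulr_sumr; apply: eq_bigr => a _; rewrite /M; ring.
  rewrite IH -sumrB mulr_sumr; apply: eq_bigr => a _.
  by rewrite exprS; ring.
transitivity (\sum_(a < N) c a * ((lam a - 1) / h) ^+ r).
  rewrite (eq_bigr (fun i : 'I_N => \sum_(a < N) s i * k i * U a i * ((lam a - 1) / h) ^+ r)).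
    by rewrite exchange_big; apply: eq_bigr => a _; rewrite mulr_suml.
  by move=> i _; rewrite itE mulr_sumr; apply: eq_bigr => a _; ring.
apply: eq_bigr => a _; rewrite mulrAC; congr (_ * _); rewrite -mulrA mulrAC.
have aN := ltn_ord a; have ea := e_neq0 aN; rewrite /fres.
case: (boolP (o && (nat_of_ord a == u))) => am.
  rewrite (residue_mid cP am); case/andP: am => ho au.
  rewrite [if o then _ else _]ifT // ifT //.
  have [eu su _] := mid ho.
  have -> : e a = 1 by rewrite (eqP au).
  have -> : s a = 1 by rewrite (eqP au).
  by rewrite invr1; ring.
have lc := lam_c0 aN am; have l0 := lam_neq0 aN.
have chl : c0 * h * lam a * (lam a ^+ 2 - c0 ^+ 2) != 0 by exact: mulf_neq0 (mulf_neq0 (mulf_neq0 c0_neq0 h_neq0) l0) lc.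
apply: (mulfI chl); rewrite (residue cP am) -(PhiE lc).
have -> : lam a - mu a = lam a * (e a)^-1 * (s a * h).
  by rewrite -(e_s' aN am) /lam /mu; field.
have -> : Phi (lam a) = (if o then if nat_of_ord a == u then 1
    else 1 + h * (lam a * c0 / (lam a ^+ 2 - c0 ^+ 2))
  else 1 - h * (q * c0 ^+ 2 / (lam a ^+ 2 - c0 ^+ 2))).
  rewrite /Phi; move: am (lam a) => + la; move: (nat_of_ord a) => j.
  by case: (o) => /= [/negPf ->|_]; ring.
set X := (if o then _ else _); set Y := \prod_(b < _ | _) _; move: X Y (q - q^-1) => X Y H.
by field; rewrite c0_neq0 ea.
Qed.
End TriangularResolvent.

(** * Eigenvalues at regular weights *)

Section Spectrum.
Variables (R : realType) (m k : nat) (hq : R[i]).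
Local Notation C := R[i].
Local Notation l := (m./2).
Local Notation u := (k + l)%N.
Local Notation N := (u + u + odd m)%N.
Local Notation wt := (weight R m k).
Local Notation idx := (idx m k).
Local Notation eps := (@eps R m k).
Local Notation qpow := (qpow hq).
Local Notation rho2 := (rho R m k *+ 2).
Local Notation C0 := (C0 R m k).
Local Notation sg := (@sg R m k).
Local Notation kk := (@kk R m k hq).
Local Notation qh := (@qh R hq).
Hypotheses (m_gt2 : (2 < m)%N) (k_gt0 : (0 < k)%N) (qh_neq0 : qh != 0).
Implicit Types (a b x : idx) (L : wt) (G : idx -> C).

Lemma size_idx : N = (m + 2 * k)%N.
Proof. by have := odd_double_half m; lia. Qed.

Lemma rk_ltN a : (rk a < N)%N.
Proof. by rewrite size_idx; exact: rk_lt. Qed.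

Lemma rk_onto j : (j < N)%N -> exists a : idx, rk a = j.
Proof. by rewrite size_idx; exact: rk_surj. Qed.

Lemma rk_opp a : (N - (rk a).+1)%N = rk (bar a).
Proof. by rewrite size_idx rk_bar. Qed.

Definition rkO a : 'I_N := Ordinal (rk_ltN a).

Lemma rkO_bij : bijective rkO.
Proof.
apply: inj_card_bij => [a b /(congr1 val)/rk_inj//|].
by rewrite card_sum !card_ord size_idx.
Qed.

(** Transport along [rk] to sequences indexed by ranks; the value 0 stands at numbers that are not
    ranks. *)
Definition onrk G (j : nat) : C := if [pick a | rk a == j] is Some a then G a else 0.

Lemma onrkE G a : onrk G (rk a) = G a.
Proof.
by rewrite /onrk; case: pickP => [b /eqP/rk_inj->|/(_ a)] //; rewrite eqxx.
Qed.

Lemma self_bar a : (a == bar a) = odd m && (rk a == u).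
Proof.
rewrite -(inj_eq (@rk_inj m k)) -rk_opp; have := rk_ltN a.
case: (odd m) => /= H; last by apply/negP => /eqP; lia.
by apply/eqP/eqP; lia.
Qed.

Lemma eps_eq0 a : (eps a == 0) = odd m && (rk a == u).
Proof.
rewrite -self_bar; apply/eqP/eqP => [e0|ab].
  have := eps_self R a; rewrite e0 bil0r; case: (eqVneq a (bar a)) => [ab _|_ E].
    exact: ab.
  by have /eqP := E; rewrite eq_sym /sg signr_eq0.
have H : forall y : wt, bil y (eps a) = 0 by case: (self_bar_even R m_gt2 k_gt0 ab).
apply: contrapT => /eqP e0; have := eps_bar R a; rewrite -ab => /eqP.
rewrite -addr_eq0 -mulr2n -scaler_nat scaler_eq0 pnatr_eq0 /= => /eqP //.
by apply/eqP.
Qed.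

Lemma eps_self_upper a : (rk a < u)%N ->
  bil (eps a) (eps a) = if (rk a < k)%N then -1 else 1.
Proof.
move=> au; rewrite eps_self self_bar (ltn_eqF au) andbF /sg.
case: a au => [i|v] /= au; rewrite ?expr0 ?expr1; first by rewrite ifF //; lia.
have vk : (v < k)%N by move: au; case: ifP => // kv; have := odd_double_half m; lia.
by rewrite !vk.
Qed.

Lemma rho2_upper a : (rk a < u)%N -> bil rho2 (eps a) =
  if (rk a < k)%N then - ((2 * k)%:R - m%:R + 2 - 2 * (rk a).+1%:R)
  else m%:R - 2 * (rk a - k).+1%:R.
Proof.
move=> au; rewrite rho2E bil_wtof_eps /anti; case: a au => [i|v] /= au.
  rewrite [X in _ = if X then _ else _](_ : _ = false); last lia.
  by rewrite ifT; [rewrite addKn|lia].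
have vk : (v < k)%N by move: au; case: ifP => // kv; have := odd_double_half m; lia.
by rewrite !vk /= ifT //; lia.
Qed.

Lemma C0E : C0 = m%:R - (2 * k)%:R - 1.
Proof.
rewrite /Defs.C0 bilDr bil_deltan k_gt0 bilC rho2E bil_wtof_deltan k_gt0 eqxx /=; ring.
Qed.

Let c0 := qpow (- C0).
Let e := onrk (fun a => qpow (bil (eps a) (eps a))).
Let s := onrk sg.
Let kf := onrk kk.

Let onN (P : nat -> Prop) : (forall a, P (rk a)) -> forall j, (j < N)%N -> P j.
Proof. by move=> H j /rk_onto[a <-]. Qed.

Let u_gt0 : (0 < u)%N. Proof. by lia. Qed.
Let c0_neq0 : c0 != 0. Proof. exact: qpow_neq0. Qed.
Let e_neq0 : forall j, (j < N)%N -> e j != 0.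
Proof. by apply: onN => a; rewrite /e onrkE qpow_neq0. Qed.
Let k_neq0 : forall j, (j < N)%N -> kf j != 0.
Proof. by apply: onN => a; rewrite /kf onrkE qpow_neq0. Qed.
Let s_sq : forall j, (j < N)%N -> s j * s j = 1.
Proof. by apply: onN => a; rewrite /s onrkE sg_sq. Qed.
Let s_opp : forall j, (j < N)%N -> s (N - j.+1)%N = s j.
Proof. by apply: onN => a; rewrite /s rk_opp !onrkE sg_bar. Qed.
Let e_opp : forall j, (j < N)%N -> e (N - j.+1)%N = e j.
Proof. by apply: onN => a; rewrite /e rk_opp !onrkE eps_bar bilNl bilNr opprK. Qed.
Let k_opp : forall j, (j < N)%N -> kf j * kf (N - j.+1)%N = 1.
Proof. by apply: onN => a; rewrite /kf rk_opp !onrkE /kk eps_bar bilNr qpowNK. Qed.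

Let upper (P : nat -> Prop) : (forall a, (rk a < u)%N -> P (rk a)) ->
  forall j, (j < u)%N -> P j.
Proof.
by move=> H j ju; have [|a E] := @rk_onto j; [lia|rewrite -E in ju *; exact: H].
Qed.

Let e_s : forall j, (j < u)%N -> e j - (e j)^-1 = s j * qh.
Proof.
apply: upper => a au; rewrite /e /s !onrkE eps_self self_bar (ltn_eqF au) andbF.
by rewrite -qpowN qpow_sg.
Qed.

Let k_rec : forall j, (j.+1 < u)%N -> kf j / e j = kf j.+1 * e j.+1.
Proof.
move=> j j1; have [|a aE] := @rk_onto j; first lia.
have [|b bE] := @rk_onto j.+1; first lia.
rewrite -bE -aE /kf /e !onrkE /kk -qpowB -qpowD; congr (qpow _).
rewrite !rho2_upper ?eps_self_upper ?aE ?bE //; try lia.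
case: (ltnP j.+1 k) => j1k.
  have -> : (j < k)%N by lia.
  by rewrite -[j.+2%:R]natr1; ring.
case: ifP => jk.
  have -> : (j.+1 - k = 0)%N by lia.
  have -> : (2 * k)%:R = 2 * j.+1%:R :> C by rewrite natrM; congr (_ * _%:R); lia.
  by ring.
have -> : (j.+1 - k = (j - k).+1)%N by lia.
by rewrite -[(_ - k).+2%:R]natr1; ring.
Qed.

Let k_last : kf u.-1 / e u.-1 = if odd m then 1 else (qpow 1)^-1.
Proof.
have [|a aE] := @rk_onto u.-1; first lia.
rewrite -aE /kf /e !onrkE /kk -qpowB rho2_upper ?eps_self_upper ?aE; try lia.
have -> : (u.-1 < k)%N = false by lia.
have -> : (u.-1 - k).+1 = l by lia.
have -> : m%:R = 2 * l%:R + (odd m)%:R :> C.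
  by rewrite -natrM -natrD; congr (_%:R); have := odd_double_half m; lia.
case: (odd m) => /=; first by rewrite -[RHS](qpow0 hq); congr (qpow _); ring.
by rewrite -qpowN; congr (qpow _); ring.
Qed.

Let k_first : kf 0 * c0 * e 0 = 1.
Proof.
have [|a aE] := @rk_onto 0; first lia.
rewrite -aE /kf /e !onrkE /kk -!qpowD -[RHS](qpow0 hq); congr (qpow _).
rewrite rho2_upper ?eps_self_upper ?aE ?k_gt0; try lia.
rewrite C0E; ring.
Qed.

Let mid : odd m -> [/\ e u = 1, s u = 1 & kf u = 1].
Proof.
move=> mo; have [|a aE] := @rk_onto u; first by rewrite mo; lia.
have /eqP ab : a == bar a by rewrite self_bar mo aE eqxx.
have [sa H] := self_bar_even R m_gt2 k_gt0 ab.
by rewrite -aE /e /s /kf !onrkE sa /kk !H qpow0.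
Qed.

Let triE a x : tri u (odd m) (qpow 1) e s kf (rk a) (rk x) = Pform hq a x.
Proof.
rewrite /tri rk_opp !(inj_eq (@rk_inj m k)) /e /s /kf !onrkE /Pform //.
Qed.

Lemma Pform_kappa a : \sum_x Pform hq a x * (kk x * qpow (- C0)) = 1.
Proof.
rewrite -(tri_kappa u_gt0 (qpow_neq0 hq 1) qh_neq0 c0_neq0 e_neq0 k_neq0 s_sq s_opp
  e_opp k_opp e_s k_rec k_last k_first mid (rk_ltN a)).
rewrite [RHS](reindex rkO) /=; last exact: onW_bij rkO_bij.
by apply: eq_bigr => x _; rewrite triE /kf onrkE.
Qed.

Section FixedWeight.
Variable L : wt.
Let d := onrk (fun a => qpow (bil (eps a) L)).

Let d_neq0 : forall j, (j < N)%N -> d j != 0.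
Proof. by apply: onN => a; rewrite /d onrkE qpow_neq0. Qed.
Let d_opp : forall j, (j < N)%N -> d j * d (N - j.+1)%N = 1.
Proof. by apply: onN => a; rewrite /d rk_opp !onrkE eps_bar bilNl qpowNK. Qed.
Let d_mid : odd m -> d u = 1.
Proof.
move=> mo; have [|a aE] := @rk_onto u; first by rewrite mo; lia.
have /eqP a0 : eps a == 0 by rewrite eps_eq0 mo aE eqxx.
by rewrite -aE /d onrkE a0 bil0l qpow0.
Qed.

(** Only q - q^-1 is inverted here, never a difference of eigenvalues, so these numbers make sense
    and are continuous at every weight L. *)
Fixpoint tE (r : nat) (a : idx) : C :=
  if r is r'.+1 then
    qh^-1 * (qpow (bil (eps a) L) ^+ 2 *
      (\sum_x Pform hq a x * (kk x * qpow (- C0)) * tE r' x) - tE r' a)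
  else 1.

Let tE_iterT r a : tE r a = iterT u (odd m) (qpow 1) c0 e s kf d r (rk a).
Proof.
elim: r a => //= r IH a; rewrite IH; congr (_ * (_ * _ - _)); first by rewrite /d onrkE.
rewrite [RHS](reindex rkO) /=; last exact: onW_bij rkO_bij.
by apply: eq_bigr => x _; rewrite triE IH /kf onrkE.
Qed.

Let lamE a : lam c0 e kf d (rk a) = qpow (xplus L a) * c0.
Proof.
rewrite /lam /e /kf /d !onrkE /c0 /kk -qpowMn -!qpowD; congr (qpow _).
rewrite /xplus (bilDr _ (_ + _)) (bilDr _ (eps a)) (bilMnr _ L) (bilC rho2).
by ring.
Qed.

Let muE a : mu c0 e kf d (rk a) = qpow (xminus L a) * c0.
Proof.
rewrite /mu /e /kf /d !onrkE /c0 /kk -qpowMn -qpowN -!qpowD; congr (qpow _).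
rewrite /xminus (bilDr _ (_ + _)) bilNr (bilDr _ rho2) (bilMnr _ L) (bilC rho2); by ring.
Qed.

Lemma trace_tE r : regular_wt hq L ->
  \sum_a sg a * kk a * tE r a = eigen_formula hq r L.
Proof.
move=> [reg1 reg2].
have lam_inj i j : (i < N)%N -> (j < N)%N -> i != j ->
    lam c0 e kf d i != lam c0 e kf d j.
  move=> /rk_onto[a <-] /rk_onto[b <-]; rewrite (inj_eq (@rk_inj m k)) => ab.
  by rewrite !lamE (inj_eq (mulIf c0_neq0)) reg1.
have xx2 a : qpow (2 * xplus L a) = qpow (xplus L a) ^+ 2.
  by rewrite -qpowMn mulr_natl.
have lc i : (i < N)%N -> ~~ (odd m && (i == u)) -> lam c0 e kf d i ^+ 2 - c0 ^+ 2 != 0.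
  move=> /rk_onto[a <-]; rewrite -eps_eq0 => /reg2; rewrite lamE exprMn xx2 => H.
  by rewrite -[X in _ - X]mul1r -mulrBl mulf_neq0 ?expf_neq0 // subr_eq0.
have := trace_iterT u_gt0 (qpow_neq0 hq 1) qh_neq0 c0_neq0 e_neq0 k_neq0 s_sq s_opp
  e_opp k_opp e_s k_rec k_last k_first mid d_neq0 d_opp d_mid lam_inj lc r.
rewrite (reindex rkO) /=; last exact: onW_bij rkO_bij.
rewrite (eq_bigr (fun a => sg a * kk a * tE r a)) => [->|a _]; last first.
  by rewrite -tE_iterT /s /kf !onrkE.
rewrite (reindex rkO) /=; last exact: onW_bij rkO_bij.
apply: eq_bigr => a _.
have -> : (lam c0 e kf d (rk a) - 1) / qh = (qpow (xplus L a - C0) - 1) / (qpow 1 - (qpow 1)^-1).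
  by rewrite lamE /c0 -qpowD.
congr (_ * _ * _ * _).
- by rewrite /s /e !onrkE (qpowB _ C0 (bil _ _)) /c0 qpowN invrK.
- rewrite /fres lamE /fcoef xx2; case: (boolP (odd m)) => mo /=.
    have -> : (rk a == u) = (eps a == 0) by rewrite eps_eq0 mo.
    case: (eqVneq (eps a) 0) => // ea; congr (1 + _ * _).
    have := reg2 a ea; rewrite xx2 -subr_eq0; move: (qpow (xplus L a)) => X H.
    have H2 : (X * c0) ^+ 2 - c0 ^+ 2 != 0.
      by rewrite exprMn -[X in _ - X]mul1r -mulrBl mulf_neq0 ?expf_neq0.
    by field; rewrite H H2.
  congr (1 - _ * _).
  have ea : eps a != 0 by rewrite eps_eq0 (negPf mo).
  have := reg2 a ea; rewrite xx2 -subr_eq0; move: (qpow (xplus L a)) => X H.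
  have H2 : (X * c0) ^+ 2 - c0 ^+ 2 != 0.
    by rewrite exprMn -[X in _ - X]mul1r -mulrBl mulf_neq0 ?expf_neq0.
  by field; rewrite H H2.
- rewrite (reindex rkO) /=; last exact: onW_bij rkO_bij.
  apply: eq_big => [b|b _]; first by rewrite (inj_eq (bij_inj rkO_bij)).
  by rewrite /ratio muE !lamE -!mulrBl -mulf_div divff // mulr1.
Qed.
End FixedWeight.
End Spectrum.

(** * Continuity in the weight *)

Section CexpContinuous.
Variable R : realType.
Local Notation C := R[i].

Lemma Re_continuous : continuous (fun z : C => complex.Re z).
Proof.
move=> z; apply/(@cvgrPdist_lt _ _ _ _ (nbhs_filter z)) => e e0.
have ec : 0 < Complex e 0 by rewrite ltcE /= eqxx.
apply: filterS (nbhsx_ballx z _ ec) => w H; rewrite -raddfB.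
have := le_lt_trans (normc_ge_Re (z - w)) H.
by rewrite ltcE /= eqxx.
Qed.

Lemma real_complex_continuous : continuous (fun x : R => x%:C%C).
Proof.
(* A positive element of R[i] is real, so the radius has imaginary part 0. *)
move=> x; apply/(@cvgrPdist_lt _ C _ _ (nbhs_filter x)) => -[e e']; rewrite ltcE /= => /andP[/eqP -> e0].
apply: filterS (nbhsx_ballx x _ e0) => y H.
by rewrite -rmorphB /= normc_def /= expr0n /= addr0 sqrtr_sqr ltcE /= eqxx.
Qed.

Lemma mulC_continuous (T : topologicalType) (f g : T -> C) :
  continuous f -> continuous g -> continuous (fun x => f x * g x).
Proof. by move=> cf cg x; apply: cvgM; [exact: cf|exact: cg]. Qed.

Lemma addC_continuous (T : topologicalType) (f g : T -> C) :
  continuous f -> continuous g -> continuous (fun x => f x + g x).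
Proof. by move=> cf cg x; apply: cvgD; [exact: cf|exact: cg]. Qed.

Lemma sumC_continuous (T : topologicalType) (I : finType) (f : I -> T -> C) :
  (forall i, continuous (f i)) -> continuous (fun x => \sum_i f i x).
Proof.
by move=> cf; apply: continuous_big => [|i _]; [exact: add_continuous|exact: cf].
Qed.

Lemma Im_continuous : continuous (fun z : C => complex.Im z).
Proof.
have -> : (fun z : C => complex.Im z) = (@complex.Re R) \o (fun z => - 'i%C * z).
  by apply/funext => -[a b] /=; ring.
move=> z; apply: continuous_comp; last exact: Re_continuous.
by apply: mulC_continuous => [|w]; [exact: cst_continuous|exact: cvg_id].
Qed.

Lemma cexp_continuous : continuous (@cexp R).
Proof.
have -> : @cexp R = (fun z => (expR (complex.Re z))%:C%C *
    ((cos (complex.Im z))%:C%C + 'i%C * (sin (complex.Im z))%:C%C)).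
  apply/funext => -[a b]; rewrite /cexp /=.
  by apply/eqP; rewrite eq_complex /=; apply/andP; split; apply/eqP; ring.
have H (f : R -> R) (g : C -> R) : continuous f -> continuous g ->
    continuous (fun z => (f (g z))%:C%C).
  move=> cf cg z; apply: (@continuous_comp _ _ _ (f \o g) (fun x => x%:C%C)).
    by apply: continuous_comp; [exact: cg|exact: cf].
  exact: real_complex_continuous.
apply: mulC_continuous; first exact: (H _ _ (@continuous_expR R) Re_continuous).
apply: addC_continuous; first exact: (H _ _ (@continuous_cos R) Im_continuous).
apply: mulC_continuous; first exact: cst_continuous.
exact: (H _ _ (@continuous_sin R) Im_continuous).
Qed.
End CexpContinuous.

Section EigenContinuous.
Variables (R : realType) (m k : nat) (hq : R[i]).
Local Notation C := R[i].
Local Notation wt := (weight R m k).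

Lemma bil_continuous (y : wt) : continuous (bil y : wt -> C).
Proof.
apply: addC_continuous.
  apply: sumC_continuous => i; apply: mulC_continuous; first exact: cst_continuous.
  move=> L; apply: (@continuous_comp _ _ _ fst (fun M : 'rV[C]_(m./2) => M 0 i)).
    exact: cvg_fst.
  exact: coord_continuous.
move=> L; apply: cvgN; move: L; apply: sumC_continuous => i.
apply: mulC_continuous; first exact: cst_continuous.
move=> L; apply: (@continuous_comp _ _ _ snd (fun M : 'rV[C]_k => M 0 i)).
  exact: cvg_snd.
exact: coord_continuous.
Qed.

Lemma tE_continuous r (a : idx m k) : continuous (fun L : wt => tE hq L r a).
Proof.
elim: r a => [|r IH] a /=; first exact: cst_continuous.
apply: mulC_continuous; first exact: cst_continuous.
apply: addC_continuous; last by move=> L; apply: cvgN; exact: IH.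
have qc : continuous (fun L : wt => qpow hq (bil (eps R a) L)).
  move=> L; apply: (@continuous_comp _ _ _ (fun L => hq * bil (eps R a) L) (@cexp R)).
    by apply: mulC_continuous; [exact: cst_continuous|exact: bil_continuous].
  exact: cexp_continuous.
apply: mulC_continuous; first by apply: mulC_continuous.
apply: sumC_continuous => x; apply: mulC_continuous; last exact: IH.
exact: cst_continuous.
Qed.

(** At regular weights the formula agrees with a function continuous at every weight, so its limit
    is the value of that function at L. *)
Lemma eigen_formula_cvg r (L : wt) :
  (2 < m)%N -> (0 < k)%N -> qh hq != 0 ->
  (eigen_formula hq r L' @[L' --> within (regular_wt hq) (nbhs L)] -->
    \sum_a sg R a * kk hq a * tE hq L r a)%classic.
Proof.
move=> m2 k0 h0.
have tc : continuous (fun L' : wt => \sum_a sg R a * kk hq a * tE hq L' r a).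
  apply: sumC_continuous => a; apply: mulC_continuous; first exact: cst_continuous.
  exact: tE_continuous.
move=> A nA; have {}nA : nbhs L (fun L' => A (\sum_a sg R a * kk hq a * tE hq L' r a)).
  exact: tc.
change (nbhs L (fun L' => regular_wt hq L' -> A (eigen_formula hq r L'))).
by apply: filterS nA => L' + reg; rewrite trace_tE.
Qed.
End EigenContinuous.

(** * The Casimir invariants *)

Section Casimir.
Variables (R : realType) (m k : nat) (hq : R[i]).
Local Notation C := R[i].
Local Notation wt := (weight R m k).
Local Notation U := (Uosp m k hq).
Local Notation UU := (stens U U).
Local Notation EndV := (smx (@gr m k) C^o).
Hypotheses (m_gt2 : (2 < m)%N) (k_gt0 : (0 < k)%N).
Variable Delta : shom U UU.
Hypothesis DeltaP : is_coproduct Delta.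
Variable pi : shom U EndV.
Hypothesis piP : is_vector_rep pi.
Variable Rm : completion (@adm R m k hq).
Hypotheses (RmP : universal_R Delta Rm) (RmD : double_form Rm).

Lemma casimirE r : casimir pi Rm r =
  \sum_a cst ((-1) ^+ gr a * qpow hq (bil (rho R m k *+ 2) (eps R a))) *
    (casimirA pi Rm ^+ r) (a, a).
Proof.
apply: eq_bigr => a _; rewrite smx_mull_inl cstM -mulrA; congr (_ * _).
rewrite (bigD1 a) //= big1 => [|b ba]; first by rewrite addr0 (pi_uqE piP) eqxx.
by rewrite (pi_uqE piP) eq_sym (negPf ba) cst0l.
Qed.

Lemma invariant_casimirA_exp r : invariant Delta pi (casimirA pi Rm ^+ r).
Proof. exact: invariantX (invariant_casimirA m_gt2 k_gt0 piP RmP). Qed.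

Lemma casimir_central r (x : U) : casimir pi Rm r * x = x * casimir pi Rm r.
Proof.
by rewrite casimirE; apply: (strq_central m_gt2 k_gt0 DeltaP piP (invariant_casimirA_exp r)).
Qed.

Lemma casimir_highest_weight r (W : lmodType C) (a : U -> W -> W) (L : wt) :
  qh hq != 0 -> is_action a -> highest_weight a L ->
  forall w, a (casimir pi Rm r) w =
    (\sum_b sg R b * kk hq b * tE hq L r b) *: w.
Proof.
move=> h0 aP [v [v0 vg ve vh vq]] w.
rewrite (central_scalar m_gt2 k_gt0 aP vg ve vh vq (casimir_central r)); congr (_ *: _).
set f := vst _ _ _ _ _ _ _.
have fD w1 w2 : f (w1 + w2) = f w1 + f w2 by exact: vstD.
have fZ z w1 : f (z *: w1) = z * f w1 by exact: vstZ.
have tP t b : hwe a v f (casimirA pi Rm ^+ t) b = tE hq L t b.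
  elim: t b => [|t IH] b.
    by rewrite expr0 /hwe -(@cst1 _ (smx _ _)) smx_cstE eqxx (act_cst aP) scale1r /f vst_v.
  (* The weights given for [kap] are those whose row sums [Pform_kappa] normalises to 1. *)
  rewrite exprS (casimirA_hwe m_gt2 k_gt0 DeltaP piP RmP RmD aP fD fZ vq vh
    (vst_q m_gt2 k_gt0 aP v0 vg ve vh vq) (vst_h m_gt2 k_gt0 aP v0 vg ve vh vq)
    (borel_ue_v aP ve vh vq) (borel_uf_vst m_gt2 k_gt0 aP v0 vg ve vh vq)
    (kap := fun x => kk hq x * qpow hq (- C0 R m k)) _ b (invariant_casimirA_exp t)).
    rewrite IH /=; congr (_ * (_ * _ - _)); apply: eq_bigr => x _.
    by rewrite IH -(Pcoef_form m_gt2 k_gt0 DeltaP piP RmP RmD).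
  move=> c; rewrite -[RHS](Pform_kappa m_gt2 k_gt0 h0 c); apply: eq_bigr => x _.
  by rewrite -(Pcoef_form m_gt2 k_gt0 DeltaP piP RmP RmD).
have f0 : f 0 = 0 by rewrite -(scale0r (0 : W)) fZ mul0r.
rewrite casimirE (act_suml aP) (big_morph f fD f0); apply: eq_bigr => b _.
by rewrite (act_cstM aP) fZ -tP.
Qed.
End Casimir.

Theorem theorem6p4p1 (R : realType) (m k : nat) (q hq : R[i])
  (m_gt2 : (2 < m)%N) (k_gt0 : (0 < k)%N)
  (q_neq0 : q != 0) (hqE : cexp hq = q)
  (q_nroot : forall j : nat, (0 < j)%N -> q ^+ j != 1)
  (Delta : shom (Uosp m k hq) (stens (Uosp m k hq) (Uosp m k hq)))
  (DeltaP : is_coproduct Delta)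
  (pi : shom (Uosp m k hq) (smx (@gr m k) (R[i])^o))
  (piP : is_vector_rep pi)
  (Rm : completion (@adm R m k hq))
  (RmP : universal_R Delta Rm) (RmD : double_form Rm) :
  (forall r : nat, (0 < r)%N ->
     forall x : Uosp m k hq, casimir pi Rm r * x = x * casimir pi Rm r) /\
  (forall r : nat, (0 < r)%N ->
     forall (W : vectType R[i]) (a : Uosp m k hq -> W -> W) (L : weight R m k),
       is_action a -> irreducible a -> highest_weight a L ->
       exists chi : R[i],
         (forall v : W, a (casimir pi Rm r) v = chi *: v) /\
         eigen_value hq r L chi).
Proof.
have qh_neq0 : qh hq != 0.
  have := q_nroot 2 isT; rewrite /qh /qpow mulr1 hqE; apply: contraNneq => /eqP.
  by rewrite subr_eq0 expr2 => /eqP E; rewrite {1}E mulVf.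
split=> [r _ x|r _ W a L aP _ aL].
  exact: (casimir_central m_gt2 k_gt0 DeltaP piP RmP).
exists (\sum_b sg R b * kk hq b * tE hq L r b); split=> [v|].
  exact: (casimir_highest_weight m_gt2 k_gt0 DeltaP piP RmP RmD).
by split=> [reg|_]; [exact: trace_tE|exact: eigen_formula_cvg].
Qed.
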